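(* Let $V$ be a finite-dimensional real Euclidean space and let $G\subset \mathbf{O}(V)$ be a compact Lie group acting linearly on $V$, with Lie algebra $\mathfrak{g}$ and identity component $G^0$. Let $n_1\ge\dots\ge n_l>1=n_{l+1}=\dots=n_L$ be the dimensions of the irreducible components (counted with multiplicity) of the real representation of $\mathfrak{g}$ on $V$. If $\mathfrak{g}\cong\mathfrak{su}_2$, $G=G^0$, $l=1$ and $n_1=8$, then $V/G\cong\mathbb{R}^5$.
   Context: $V/G$ denotes the orbit space with the quotient topology, and $\cong$ means homeomorphic. The conclusion is given as printed in the paper; the paper's proof begins by saying that one may take the subspace $V_0=\{v\in V:\mathfrak{g}v=0\}$ to be trivial, and then treats the irreducible 8-dimensional representation.
   Formalization: As printed the claim fails when some irreducible components have dimension 1 (for V = R^8 + R the quotient is R^6); proved instead: V/G is homeomorphic to R^5 if V_0 = {v : gv = 0} is trivial, and to R^5 x V_0 in general. *)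

(* Defs.v *)
From HB Require Import structures.
From mathcomp Require Import all_boot all_order all_algebra.
From mathcomp Require Import all_classical all_reals all_analysis.
From mathcomp Require Export generic_quotient complex.

Set Implicit Arguments.
Unset Strict Implicit.
Unset Printing Implicit Defensive.

Import Order.TTheory GRing.Theory Num.Theory.
Import numFieldNormedType.Exports.

Local Open Scope classical_set_scope.
Local Open Scope ring_scope.

(** The Euclidean space V is 'cV[R]_n with its standard inner product, and
    matrices act on it by left multiplication. *)

(** By Cartan's closed subgroup theorem, the compact Lie groups G in O(V) are
    exactly the compact subsets of 'M[R]_n satisfying these axioms. *)
Record compact_orthogonal_group (R : realType) (n : nat) := CompactOrthogonalGroup {
  group_carrier :> set 'M[R]_n;
  group_orthogonal : forall g, group_carrier g -> g^T *m g = 1%:M;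
  group_one : group_carrier 1%:M;
  group_mul : forall g h,
    group_carrier g -> group_carrier h -> group_carrier (g *m h);
  group_inv : forall g, group_carrier g -> group_carrier (invmx g);
  group_compact : compact group_carrier }.

Definition identity_component (R : realType) (n : nat)
    (G : compact_orthogonal_group R n) : set 'M[R]_n :=
  connected_component G 1%:M.

Definition expmx (R : realType) (n : nat) (A : 'M[R]_n) : 'M[R]_n :=
  limn (series (fun k : nat => (k`!%:R)^-1 *: A ^+ k)).

Definition lie_algebra (R : realType) (n : nat)
    (G : compact_orthogonal_group R n) : set 'M[R]_n :=
  [set A | forall t : R, (G : set _) (expmx (t *: A))].

Definition lie_bracket (S : pzRingType) (n : nat) (A B : 'M[S]_n) : 'M[S]_n :=
  A *m B - B *m A.

Definition su (R : realType) (n : nat) : set 'M[R[i]]_n :=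
  [set X | (map_mx conjc X)^T = - X /\ \tr X = 0].
Arguments su : clear implicits.

(** Isomorphism, as real Lie algebras, of a Lie algebra [g] of real matrices
    with [su R m]; [phi] only matters on [su R m]. *)
Definition isomorphic_to_su (R : realType) (m n : nat) (g : set 'M[R]_n) : Prop :=
  exists phi : 'M[R[i]]_m -> 'M[R]_n,
    [/\ set_bij (su R m) g phi,
        forall (a : R) (X Y : 'M[R[i]]_m), su R m X -> su R m Y ->
          phi ((a%:C)%C *: X + Y) = a *: phi X + phi Y
      & forall X Y : 'M[R[i]]_m, su R m X -> su R m Y ->
          phi (lie_bracket X Y) = lie_bracket (phi X) (phi Y)].

Definition invariant_subspace (R : realType) (n : nat) (g : set 'M[R]_n)
    (U : {vspace 'cV[R]_n}) : Prop :=
  forall A v, g A -> v \in U -> A *m v \in U.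

Definition irreducible_subspace (R : realType) (n : nat) (g : set 'M[R]_n)
    (U : {vspace 'cV[R]_n}) : Prop :=
  [/\ invariant_subspace g U, U != 0%VS
    & forall W : {vspace 'cV[R]_n},
        invariant_subspace g W -> (W <= U)%VS -> W = 0%VS \/ W = U].

(** [d] is the nonincreasing list of the dimensions, counted with multiplicity,
    of the irreducible components of the representation of [g] on R^n. *)
Definition irreducible_dimensions (R : realType) (n : nat) (g : set 'M[R]_n)
    (d : seq nat) : Prop :=
  sorted geq d /\
  exists U : 'I_(size d) -> {vspace 'cV[R]_n},
    [/\ forall i, irreducible_subspace g (U i),
        directv (\sum_(i < size d) U i)%VS,
        (\sum_(i < size d) U i)%VS = fullv
      & forall i, \dim (U i) = nth 0%N d i].

Section OrbitSpace.
Variables (R : realType) (n : nat) (G : compact_orthogonal_group R n).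

Definition orbit_rel : rel 'cV[R]_n :=
  fun v w => `[< exists2 g, (G : set _) g & w = g *m v >].

Lemma orbit_rel_refl : reflexive orbit_rel.
Proof.
by move=> v; apply/asboolP; exists 1%:M; rewrite ?mul1mx //; exact: group_one.
Qed.

Lemma orbit_rel_sym : symmetric orbit_rel.
Proof.
suff imp v w : orbit_rel v w -> orbit_rel w v by move=> v w; apply/idP/idP => /imp.
move=> /asboolP[g Gg ->]; apply/asboolP.
have gU : g \in unitmx by have /mulmx1_unit[] := group_orthogonal Gg.
by exists (invmx g); [exact: group_inv | rewrite mulKmx].
Qed.

Lemma orbit_rel_trans : transitive orbit_rel.
Proof.
move=> w v u /asboolP[g Gg ->] /asboolP[h Gh ->]; apply/asboolP.
by exists (h *m g); [exact: group_mul | rewrite mulmxA].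
Qed.

Definition orbit_equiv : equiv_rel 'cV[R]_n :=
  EquivRel orbit_rel orbit_rel_refl orbit_rel_sym orbit_rel_trans.

(** V/G with the quotient topology. *)
Definition orbit_space : topologicalType :=
  quotient_topology {eq_quot orbit_equiv}%qT.

End OrbitSpace.

Definition homeomorphic (X Y : topologicalType) : Prop :=
  exists (f : X -> Y) (f' : Y -> X),
    [/\ continuous f, continuous f', cancel f f' & cancel f' f].

(* Main.v *)
(** The irreducible 8-dimensional real representation of su(2) is the spin 3/2
    representation: unit quaternions k act on
    W = {p in H^3 | e1 p1 + e2 p2 + e3 p3 = 0}, H^3 being 3 x 4 matrices, by
    p |-> O(k) p L(k), the rotation of the index times left multiplication.
    Right multiplications commute with this action. The matrices
    S_b = p R(e_b) p^T have an invariant Gram matrix C(p), which is conjugated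
    by a rotation when p is multiplied on the right by a unit quaternion; its
    traceless part gives the map W -> R^5 inducing the homeomorphism.

    Maximizing the scalar product with a regular point over left and right
    factors moves p to a point (x1 e1, x2 e2, x3 e3) with x1 + x2 + x3 = 0 and
    x1 >= x2 >= 0, where C is diagonal with entries x2^2 x3^2, x1^2 x3^2,
    x1^2 x2^2. The differences of these entries map this chamber bijectively
    onto a chamber of traceless diagonal matrices, so the traceless part of C
    separates the orbits of W and is onto R^5; it is moreover proper.

    Weight strings identify the nontrivial part of V with W, and Euler's
    approximation of exp shows that exp(Lie G) acts on it as the group of unit
    quaternions. Since a closed subgroup of a connected compact group G that
    contains exp(Lie G) is G, the orbits of G are those of the unit quaternions,
    and a proper continuous surjection separating them is a homeomorphism on the
    quotient. *)

Require Import Defs.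
From HB Require Import structures.
From mathcomp Require Import all_boot all_order all_algebra.
From mathcomp Require Import all_classical all_reals all_analysis.
From mathcomp Require Import ring lra.

Set Implicit Arguments.
Unset Strict Implicit.
Unset Printing Implicit Defensive.

Import Order.TTheory GRing.Theory Num.Theory.
Import numFieldNormedType.Exports.

Local Open Scope classical_set_scope.
Local Open Scope ring_scope.

(** * Matrix limits and the exponential *)

(** Right multiplications are the reason why five polynomials suffice: they act on the orbits of the
    left factors, and the Gram matrix follows them by conjugation. Left and right factors together
    carry every point of [W] into the plane of section points, where the permutations and the sign
    change of [(x1, x2, x3)] remain, a group of order 12 with chamber [x1 >= x2 >= 0]. For the left
    factors alone two questions are then left: whether the eigenvalue gaps of the Gram matrix
    determine the chamber point, and whether a right factor that fixes the Gram matrix can be traded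
    for a left factor. The second is delicate on the wall [x2 = 0], where the Gram matrix has a
    double eigenvalue although the section coordinates are distinct.

    First-order conditions at maxima come without derivatives: on circles of unit quaternions the
    functions are forms of degree at most four, and elsewhere a quadratic error bound for [exp]
    suffices. Trivial summands of [V] are kept throughout; they contribute the factor [V0]. *)

Section MatrixLimits.
Variable R : realType.

Lemma cvg_mx_entries {T : Type} (F : set_system T) {FF : Filter F} m n
    (f : T -> 'M[R]_(m, n)) (A : 'M[R]_(m, n)) :
  (forall i j, (fun x => f x i j) @ F --> A i j) -> f @ F --> A.
Proof.
move=> fA B [P AP PB].
have : F (fun x => forall i, forall j, P i j (f x i j)).
  apply: filter_forall => i; apply: filter_forall => j.
  exact: (fA i j _ (AP i j)).
by apply: (@filterS _ F FF) => x Px; apply: PB => i j; exact: Px.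
Qed.

Lemma cvg_mx_entry {T : Type} (F : set_system T) {FF : Filter F} m n
    (f : T -> 'M[R]_(m, n)) (A : 'M[R]_(m, n)) i j :
  f @ F --> A -> (fun x => f x i j) @ F --> A i j.
Proof.
move=> fA; apply: (cvg_comp _ (fun M : 'M[R]_(m, n) => M i j) fA).
exact: (@coord_continuous R m n i j A).
Qed.

Lemma continuous_mx_entries {T : topologicalType} m n (f : T -> 'M[R]_(m, n)) :
  (forall i j, continuous (fun x => f x i j)) -> continuous f.
Proof.
move=> cf x; refine (@cvg_mx_entries T (nbhs x) _ m n f (f x) _) => i j.
exact: cf.
Qed.

Lemma cvg_sum_fin {T : Type} (F : set_system T) {FF : Filter F} (I : Type)
    (r : seq I) (f : I -> T -> R) (a : I -> R) :
  (forall i, f i @ F --> a i) ->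
  (fun x => \sum_(i <- r) f i x) @ F --> \sum_(i <- r) a i.
Proof.
move=> fa; elim: r => [|i r IH].
  under eq_fun do rewrite big_nil.
  by rewrite big_nil; apply: cvg_cst.
under eq_fun do rewrite big_cons.
by rewrite big_cons; apply: cvgD.
Qed.

Lemma cvg_mulmx {T : Type} (F : set_system T) {FF : Filter F} m n p
    (f : T -> 'M[R]_(m, n)) (g : T -> 'M[R]_(n, p))
    (A : 'M[R]_(m, n)) (B : 'M[R]_(n, p)) :
  f @ F --> A -> g @ F --> B -> (fun x => f x *m g x) @ F --> A *m B.
Proof.
move=> fA gB; apply: cvg_mx_entries => i j.
under eq_fun do rewrite mxE.
rewrite mxE; apply: cvg_sum_fin => k.
by apply: cvgM; apply: cvg_mx_entry.
Qed.

Lemma cvg_mxtrace {T : Type} (F : set_system T) {FF : Filter F} n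
    (f : T -> 'M[R]_n) (A : 'M[R]_n) :
  f @ F --> A -> (fun x => \tr (f x)) @ F --> \tr A.
Proof. by move=> fA; apply: cvg_sum_fin => i; apply: cvg_mx_entry. Qed.

Lemma cvg_trmx {T : Type} (F : set_system T) {FF : Filter F} m n
    (f : T -> 'M[R]_(m, n)) (A : 'M[R]_(m, n)) :
  f @ F --> A -> (fun x => (f x)^T) @ F --> A^T.
Proof.
move=> fA; apply: cvg_mx_entries => i j; under eq_fun do rewrite mxE.
by rewrite mxE; apply: cvg_mx_entry.
Qed.

Lemma cvg_mx_exp {T : Type} (F : set_system T) {FF : Filter F} n
    (f : T -> 'M[R]_n) (A : 'M[R]_n) k :
  f @ F --> A -> (fun x => f x ^+ k) @ F --> A ^+ k.
Proof.
move=> fA; elim: k => [|k IH].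
  under eq_fun do rewrite expr0.
  by rewrite expr0; apply: cvg_cst.
under eq_fun do rewrite exprS.
by rewrite exprS; apply: cvg_mulmx.
Qed.

Lemma cvg_mx_unique {T : Type} (F : set_system T) {FF : ProperFilter F} m n
    (f : T -> 'M[R]_(m, n)) (A B : 'M[R]_(m, n)) :
  f @ F --> A -> f @ F --> B -> A = B.
Proof.
move=> fA fB; have Ff := fmap_proper_filter f FF.
exact: (@norm_cvg_unique R 'M[R]_(m, n) (f @ F) Ff A B fA fB).
Qed.

Lemma mx_entry_le_norm m n (A : 'M[R]_(m, n)) i j : `|A i j| <= `|A|.
Proof.
rewrite [leRHS]/Num.norm /= mx_normrE; apply/bigmax_geP; right => /=.
by exists (i, j).
Qed.

Lemma mx_norm_le m n (A : 'M[R]_(m, n)) (c : R) : 0 <= c ->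
  (forall i j, `|A i j| <= c) -> `|A| <= c.
Proof.
move=> c0 Ac; rewrite [leLHS]/Num.norm /= mx_normrE.
by apply/bigmax_leP; split => // -[i j] _; apply: Ac.
Qed.

(** The norm is the largest absolute value of an entry, which is not submultiplicative; the factor
    [n] counts the summands of an entry of the product. *)
Lemma norm_mulmx_le m n p (A : 'M[R]_(m, n)) (B : 'M[R]_(n, p)) :
  `|A *m B| <= n%:R * (`|A| * `|B|).
Proof.
apply: mx_norm_le => [|i j]; first by rewrite !mulr_ge0.
rewrite mxE; apply: le_trans (ler_norm_sum _ _ _) _.
apply: (le_trans (y := \sum_(k < n) `|A| * `|B|)).
  by apply: ler_sum => k _; rewrite normrM ler_pM // mx_entry_le_norm.
by rewrite sumr_const card_ord mulr_natl.
Qed.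

Lemma scalemx_exp n (a : R) (A : 'M[R]_n) k : (a *: A) ^+ k = a ^+ k *: A ^+ k.
Proof.
elim: k => [|k IH]; first by rewrite !expr0 scale1r.
by rewrite !exprS IH -[LHS]/(_ *m _) -scalemxAl -scalemxAr scalerA.
Qed.

Lemma norm_mx1_le n : `|1%:M : 'M[R]_n| <= 1.
Proof.
by apply: mx_norm_le => // i j; rewrite mxE; case: eqP; rewrite ?normr1 ?normr0.
Qed.

Lemma norm_expmx_le n (A : 'M[R]_n) k (b : R) : `|A| <= b ->
  `|A ^+ k| <= (n%:R * b) ^+ k.
Proof.
move=> Ab; have b0 : 0 <= b by apply: le_trans Ab.
elim: k => [|k IH]; first by rewrite !expr0; apply: norm_mx1_le.
rewrite !exprS; apply: le_trans (norm_mulmx_le _ _) _.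
by rewrite -mulrA ler_wpM2l // ler_pM.
Qed.

End MatrixLimits.

Section RealContinuity.
Variables (R : realType) (T : topologicalType).
Implicit Types f g : T -> R.

Lemma continuous_fun_opp f : continuous f -> continuous (fun x => - f x).
Proof. by move=> cf x; apply: (@cvgN _ _ _ (nbhs x)); exact: cf. Qed.

Lemma continuous_fun_add f g :
  continuous f -> continuous g -> continuous (fun x => f x + g x).
Proof. by move=> cf cg x; apply: (@cvgD _ _ _ (nbhs x)); [exact: cf | exact: cg]. Qed.

Lemma continuous_fun_sub f g :
  continuous f -> continuous g -> continuous (fun x => f x - g x).
Proof. by move=> cf cg x; apply: (@cvgB _ _ _ (nbhs x)); [exact: cf | exact: cg]. Qed.

Lemma continuous_fun_mul f g :
  continuous f -> continuous g -> continuous (fun x => f x * g x).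
Proof. by move=> cf cg x; apply: (@cvgM _ _ (nbhs x)); [exact: cf | exact: cg]. Qed.

Lemma continuous_fun_cst (c : R) : continuous (fun _ : T => c).
Proof. by move=> x; exact: cvg_cst. Qed.

Lemma continuous_fun_mulmx m n p (f : T -> 'M[R]_(m, n)) (g : T -> 'M[R]_(n, p)) :
  continuous f -> continuous g -> continuous (fun x => f x *m g x).
Proof. by move=> cf cg x; apply: (@cvg_mulmx R T (nbhs x)); [exact: cf | exact: cg]. Qed.

Lemma continuous_fun_trmx m n (f : T -> 'M[R]_(m, n)) :
  continuous f -> continuous (fun x => (f x)^T).
Proof. by move=> cf x; apply: (@cvg_trmx R T (nbhs x)); exact: cf. Qed.

Lemma continuous_fun_entry m n (f : T -> 'M[R]_(m, n)) i j :
  continuous f -> continuous (fun x => f x i j).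
Proof. by move=> cf x; apply: (@cvg_mx_entry R T (nbhs x)); exact: cf. Qed.

Lemma continuous_fun_trace n (f : T -> 'M[R]_n) :
  continuous f -> continuous (fun x => \tr (f x)).
Proof. by move=> cf x; apply: (@cvg_mxtrace R T (nbhs x)); exact: cf. Qed.

Lemma continuous_mx_cst m n (A : 'M[R]_(m, n)) : continuous (fun _ : T => A).
Proof. by move=> x; exact: cvg_cst. Qed.

End RealContinuity.

(** * Convergence of the exponential series and Euler's approximation *)

Section Exponential.
Variable R : realType.

Local Notation expmx_term A := (fun k : nat => (k`!%:R)^-1 *: A ^+ k).

(** [expmx] is a bare [limn], so convergence must come before any use: entrywise, the series is
    dominated by that of the real exponential at [n * |A|]. *)
Lemma expmx_cvg n (A : 'M[R]_n) : series (expmx_term A) @ \oo --> expmx A.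
Proof.
pose b : R := n%:R * `|A|.
have cvg_entry i j : cvgn (series (fun k => expmx_term A k i j)).
  apply: normed_cvg.
  apply: (@series_le_cvg R _ (exp_coeff b)).
  - by move=> k; apply: normr_ge0.
  - by move=> k; rewrite /exp_coeff /= divr_ge0 // exprn_ge0 // mulr_ge0.
  - move=> k /=; rewrite mxE /exp_coeff /= normrM normfV.
    rewrite (@ger0_norm _ k`!%:R) // mulrC ler_wpM2r ?invr_ge0 //.
    apply: le_trans (mx_entry_le_norm _ _ _) _.
    exact: norm_expmx_le.
  - exact: is_cvg_series_exp_coeff.
have : series (expmx_term A) @ \oo -->
    (\matrix_(i, j) limn (series (fun k => expmx_term A k i j))).
  apply: cvg_mx_entries => i j; rewrite mxE.
  have -> : (fun N => series (expmx_term A) N i j) =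
      series (fun k => expmx_term A k i j).
    by apply/funext => N; rewrite /series /= summxE.
  exact: cvg_entry.
by move/cvgP.
Qed.

(** As [P] may be rectangular, this moves exponentials between representations of different
    dimensions: from [V] to the model and, with [D = 0], to the fixed coordinates. *)
Lemma expmx_intertwine m n (P : 'M[R]_(m, n)) (A : 'M[R]_n) (D : 'M[R]_m) :
  P *m A = D *m P -> P *m expmx A = expmx D *m P.
Proof.
move=> PA.
have PAk k : P *m A ^+ k = D ^+ k *m P.
  elim: k => [|k IH]; first by rewrite !expr0 mulmx1 mul1mx.
  by rewrite !exprS mulmxA PA -mulmxA IH !mulmxA.
have cvgL : (fun N => P *m series (expmx_term A) N) @ \oo --> P *m expmx A.
  by apply: cvg_mulmx; [exact: cvg_cst | exact: expmx_cvg].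
have cvgR : (fun N => series (expmx_term D) N *m P) @ \oo --> expmx D *m P.
  by apply: cvg_mulmx; [exact: expmx_cvg | exact: cvg_cst].
refine (cvg_mx_unique cvgL _).
have -> : (fun N => P *m series (expmx_term A) N) =
    (fun N => series (fun k : nat => (k`!%:R)^-1 *: D ^+ k) N *m P).
  apply/funext => N; rewrite /series /= mulmx_sumr mulmx_suml.
  by apply: eq_bigr => k _; rewrite -scalemxAr PAk scalemxAl.
exact: cvgR.
Qed.

(** [m ^_ k / m ^ k] is a product of [k] factors [1 - i / m], each tending to 1. *)
Lemma cvg_falling_quotient {T : Type} (F : set_system T) {FF : ProperFilter F}
    (m : T -> nat) k :
  (forall K, \forall x \near F, (K <= m x)%N) ->
  (fun x => ('C(m x, k))%:R / (m x)%:R ^+ k : R) @ F --> (k`!%:R : R)^-1.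
Proof.
move=> moo.
have inv0 : (fun x => ((m x)%:R : R)^-1) @ F --> (0 : R).
  apply/cvgrPdist_le => e e0.
  near=> x.
  have mx : (Num.truncn e^-1 < m x)%N by near: x; exact: moo.
  have mx0 : 0 < (m x)%:R :> R by rewrite ltr0n (leq_ltn_trans _ mx).
  rewrite sub0r normrN ger0_norm ?invr_ge0 // invf_ple // ?posrE //.
  by apply: ltW; rewrite -truncn_lt_nat // ?invr_ge0 ?ltW.
have ffact_cvg : (fun x => (m x ^_ k)%:R / (m x)%:R ^+ k : R) @ F --> (1 : R).
  elim: k => [|k IH].
    under eq_fun do rewrite ffactn0 expr0 divr1.
    exact: cvg_cst.
  rewrite -[1 in X in _ --> X]mulr1.
  have -> : (fun x => (m x ^_ k.+1)%:R / (m x)%:R ^+ k.+1 : R) =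
      (fun x => ((m x ^_ k)%:R / (m x)%:R ^+ k) * ((m x - k)%:R / (m x)%:R)).
    by apply/funext => x; rewrite ffactnSr natrM exprSr invfM mulrACA.
  apply: cvgM => //.
  have h : (fun x => 1 - k%:R * (m x)%:R^-1 : R) @ F --> (1 : R).
    rewrite -[X in _ --> X](subr0 1) -(mulr0 k%:R).
    by apply: cvgB; [exact: cvg_cst | apply: cvgMr].
  apply: cvg_trans h; apply: near_eq_cvg; near=> x.
  have mx : (k < m x)%N by near: x; exact: moo.
  have mx0 : (m x)%:R != 0 :> R by rewrite pnatr_eq0 -lt0n (leq_ltn_trans _ mx).
  by rewrite natrB ?(ltnW mx) // mulrBl divff.
rewrite -[X in _ --> X]mul1r.
have -> : (fun x => 'C(m x, k)%:R / (m x)%:R ^+ k : R) =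
    (fun x => (m x ^_ k)%:R / (m x)%:R ^+ k * (k`!%:R)^-1).
  by apply/funext => x; rewrite -bin_ffact natrM mulrAC mulfK.
by apply: cvgM => //; apply: cvg_cst.
Unshelve. all: by end_near. Qed.

Lemma ffact_le_expn a k : (a ^_ k <= a ^ k)%N.
Proof.
by elim: k => // k IH; rewrite ffactnSr expnSr leq_mul // leq_subr.
Qed.

Lemma exp_tail_cvg (b : R) :
  (fun K => expR b - series (exp_coeff b) K) @ \oo --> (0 : R).
Proof.
rewrite -[X in _ --> X](subrr (expR b)); apply: cvgB; first exact: cvg_cst.
exact: is_cvg_series_exp_coeff.
Qed.

Lemma exp_sum_le (b : R) K M : 0 <= b -> (K <= M)%N ->
  \sum_(K <= k < M) b ^+ k / k`!%:R <= expR b - series (exp_coeff b) K.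
Proof.
move=> b0 KM; rewrite -[X in X <= _]/(\sum_(K <= k < M) exp_coeff b k).
rewrite -sub_series_geq // lerB //.
apply: (@nondecreasing_cvgn_le _ (series (exp_coeff b))).
  apply: nondecreasing_series => k _ _.
  by rewrite /exp_coeff /= divr_ge0 // exprn_ge0.
exact: is_cvg_series_exp_coeff.
Qed.

(** Expand [(1 + X / m) ^ m] with [X = m (g - 1)]: the coefficients tend to [1 / k!] and stay below
    it, so the tail is controlled by one tail of the real exponential series. The filter is
    arbitrary because the result serves both along the integers and along an ultrafilter. *)
Theorem cvg_pow_expmx {T : Type} (F : set_system T) {FF : ProperFilter F} n
    (m : T -> nat) (g : T -> 'M[R]_n) (B : 'M[R]_n) :
  (forall K, \forall x \near F, (K <= m x)%N) ->
  (fun x => (m x)%:R *: (g x - 1%:M)) @ F --> B ->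
  (fun x => g x ^+ m x) @ F --> expmx B.
Proof.
move=> moo gB.
set X := fun x => (m x)%:R *: (g x - 1%:M) in gB.
pose c x k : R := 'C(m x, k)%:R / (m x)%:R ^+ k.
(* Near the limit [|X| <= |B| + 1], so [b ^ k] bounds the norm of [X ^ k]. *)
pose b := n%:R * (`|B| + 1).
have b0 : 0 <= b by rewrite mulr_ge0 // addr_ge0.
have c_le x k : (0 < m x)%N -> 0 <= c x k <= (k`!%:R)^-1.
  move=> mx0; have mR : 0 < (m x)%:R ^+ k :> R by rewrite exprn_gt0 ?ltr0n.
  rewrite divr_ge0 ?(ltW mR) //= ler_pdivrMr // mulrC.
  rewrite ler_pdivlMr ?ltr0n ?fact_gt0 // -natrM bin_ffact -natrX ler_nat.
  exact: ffact_le_expn.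
have X_le : \forall x \near F, `|X x| <= `|B| + 1.
  by apply: (@cvgr_norm_le R 'M[R]_n T F FF X B gB); rewrite ltrDl.
have g_expand x K : (0 < m x)%N -> (K <= m x)%N ->
    g x ^+ m x = \sum_(0 <= k < K) c x k *: X x ^+ k
               + \sum_(K <= k < (m x).+1) c x k *: X x ^+ k.
  move=> mx0 Km; have mxR : (m x)%:R != 0 :> R by rewrite pnatr_eq0 -lt0n.
  have -> : g x = 1%:M + (m x)%:R^-1 *: X x.
    by rewrite /X scalerA mulVf // scale1r addrC subrK.
  rewrite -big_cat_nat ?(leq_trans Km) // big_mkord exprDn_comm; last first.
    exact: (commr_sym (commr1 _)).
  apply: eq_bigr => k _; rewrite scalemx_exp expr1n mul1r -scaler_nat scalerA /c.
  by rewrite exprVn.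
apply/cvgrPdist_le => e e0.
have e3 : 0 < e / 3 by rewrite divr_gt0.
have /cvgrPdist_le /(_ _ e3) tail := exp_tail_cvg b.
have /cvgrPdist_le /(_ _ e3) expB := @expmx_cvg _ B.
(* The cut [K] is fixed before [x]: it makes the tails of [expmx B] and of [expR b] small, and the
   finite sum below it converges termwise. *)
near \oo => K.
have fin : (fun x => \sum_(0 <= k < K) c x k *: X x ^+ k) @ F -->
    series (expmx_term B) K.
  apply: cvg_mx_entries => i j; rewrite summxE.
  under eq_fun do rewrite summxE.
  apply: cvg_sum_fin => k; rewrite mxE.
  under eq_fun do rewrite mxE.
  apply: cvgM; first exact: cvg_falling_quotient.
  by apply: cvg_mx_entry; apply: cvg_mx_exp.
have /cvgrPdist_le /(_ _ e3) fin3 := fin.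
near=> x.
have Km : (K <= m x)%N by near: x; exact: moo.
have mx0 : (0 < m x)%N by near: x; exact: moo.
rewrite (g_expand x K) //.
set S1 := \sum_(0 <= k < K) _; set S2 := \sum_(K <= k < _) _.
have -> : expmx B - (S1 + S2) = (expmx B - series (expmx_term B) K) +
    (series (expmx_term B) K - S1) - S2 by rewrite addrA subrK opprD addrA.
apply: le_trans (ler_normB _ _) _.
have -> : e = e / 3 + e / 3 + e / 3 by field.
apply: lerD.
  apply: le_trans (ler_normD _ _) _; apply: lerD.
    by near: K.
  by rewrite /S1; near: x.
apply: le_trans (ler_norm_sum _ _ _) _.
apply: (le_trans (y := \sum_(K <= k < (m x).+1) b ^+ k / k`!%:R)).
  apply: ler_sum => k _; rewrite normrZ mulrC.
  have /andP[ck0 ck1] := c_le x k mx0.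
  rewrite ger0_norm // ler_pM //.
  by apply: norm_expmx_le; near: x.
apply: le_trans (exp_sum_le b0 (leqW Km)) _.
apply: le_trans (ler_norm _) _; rewrite -normrN -[X in `|X|]sub0r.
by near: K.
Unshelve. all: by end_near. Qed.

End Exponential.

(** * Closed subgroups of a compact linear group *)

Section ClosedSubgroup.
Variables (R : realType) (n : nat).

(** For [|t| <= 1] every term of degree at least two is bounded by [t ^ 2] times a term of the
    series of [expR (n * |X|)]. *)
Lemma expmx_linear_approx (X : 'M[R]_n) : exists2 c : R, 0 <= c &
  forall t, `|t| <= 1 -> `|expmx (t *: X) - 1%:M - t *: X| <= c * t ^+ 2.
Proof.
pose b := n%:R * `|X|; have b0 : 0 <= b by rewrite mulr_ge0.
exists (expR b); first exact: expR_ge0.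
move=> t t1.
pose term k : 'M[R]_n := (k`!%:R)^-1 *: (t *: X) ^+ k.
have cvg_dist : (fun N => `|series term N - 1%:M - t *: X|) @ \oo -->
    `|expmx (t *: X) - 1%:M - t *: X|.
  apply: cvg_norm; apply: cvgB; last exact: cvg_cst.
  by apply: cvgB; [exact: expmx_cvg | exact: cvg_cst].
rewrite -(cvg_lim (@Rhausdorff R) cvg_dist); apply: limr_le.
  by apply/cvg_ex; eexists; exact: cvg_dist.
near=> N.
have N2 : (2 <= N)%N by near: N; exists 2%N.
rewrite /series /= big_ltn ?(ltnW N2) // big_ltn //.
have -> : term 0%N = 1%:M by rewrite /term fact0 expr0 invr1 scale1r.
have -> : term 1%N = t *: X by rewrite /term expr1 invr1 scale1r.
rewrite -addrA -opprD addrA addrAC subrr add0r.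
apply: le_trans (ler_norm_sum _ _ _) _.
apply: (le_trans (y := \sum_(2 <= k < N) (b ^+ k / k`!%:R) * t ^+ 2)).
  rewrite big_nat_cond [leRHS]big_nat_cond.
  apply: ler_sum => k /andP[/andP[k2 _] _].
  rewrite normrZ normfV (@ger0_norm _ k`!%:R) // scalemx_exp normrZ.
  rewrite mulrC [leRHS]mulrAC ler_wpM2r ?invr_ge0 // mulrC.
  apply: ler_pM => //; first exact: norm_expmx_le.
  rewrite normrX -(subnK k2) exprD -[leRHS](mul1r) -[t ^+ 2]real_normK ?num_real //.
  by rewrite ler_wpM2r ?exprn_ge0 // exprn_ile1.
rewrite -mulr_suml ler_wpM2r ?sqr_ge0 //.
apply: le_trans (exp_sum_le b0 N2) _.
rewrite gerBl /series /=; apply: sumr_ge0 => k _.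
by rewrite /exp_coeff /= divr_ge0 // exprn_ge0.
Unshelve. all: by end_near. Qed.

(** Stands in for the derivative test at the maxima below: near 0 a quadratic term cannot dominate a
    nonzero linear one. *)
Lemma first_order_vanish (a c : R) : 0 <= c ->
  (forall t, `|t| <= 1 -> t * a <= c * t ^+ 2) -> a = 0.
Proof.
move=> c0 H; apply/eqP; apply: contraT => a0.
(* With this [t], of the sign of [a], the right side is the left side times
   [c / (|a| + c + 1) < 1]. *)
pose t := a / (`|a| + c + 1) .
have na : 0 < `|a| by rewrite normr_gt0.
have d0 : 0 < `|a| + c + 1 by lra.
have t1 : `|t| <= 1.
  by rewrite /t normrM normfV (ger0_norm (ltW d0)) ler_pdivrMr //; lra.
have := H t t1; rewrite /t.
have -> : a / (`|a| + c + 1) * a = `|a| ^+ 2 / (`|a| + c + 1).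
  by rewrite real_normK ?num_real // expr2 mulrAC.
have -> : c * (a / (`|a| + c + 1)) ^+ 2 =
    c / (`|a| + c + 1) * (`|a| ^+ 2 / (`|a| + c + 1)).
  by rewrite real_normK ?num_real // exprMn; field; lra.
have A0 : 0 < `|a| ^+ 2 / (`|a| + c + 1) by rewrite divr_gt0 // exprn_gt0.
move=> h; have : 1 <= c / (`|a| + c + 1) by rewrite -(ler_pM2r A0) mul1r.
have clt : c < `|a| + c + 1 by lra.
by rewrite ler_pdivlMr // mul1r leNgt clt.
Qed.

Lemma trace_mulmx_le (A B : 'M[R]_n) : `|\tr (A *m B)| <= (n%:R ^+ 2) * (`|A| * `|B|).
Proof.
rewrite /mxtrace; apply: le_trans (ler_norm_sum _ _ _) _.
apply: (le_trans (y := \sum_(i < n) n%:R * (`|A| * `|B|))).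
  by apply: ler_sum => i _; apply: le_trans (mx_entry_le_norm _ _ _) (norm_mulmx_le _ _).
by rewrite sumr_const card_ord -[leLHS]mulr_natl expr2 mulrA.
Qed.

Lemma trace_max_critical (X g : 'M[R]_n) :
  (forall t, \tr (expmx (t *: X) *m g) <= \tr g) -> \tr (X *m g) = 0.
Proof.
move=> H; have [c c0 Hc] := expmx_linear_approx X.
apply: (@first_order_vanish _ (n%:R ^+ 2 * (c * `|g|))) => [|t t1].
  by rewrite !mulr_ge0 // exprn_ge0.
have := H t; set E := expmx _.
have -> : E = 1%:M + t *: X + (E - 1%:M - t *: X).
  by rewrite -[E - _ - _]addrA -opprD [RHS]addrC subrK.
rewrite 2!mulmxDl mul1mx 2!mxtraceD -scalemxAl mxtraceZ.
set r := (E - _ - _).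
have : `|\tr (r *m g)| <= n%:R ^+ 2 * (c * `|g|) * t ^+ 2.
  apply: le_trans (trace_mulmx_le _ _) _.
  have -> : n%:R ^+ 2 * (c * `|g|) * t ^+ 2 = n%:R ^+ 2 * (c * t ^+ 2 * `|g|).
    by ring.
  by apply: ler_wpM2l; [exact: exprn_ge0 | apply: ler_wpM2r => //; exact: Hc].
rewrite ler_norml => /andP[h1 h2] h3; lra.
Qed.


Lemma mx_continuous_compact {T U : topologicalType} (f : T -> U) (A : set T) :
  continuous f -> compact A -> compact (f @` A).
Proof. by move=> cf; apply: continuous_compact; apply: continuous_subspaceT. Qed.

(** Heine-Borel for row vectors, transported through [vec_mx]. *)
Lemma mx_bounded_closed_compact p q (A : set 'M[R]_(p, q)) (c : R) :
  (forall x, A x -> `|x| <= c) -> closed A -> compact A.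
Proof.
move=> Ac Acl.
have cv : continuous (vec_mx : 'rV[R]_(p * q) -> 'M[R]_(p, q)).
  apply: continuous_mx_entries => i j.
  by under eq_fun do rewrite mxE; apply: coord_continuous.
have -> : A = vec_mx @` (vec_mx @^-1` A).
  rewrite eqEsubset; split => [x Ax|x [v Av <-] //].
  by exists (mxvec x); rewrite /= mxvecK.
apply: mx_continuous_compact => //.
apply: bounded_closed_compact.
  exists c; split; first exact: num_real.
  move=> M cM v /= Av; apply: le_trans (ltW cM).
  apply: le_trans (Ac _ Av); apply: mx_norm_le => // i j.
  rewrite ord1; case/mxvec_indexP: j => a b.
  have -> : v 0 (mxvec_index a b) = vec_mx v a b by rewrite mxE.
  exact: mx_entry_le_norm.
by apply: closed_comp => // v _; exact: cv.
Qed.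

End ClosedSubgroup.

Section Cartan.
Variables (R : realType) (n : nat) (G : compact_orthogonal_group R n).

Lemma group_carrier_closed : closed (G : set 'M[R]_n).
Proof.
apply: compact_closed; last exact: group_compact.
exact: norm_hausdorff.
Qed.

Lemma group_trV (g : 'M[R]_n) : (G : set _) g -> invmx g = g^T.
Proof.
move=> Gg; have gg := group_orthogonal Gg.
have [gU _] := mulmx1_unit gg.
have gU' : g \in unitmx by have [] := mulmx1_unit gg.
by rewrite -[LHS]mul1mx -gg mulmxK.
Qed.

Lemma group_tr (g : 'M[R]_n) : (G : set _) g -> (G : set _) g^T.
Proof. by move=> Gg; rewrite -group_trV //; exact: group_inv. Qed.

Lemma group_pow (g : 'M[R]_n) k : (G : set _) g -> (G : set _) (g ^+ k).
Proof.
move=> Gg; elim: k => [|k IH]; first exact: group_one.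
by rewrite exprS; exact: group_mul.
Qed.

(** The squares of all entries of [g - 1] sum to [tr ((g - 1)^T (g - 1)) = 2 (n - tr g)]. A large
    trace thus means closeness to the identity, so that distance to a subgroup can be minimized by
    maximizing a trace. *)
Lemma orthogonal_dist (g : 'M[R]_n) : g^T *m g = 1%:M ->
  `|g - 1%:M| ^+ 2 <= 2 * (n%:R - \tr g).
Proof.
move=> gg.
have sq : 2 * (n%:R - \tr g) = \sum_i \sum_j ((g - 1%:M) j i) ^+ 2.
  transitivity (\tr ((g - 1%:M)^T *m (g - 1%:M))).
    rewrite [(g - _)^T]linearB /= trmx1 mulmxBl !mulmxBr gg !mul1mx !mulmx1.
    by rewrite !raddfB /= mxtrace_tr !mxtrace1; ring.
  by apply: eq_bigr => i _; rewrite mxE; apply: eq_bigr => j _; rewrite mxE expr2.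
have [->|/mx_norm_neq0[[i j] /= Hij]] := eqVneq (`|g - 1%:M|) 0.
  by rewrite expr0n /= sq; apply: sumr_ge0 => i _; apply: sumr_ge0 => j _; exact: sqr_ge0.
rewrite [X in X ^+ 2]Hij real_normK ?num_real // sq (bigD1 j) //= (bigD1 i) //=.
rewrite -addrA lerDl addr_ge0 //; last first.
  by apply: sumr_ge0 => k _; apply: sumr_ge0 => l _; exact: sqr_ge0.
by apply: sumr_ge0 => k _; exact: sqr_ge0.
Qed.

Lemma norm_trmx p q (A : 'M[R]_(p, q)) : `|A^T| = `|A|.
Proof.
apply/eqP; rewrite eq_le; apply/andP; split.
  by apply: mx_norm_le => // i j; rewrite mxE mx_entry_le_norm.
apply: mx_norm_le => // i j; have -> : A i j = A^T j i by rewrite mxE.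
exact: mx_entry_le_norm.
Qed.

(** * Tangent directions of the group at the identity *)

Section Tangent.
Context {T : Type} (F : set_system T) {FF : ProperFilter F}.
Variables (g : T -> 'M[R]_n) (A : 'M[R]_n).
Hypothesis Gg : \forall x \near F, (G : set _) (g x).
Hypothesis g_cvg1 : g @ F --> (1%:M : 'M[R]_n).
Hypothesis g_neq1 : \forall x \near F, g x != 1%:M.
Hypothesis gA : (fun x => `|g x - 1%:M|^-1 *: (g x - 1%:M)) @ F --> A.

(** With [m] the integer part of [t / |g - 1|], the matrices [m (g - 1)] tend to [t A]; hence
    [g ^ m] tends to [exp (t A)], and [G] is closed. *)
Lemma tangent_exp_pos t : 0 < t -> (G : set _) (expmx (t *: A)).
Proof.
move=> t0; pose e x := `|g x - 1%:M|; pose m x := Num.truncn (t / e x).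
have e_pos : \forall x \near F, 0 < e x.
  by near=> x; rewrite normr_gt0 subr_eq0; near: x.
have e_cvg0 : e @ F --> (0 : R).
  rewrite -(normr0 'M[R]_n) -(subrr (1%:M : 'M[R]_n)).
  by apply: cvg_norm; apply: cvgB => //; apply: cvg_cst.
have mlim : (fun x => (m x)%:R * e x) @ F --> t.
  have te : (fun x => t - e x) @ F --> t.
    by rewrite -[X in _ --> X]subr0; apply: cvgB => //; apply: cvg_cst.
  apply: (squeeze_cvgr _ te (cvg_cst t)); near=> x.
  have ex : 0 < e x by near: x.
  have te0 : 0 <= t / e x by rewrite divr_ge0 // ltW.
  have /andP[lo hi] := truncn_itv te0.
  rewrite -ler_pdivlMr // lo andbT lerBlDr -[X in _ + X]mul1r -mulrDl.
  by rewrite -ler_pdivrMr // natr1 ltW.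
have moo K : \forall x \near F, (K <= m x)%N.
  have [-> |K0] := posnP K; first by near=> x.
  near=> x; have ex : 0 < e x by near: x.
  rewrite truncn_ge_nat ?divr_ge0 ?(ltW ex) ?(ltW t0) //.
  rewrite ler_pdivlMr // mulrC -ler_pdivlMr ?ltr0n //.
  near: x; apply: (@cvgr_le R T F FF e 0 e_cvg0).
  by rewrite divr_gt0 // ltr0n.
have mgA : (fun x => (m x)%:R *: (g x - 1%:M)) @ F --> t *: A.
  refine (cvg_trans _ (cvgZ mlim gA)); apply: near_eq_cvg; near=> x.
  have ex : 0 < e x by near: x.
  by rewrite scalerA mulfK // gt_eqF.
apply: (closed_cvg _ group_carrier_closed _ _ (cvg_pow_expmx moo mgA)).
by apply: filterS Gg => x Gx; exact: group_pow.
Unshelve. all: by end_near. Qed.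

(** For orthogonal [g], [g^T - 1 = - g^T (g - 1)], and [g^T] tends to 1. Inverses have the opposite
    direction, which gives access to negative times and makes [A] skew. *)
Lemma tangent_tr :
  (fun x => `|(g x)^T - 1%:M|^-1 *: ((g x)^T - 1%:M)) @ F --> - A.
Proof.
have h : (fun x => - ((g x)^T *m (`|g x - 1%:M|^-1 *: (g x - 1%:M)))) @ F --> - A.
  apply: cvgN; rewrite -[X in _ --> X]mul1mx; apply: cvg_mulmx => //.
  by rewrite -trmx1; apply: cvg_trmx.
refine (cvg_trans _ h); apply: near_eq_cvg; near=> x.
have /group_orthogonal gg : (G : set _) (g x) by near: x.
rewrite -scalemxAr -scalerN mulmxBr gg mulmx1 opprB -norm_trmx.
by rewrite [(_ - 1%:M)^T]linearB /= trmx1.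
Unshelve. all: by end_near. Qed.

Lemma tangent_skew : A^T = - A.
Proof.
have hT : (fun x => `|(g x)^T - 1%:M|^-1 *: ((g x)^T - 1%:M)) @ F --> A^T.
  have -> : (fun x => `|(g x)^T - 1%:M|^-1 *: ((g x)^T - 1%:M)) =
      (fun x => (`|g x - 1%:M|^-1 *: (g x - 1%:M))^T).
    apply/funext => x; have -> : (g x)^T - 1%:M = (g x - 1%:M)^T.
      by rewrite linearB /= trmx1.
    by rewrite norm_trmx [RHS]linearZ.
  by apply: cvg_trmx.
exact: (cvg_mx_unique hT tangent_tr).
Qed.

End Tangent.

Lemma expmx0 : expmx (0 : 'M[R]_n) = 1%:M.
Proof.
have [c _ /(_ 0)] := expmx_linear_approx (0 : 'M[R]_n).
rewrite normr0 ler01 scaler0 subr0 expr0n mulr0 => /(_ isT).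
by rewrite normr_le0 subr_eq0 => /eqP.
Qed.

Lemma tangent_lie {T : Type} (F : set_system T) {FF : ProperFilter F}
    (g : T -> 'M[R]_n) (A : 'M[R]_n) :
  (\forall x \near F, (G : set _) (g x)) -> g @ F --> (1%:M : 'M[R]_n) ->
  (\forall x \near F, g x != 1%:M) ->
  (fun x => `|g x - 1%:M|^-1 *: (g x - 1%:M)) @ F --> A ->
  lie_algebra G A.
Proof.
move=> Gg g1 gn1 gA t; case: (ltrgt0P t) => [t0|t0|->].
- exact: (tangent_exp_pos Gg g1 gn1 gA).
- rewrite -[t]opprK scaleNr -scalerN.
  apply: (@tangent_exp_pos _ F FF (fun x => (g x)^T)).
  + by apply: filterS Gg => x; exact: group_tr.
  + by rewrite -trmx1; apply: cvg_trmx.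
  + by apply: filterS gn1 => x; apply: contra => /eqP h; rewrite -[g x]trmxK h trmx1.
  + exact: (tangent_tr Gg g1 gA).
  + by rewrite oppr_gt0.
- by rewrite scale0r expmx0; exact: group_one.
Qed.

(** On orthogonal matrices the trace is at most [n], so along [exp (t X)] it is maximal at
    [t = 0]. *)
Lemma lie_trace0 (X : 'M[R]_n) : lie_algebra G X -> \tr X = 0.
Proof.
move=> GX; rewrite -[X]mulmx1; apply: trace_max_critical => t.
rewrite mulmx1 mxtrace1.
have := orthogonal_dist (group_orthogonal (GX t)).
by move/(le_trans (sqr_ge0 _)); rewrite pmulr_rge0 // subr_ge0.
Qed.

Lemma lie_scale (X : 'M[R]_n) s : lie_algebra G X -> lie_algebra G (s *: X).
Proof. by move=> GX t; rewrite scalerA; exact: GX. Qed.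

(** Otherwise elements of [G] outside [H] tend to 1. Multiply each by the element of [H] that
    maximizes the trace: the products [g j] still tend to 1 and differ from 1, and a limit [A] of
    the normalized [g j - 1] lies in the Lie algebra. Maximality gives [tr (X g_j) = 0] for every
    [X] of the Lie algebra, whence [tr (A A) = 0]; the skew matrix [A] then vanishes, against
    [|A| = 1]. *)
Lemma closed_subgroup_nbhs1 (H : set 'M[R]_n) :
  H `<=` G -> closed H -> H 1%:M ->
  (forall g h, H g -> H h -> H (g *m h)) -> (forall g, H g -> H g^T) ->
  (forall X, lie_algebra G X -> H (expmx X)) ->
  exists2 d : R, 0 < d & forall g, (G : set _) g -> `|g - 1%:M| < d -> H g.
Proof.
move=> HG Hcl H1 Hmul Hinv Hexp; apply: contrapT => noex.
have seq_ex (j : nat) : exists g : 'M[R]_n,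
    [/\ (G : set _) g, `|g - 1%:M| < j.+1%:R^-1 & ~ H g].
  apply: contrapT => no; apply: noex; exists (j.+1%:R^-1).
    by rewrite invr_gt0 ltr0n.
  by move=> g Gg gj; apply: contrapT => nH; apply: no; exists g.
have Hco : compact H.
  exact: subclosed_compact Hcl (@group_compact _ _ G) HG.
have max_ex (g : 'M[R]_n) : exists h : 'M[R]_n,
    H h /\ forall k, H k -> \tr (k *m g) <= \tr (h *m g).
  have H0 : H !=set0 by exists 1%:M.
  have cf : {within H, continuous (fun h : 'M[R]_n => \tr (h *m g))}.
    apply: continuous_subspaceT => h.
    apply: (@cvg_mxtrace R _ (nbhs h)); apply: (@cvg_mulmx R _ (nbhs h)).
      exact: cvg_id.
    exact: cvg_cst.
  have [h hH hmax] := compact_EVT_max H0 Hco cf.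
  by exists h; split; [exact: set_mem | move=> k Hk; apply: hmax; exact: mem_set].
have [g0 g0P] := choice seq_ex; have [h hP] := choice max_ex.
pose g j := h (g0 j) *m g0 j.
have Hh j : H (h (g0 j)) by case: (hP (g0 j)).
have Gg j : (G : set _) (g j).
  by apply: group_mul; [exact: HG | case: (g0P j)].
have g_neq1 j : g j != 1%:M.
  apply/eqP => gj; case: (g0P j) => Gg0 _; apply.
  suff -> : g0 j = (h (g0 j))^T by apply: Hinv.
  by rewrite -[LHS]mul1mx -(group_orthogonal (HG _ (Hh j))) -mulmxA -/(g j) gj mulmx1.
(* Compared with the element 1 of [H], the maximizer does not decrease the trace, so [g j] inherits
   its closeness to 1 from [g0 j]. *)
have g_close j : `|g j - 1%:M| ^+ 2 <= 2 * n%:R * j.+1%:R^-1.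
  apply: le_trans (orthogonal_dist (group_orthogonal (Gg j))) _.
  rewrite -mulrA ler_wpM2l //.
  apply: (le_trans (y := n%:R - \tr (g0 j))).
    rewrite lerB //; have [_ hmax] := hP (g0 j).
    by have := hmax _ H1; rewrite mul1mx.
  rewrite -[X in X - _](mxtrace1 R n) -raddfB /=; apply: le_trans (ler_norm _) _.
  apply: le_trans (ler_norm_sum _ _ _) _.
  rewrite mulr_natl -[in leRHS](card_ord n) -sumr_const; apply: ler_sum => i _.
  apply: le_trans (mx_entry_le_norm _ _ _) _.
  by rewrite distrC ltW //; case: (g0P j).
have g_cvg1 : g @ \oo --> (1%:M : 'M[R]_n).
  apply/cvgrPdist_le => e e0; near=> j; rewrite distrC.
  rewrite -(@ler_pXn2r _ 2) ?nnegrE ?(ltW e0) //.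
  apply: le_trans (g_close j) _.
  rewrite ler_pdivrMr ?ltr0n // [leRHS]mulrC -ler_pdivrMr ?exprn_gt0 //.
  apply: ltW; rewrite -truncn_lt_nat ?divr_ge0 ?mulr_ge0 ?exprn_ge0 ?(ltW e0) //.
  by near: j; exists (Num.truncn (2 * n%:R / e ^+ 2)).
pose a j := `|g j - 1%:M|^-1 *: (g j - 1%:M).
have a_norm j : `|a j| = 1.
  rewrite normrZ normfV normr_id mulVf // normr_eq0 subr_eq0; exact: g_neq1.
pose S := [set x : 'M[R]_n | `|x| = 1].
have Sco : compact S.
  apply: (@mx_bounded_closed_compact _ _ _ _ 1) => [x /= -> //|].
  have -> : S = (fun x : 'M[R]_n => `|x|) @^-1` [set 1 : R] by [].
  apply: closed_comp; last exact: closed_eq.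
  by move=> x _; exact: norm_continuous.
(* Along an ultrafilter finer than the tails, the directions [a j] converge in the compact unit
   sphere. *)
have [U [Uultra oU]] := ultraFilterLemma eventually_filter.
have UP := @ultra_proper _ U Uultra.
have aS : (a @ U) S by apply: (@filterE _ U _ (a @^-1` S)) => j; exact: a_norm.
have [A [SA Acl]] := Sco (a @ U) _ aS.
have aA : a @ U --> A.
  move=> B AB; have [//|nB] := in_ultra_setVsetC (a @^-1` B) Uultra.
  by have [x [nBx Bx]] := Acl (~` B) B nB AB; case: nBx.
have Ug1 : g @ U --> (1%:M : 'M[R]_n) by move=> B /g_cvg1 /oU.
have UGg : \forall j \near U, (G : set _) (g j) by exact: filterE.
have Un1 : \forall j \near U, g j != 1%:M by exact: filterE.
have LA : lie_algebra G A := @tangent_lie nat U UP g A UGg Ug1 Un1 aA.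
have skewA : A^T = - A := @tangent_skew nat U UP g A UGg Ug1 aA.
have trXg X j : lie_algebra G X -> \tr (X *m g j) = 0.
  move=> GX; apply: trace_max_critical => t; rewrite mulmxA.
  have [_ hmax] := hP (g0 j); apply: hmax; apply: Hmul => //; apply: Hexp.
  exact: lie_scale.
have trAA : \tr (A *m A) = 0.
  have lim0 : (fun j => \tr (A *m a j)) @ U --> \tr (A *m A).
    by apply: cvg_mxtrace; apply: cvg_mulmx => //; apply: cvg_cst.
  have tr0 : (fun j => \tr (A *m a j)) = cst 0.
    apply/funext => j; rewrite /a -scalemxAr mxtraceZ mulmxBr raddfB /= trXg //.
    by rewrite mulmx1 lie_trace0 // subr0 mulr0.
  rewrite tr0 in lim0; exact: (@norm_cvg_unique R R _ _ _ _ lim0 (cvg_cst _)).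
have A0 : A = 0.
  apply/matrixP => i j; rewrite mxE; apply/eqP; rewrite -sqrf_eq0.
  have sq : \sum_k \sum_l A l k ^+ 2 = 0.
    transitivity (- \tr (A *m A)); last by rewrite trAA oppr0.
    rewrite -raddfN /= -mulNmx -skewA; apply: eq_bigr => k _.
    by rewrite mxE; apply: eq_bigr => l _; rewrite mxE expr2.
  have /eqP := sq; rewrite psumr_eq0; last first.
    by move=> k _; apply: sumr_ge0 => l _; exact: sqr_ge0.
  move/allP/(_ j (mem_index_enum _)) => /=.
  rewrite psumr_eq0; last by move=> l _; exact: sqr_ge0.
  by move/allP/(_ i (mem_index_enum _)).
by move: SA; rewrite /S /= A0 normr0 => /eqP; rewrite eq_sym oner_eq0.
Unshelve. all: by end_near. Qed.

(** Translates of the neighbourhood of 1 by elements of [H] make [H] open in [G]; it is also closed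
    and nonempty. *)
Theorem closed_subgroup_full (H : set 'M[R]_n) :
  connected (G : set 'M[R]_n) ->
  H `<=` G -> closed H -> H 1%:M ->
  (forall g h, H g -> H h -> H (g *m h)) -> (forall g, H g -> H g^T) ->
  (forall X, lie_algebra G X -> H (expmx X)) -> H = G.
Proof.
move=> Gconn HG Hcl H1 Hmul Hinv Hexp.
have [d d0 Hd] := closed_subgroup_nbhs1 HG Hcl H1 Hmul Hinv Hexp.
apply: Gconn; first by exists 1%:M.
- exists (\bigcup_(h in H) [set g : 'M[R]_n | `|h^T *m g - 1%:M| < d]).
    apply: bigcup_open => h _.
    have -> : [set g : 'M[R]_n | `|h^T *m g - 1%:M| < d] =
      (fun g : 'M[R]_n => `|h^T *m g - 1%:M|) @^-1` [set x | x < d] by [].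
    apply: open_comp; last exact: open_lt.
    move=> g _; apply: (@cvg_norm _ _ _ (nbhs g)); apply: (@cvgB _ _ _ (nbhs g)).
      apply: (@cvg_mulmx R _ (nbhs g)); [exact: cvg_cst | exact: cvg_id].
    exact: cvg_cst.
  rewrite eqEsubset; split => [g Hg|g [Gg [h Hh /= hg]]].
    split; first exact: HG.
    by exists g => //=; rewrite (@group_orthogonal _ _ G _ (HG _ Hg)) subrr normr0.
  have Hhg : H (h^T *m g).
    by apply: Hd => //; apply: group_mul => //; apply: group_tr; exact: HG.
  have -> : g = h *m (h^T *m g).
    by rewrite mulmxA (mulmx1C (@group_orthogonal _ _ G _ (HG _ Hh))) mul1mx.
  exact: Hmul.
- by exists H => //; rewrite eqEsubset; split => [g Hg|g []//]; split => //; exact: HG.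
Qed.

Lemma connected_of_identity_component :
  identity_component G = G -> connected (G : set 'M[R]_n).
Proof. by move=> <-; exact: component_connected. Qed.

End Cartan.

(** * Quaternions and the spin 3/2 representation *)

Definition mk_mx (S : nzRingType) m n (s : seq (seq S)) : 'M[S]_(m, n) :=
  \matrix_(i, j) nth 0 (nth [::] s i) j.

Ltac ord_cases i := case: i; do 12?[case=> //]; move=> ?.
Ltac mx_entries := let i := fresh "i" in let j := fresh "j" in
  apply/matrixP => i j; ord_cases i; ord_cases j;
  rewrite ?mxE; do ?[rewrite !big_ord_recl]; rewrite ?big_ord0 ?mxE /=;
  do ?[rewrite !big_ord_recl]; rewrite ?big_ord0 ?mxE /=.
Ltac mx_ring := mx_entries; ring.

Record quat (R : Type) := Quat { q0 : R; q1 : R; q2 : R; q3 : R }.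

Section Quaternions.
Variable R : realType.
Implicit Types k q : quat R.

Definition qmul k q := Quat
  (q0 k * q0 q - q1 k * q1 q - q2 k * q2 q - q3 k * q3 q)
  (q0 k * q1 q + q1 k * q0 q + q2 k * q3 q - q3 k * q2 q)
  (q0 k * q2 q - q1 k * q3 q + q2 k * q0 q + q3 k * q1 q)
  (q0 k * q3 q + q1 k * q2 q - q2 k * q1 q + q3 k * q0 q).
Definition qconj k := Quat (q0 k) (- q1 k) (- q2 k) (- q3 k).
(** The squared norm, which is polynomial and multiplicative. *)
Definition qnorm k := q0 k ^+ 2 + q1 k ^+ 2 + q2 k ^+ 2 + q3 k ^+ 2.
Definition qone : quat R := Quat 1 0 0 0.
Definition qaxis (b : 'I_3) : quat R :=
  Quat 0 (b == 0 :> nat)%:R (b == 1 :> nat)%:R (b == 2 :> nat)%:R.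

(* A quaternion is a row of coordinates in 1, i, j, k: [qleft k] sends the row of p to that of k p, and [qright q] to that of p q. *)
Definition qleft k : 'M[R]_4 := mk_mx 4 4 [::
  [:: q0 k; q1 k; q2 k; q3 k];
  [:: - q1 k; q0 k; q3 k; - q2 k];
  [:: - q2 k; - q3 k; q0 k; q1 k];
  [:: - q3 k; q2 k; - q1 k; q0 k]].
Definition qright q : 'M[R]_4 := mk_mx 4 4 [::
  [:: q0 q; q1 q; q2 q; q3 q];
  [:: - q1 q; q0 q; - q3 q; q2 q];
  [:: - q2 q; q3 q; q0 q; - q1 q];
  [:: - q3 q; - q2 q; q1 q; q0 q]].
(** The matrix of [v |-> k v (conj k)] on imaginary quaternions, a rotation when [qnorm k = 1]. *)
Definition qrot k : 'M[R]_3 := mk_mx 3 3 [::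
  [:: q0 k ^+ 2 + q1 k ^+ 2 - q2 k ^+ 2 - q3 k ^+ 2;
      2 * (q1 k * q2 k - q0 k * q3 k); 2 * (q1 k * q3 k + q0 k * q2 k)];
  [:: 2 * (q1 k * q2 k + q0 k * q3 k);
      q0 k ^+ 2 - q1 k ^+ 2 + q2 k ^+ 2 - q3 k ^+ 2;
      2 * (q2 k * q3 k - q0 k * q1 k)];
  [:: 2 * (q1 k * q3 k - q0 k * q2 k); 2 * (q2 k * q3 k + q0 k * q1 k);
      q0 k ^+ 2 - q1 k ^+ 2 - q2 k ^+ 2 + q3 k ^+ 2]].

Lemma qnormM k q : qnorm (qmul k q) = qnorm k * qnorm q.
Proof. rewrite /qnorm /=; ring. Qed.

Lemma qnorm_conj k : qnorm (qconj k) = qnorm k.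
Proof. rewrite /qnorm /=; ring. Qed.

Lemma qnorm1 : qnorm qone = 1.
Proof. rewrite /qnorm /=; ring. Qed.

Lemma qleftM k q : qleft (qmul k q) = qleft q *m qleft k.
Proof. mx_ring. Qed.

Lemma qrightM k q : qright (qmul k q) = qright k *m qright q.
Proof. mx_ring. Qed.

Lemma qrotM k q : qrot (qmul k q) = qrot k *m qrot q.
Proof. mx_ring. Qed.

Lemma qleft_qrightC k q : qleft k *m qright q = qright q *m qleft k.
Proof. mx_ring. Qed.

Lemma qleft_conj k : qleft (qconj k) = (qleft k)^T.
Proof. mx_ring. Qed.

Lemma qright_conj k : qright (qconj k) = (qright k)^T.
Proof. mx_ring. Qed.

Lemma qrot_conj k : qrot (qconj k) = (qrot k)^T.
Proof. mx_ring. Qed.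

Lemma qmul_conj k : qmul k (qconj k) = Quat (qnorm k) 0 0 0.
Proof. rewrite /qmul /qnorm /=; congr Quat; ring. Qed.

Lemma qconj_mul k : qmul (qconj k) k = Quat (qnorm k) 0 0 0.
Proof. rewrite /qmul /qnorm /=; congr Quat; ring. Qed.

Lemma qleft1 : qleft qone = 1%:M. Proof. mx_ring. Qed.
Lemma qright1 : qright qone = 1%:M. Proof. mx_ring. Qed.
Lemma qrot1 : qrot qone = 1%:M. Proof. mx_ring. Qed.

(** This is [k e_b (conj k) = sum_a (qrot k)_ab e_a] multiplied by [k] on the right; acting on rows,
    [qleft] reverses products. *)
Lemma qaxis_rot k (b : 'I_3) :
  \sum_a qrot k a b *: (qleft k *m qleft (qaxis a)) =
  qnorm k *: (qleft (qaxis b) *m qleft k).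
Proof.
under eq_bigr do rewrite -qleftM.
by rewrite -qleftM !big_ord_recl big_ord0 /qnorm; ord_cases b; mx_ring.
Qed.

Lemma qright_axis_rot q (b : 'I_3) :
  qright q *m qright (qaxis b) *m (qright q)^T =
  \sum_a qrot q a b *: qright (qaxis a).
Proof.
rewrite -qright_conj -!qrightM !big_ord_recl big_ord0; ord_cases b; mx_ring.
Qed.

End Quaternions.

(** * The action on 3 x 4 matrices, its contraction and its Gram matrix *)

Section Model.
Variable R : realType.
Implicit Types (k q : quat R) (p : 'M[R]_(3, 4)).

Definition qact k p : 'M[R]_(3, 4) := qrot k *m p *m qleft k.

(** The Clifford contraction [e1 p1 + e2 p2 + e3 p3], whose kernel, of dimension 12 - 4, is [W]. *)
Definition gamma p : 'rV[R]_4 := \sum_a row a p *m qleft (qaxis R a).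

Definition gram p : 'M[R]_3 := \matrix_(b, c)
  \tr ((p *m qright (qaxis R b) *m p^T)^T *m (p *m qright (qaxis R c) *m p^T)).

Lemma qact1 p : qact (qone R) p = p.
Proof. by rewrite /qact qrot1 qleft1 mul1mx mulmx1. Qed.

Lemma qactM k q p : qact k (qact q p) = qact (qmul k q) p.
Proof. by rewrite /qact qrotM qleftM !mulmxA. Qed.

Lemma qact_right k q p : qact k (p *m qright q) = qact k p *m qright q.
Proof. by rewrite /qact -!mulmxA qleft_qrightC. Qed.

Lemma qmul_conj1 k : qnorm k = 1 -> qmul k (qconj k) = qone R.
Proof. by move=> k1; rewrite qmul_conj k1. Qed.

Lemma qconj_mul1 k : qnorm k = 1 -> qmul (qconj k) k = qone R.
Proof. by move=> k1; rewrite qconj_mul k1. Qed.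

Lemma qactK k p : qnorm k = 1 -> qact (qconj k) (qact k p) = p.
Proof. by move=> k1; rewrite qactM qconj_mul1 // qact1. Qed.

Lemma qrightK q p : qnorm q = 1 -> p *m qright q *m qright (qconj q) = p.
Proof. by move=> q1; rewrite -mulmxA -qrightM qmul_conj1 // qright1 mulmx1. Qed.

Lemma qrightVK q p : qnorm q = 1 -> p *m qright (qconj q) *m qright q = p.
Proof. by move=> q1; rewrite -mulmxA -qrightM qconj_mul1 // qright1 mulmx1. Qed.

Lemma qrot_orth k : qnorm k = 1 -> (qrot k)^T *m qrot k = 1%:M.
Proof. by move=> k1; rewrite -qrot_conj -qrotM qconj_mul1 // qrot1. Qed.

Lemma qrot_orthV k : qnorm k = 1 -> qrot k *m (qrot k)^T = 1%:M.
Proof. by move=> k1; rewrite -qrot_conj -qrotM qmul_conj1 // qrot1. Qed.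

Lemma qleft_orthV k : qnorm k = 1 -> qleft k *m (qleft k)^T = 1%:M.
Proof. by move=> k1; rewrite -qleft_conj -qleftM qconj_mul1 // qleft1. Qed.

Lemma gamma_right q p : gamma (p *m qright q) = gamma p *m qright q.
Proof.
rewrite /gamma mulmx_suml; apply: eq_bigr => a _.
by rewrite row_mul -!mulmxA qleft_qrightC.
Qed.

Lemma gamma_qact k p : gamma (qact k p) = qnorm k *: (gamma p *m qleft k).
Proof.
rewrite /gamma mulmx_suml scaler_sumr.
transitivity (\sum_a \sum_b qrot k a b *: (row b p *m (qleft k *m qleft (qaxis R a)))).
  apply: eq_bigr => a _; rewrite /qact row_mul row_mul.
  rewrite [row a _ *m p]mulmx_sum_row !mulmx_suml; apply: eq_bigr => b _.
  by rewrite mxE -!scalemxAl mulmxA.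
rewrite exchange_big /=; apply: eq_bigr => b _.
under eq_bigr do rewrite scalemxAr.
by rewrite -mulmx_sumr qaxis_rot -scalemxAr mulmxA.
Qed.

Lemma mxtrace_conj n (O X Y : 'M[R]_n) : O^T *m O = 1%:M ->
  \tr ((O *m X *m O^T)^T *m (O *m Y *m O^T)) = \tr (X^T *m Y).
Proof.
move=> O1; rewrite !trmx_mul trmxK -!mulmxA.
by rewrite (mulmxA O^T) O1 mul1mx mxtrace_mulC -!mulmxA O1 mulmx1.
Qed.

(** The left multiplication commutes with the [qright] factor and cancels against its transpose; the
    rotation conjugates all [S_b] at once, which the trace form does not see. *)
Lemma gram_qact k p : qnorm k = 1 -> gram (qact k p) = gram p.
Proof.
move=> k1; apply/matrixP => b c; rewrite !mxE.
have S d : qact k p *m qright (qaxis R d) *m (qact k p)^T =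
    qrot k *m (p *m qright (qaxis R d) *m p^T) *m (qrot k)^T.
  rewrite /qact !trmx_mul !mulmxA; congr (_ *m _ *m _).
  rewrite -!mulmxA; congr (_ *m (_ *m _)).
  by rewrite mulmxA qleft_qrightC -mulmxA qleft_orthV // mulmx1.
by rewrite !S mxtrace_conj ?qrot_orth.
Qed.

Lemma gram_right q p : gram (p *m qright q) = (qrot q)^T *m gram p *m qrot q.
Proof.
have S b : p *m qright q *m qright (qaxis R b) *m (p *m qright q)^T =
    \sum_a qrot q a b *: (p *m qright (qaxis R a) *m p^T).
  transitivity (p *m (qright q *m qright (qaxis R b) *m (qright q)^T) *m p^T).
    by rewrite trmx_mul !mulmxA.
  rewrite qright_axis_rot mulmx_sumr mulmx_suml; apply: eq_bigr => a _.
  by rewrite -scalemxAr -scalemxAl.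
apply/matrixP => b c; rewrite !mxE !S [X in \tr (X *m _)]raddf_sum /= mulmx_suml raddf_sum /=.
under [RHS]eq_bigr do rewrite mxE mulr_suml.
rewrite [RHS]exchange_big /=; apply: eq_bigr => a _.
rewrite mulmx_sumr raddf_sum /=; apply: eq_bigr => d _.
by rewrite [(_ *: _)^T]linearZ /= -scalemxAl -scalemxAr !mxtraceZ !mxE; ring.
Qed.

Definition sect (x1 x2 x3 : R) : 'M[R]_(3, 4) := mk_mx 3 4 [::
  [:: 0; x1; 0; 0]; [:: 0; 0; x2; 0]; [:: 0; 0; 0; x3]].

(** At a section point [S_b] is the infinitesimal rotation about axis [b], scaled by the product of
    the two other coordinates. These are mutually orthogonal, and the 2 counts the two entries of
    each. *)
Lemma gram_sect (x1 x2 x3 : R) : gram (sect x1 x2 x3) = 2 *: mk_mx 3 3 [::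
  [:: (x2 * x3) ^+ 2; 0; 0]; [:: 0; (x1 * x3) ^+ 2; 0];
  [:: 0; 0; (x1 * x2) ^+ 2]].
Proof.
pose S (b : 'I_3) : 'M[R]_3 := nth 0 [::
  mk_mx 3 3 [:: [:: 0; 0; 0]; [:: 0; 0; - (x2 * x3)]; [:: 0; x2 * x3; 0]];
  mk_mx 3 3 [:: [:: 0; 0; x1 * x3]; [:: 0; 0; 0]; [:: - (x1 * x3); 0; 0]];
  mk_mx 3 3 [:: [:: 0; - (x1 * x2); 0]; [:: x1 * x2; 0; 0]; [:: 0; 0; 0]]] b.
have SE b : sect x1 x2 x3 *m qright (qaxis R b) *m (sect x1 x2 x3)^T = S b.
  have -> : sect x1 x2 x3 *m qright (qaxis R b) = mk_mx 3 4 (nth [::] [::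
     [:: [:: - x1; 0; 0; 0]; [:: 0; 0; 0; - x2]; [:: 0; 0; x3; 0]];
     [:: [:: 0; 0; 0; x1]; [:: - x2; 0; 0; 0]; [:: 0; - x3; 0; 0]];
     [:: [:: 0; 0; - x1; 0]; [:: 0; x2; 0; 0]; [:: - x3; 0; 0; 0]]] b).
    by ord_cases b; mx_ring.
  by rewrite /S; ord_cases b => /=; mx_ring.
apply/matrixP => b c; rewrite mxE !SE /S /mxtrace.
ord_cases b; ord_cases c; rewrite /= !big_ord_recl big_ord0 !mxE;
  do ?[rewrite !big_ord_recl]; rewrite !big_ord0 !mxE /=; ring.
Qed.

Lemma gamma_sect (x1 x2 x3 : R) : x1 + x2 + x3 = 0 -> gamma (sect x1 x2 x3) = 0.
Proof.
move=> x0; have x3E : x3 = - x1 - x2 by lra.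
rewrite /gamma x3E; apply/rowP => j; rewrite !big_ord_recl big_ord0 !mxE.
ord_cases j; do ?[rewrite !big_ord_recl]; rewrite ?big_ord0 ?mxE /=; ring.
Qed.

End Model.

(** * Normal form of a point of the model *)

Section UnitQuaternions.
Variable R : realType.

(** Two quaternions are packed into one row of length 8, at offsets 0 and 4, so that pairs of unit
    quaternions fill a compact set of rows. *)
Definition quat_at (v : 'rV[R]_8) s : quat R := Quat
  (v 0 (inord s)) (v 0 (inord s.+1)) (v 0 (inord s.+2)) (v 0 (inord s.+3)).

Lemma continuous_qleft s : continuous (fun v => qleft (quat_at v s)).
Proof.
apply: continuous_mx_entries => i j; ord_cases i; ord_cases j;
  under eq_fun do rewrite mxE /=; do ?apply: continuous_fun_opp;
  exact: coord_continuous.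
Qed.

Lemma continuous_qright s : continuous (fun v => qright (quat_at v s)).
Proof.
apply: continuous_mx_entries => i j; ord_cases i; ord_cases j;
  under eq_fun do rewrite mxE /=; do ?apply: continuous_fun_opp;
  exact: coord_continuous.
Qed.

(** [qleft k *m (qright k)^T] is conjugation by [k] acting on rows, so its imaginary block is the
    transpose of [qrot k]. Continuity then reduces to that of matrix products. *)
Lemma qrot_entry (k : quat R) (i j : 'I_3) :
  qrot k i j = (qleft k *m (qright k)^T) (lift ord0 j) (lift ord0 i).
Proof. by ord_cases i; ord_cases j; rewrite !mxE !big_ord_recl big_ord0 !mxE /=; ring. Qed.

Lemma qnorm_entry (k : quat R) : qnorm k = (qleft k *m (qleft k)^T) 0 0.
Proof. by rewrite mxE !big_ord_recl big_ord0 !mxE /qnorm /=; ring. Qed.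

Lemma continuous_qrot s : continuous (fun v => qrot (quat_at v s)).
Proof.
apply: continuous_mx_entries => i j; under eq_fun do rewrite qrot_entry.
apply: continuous_fun_entry; apply: continuous_fun_mulmx.
  exact: continuous_qleft.
by apply: continuous_fun_trmx; exact: continuous_qright.
Qed.

Lemma continuous_qnorm s : continuous (fun v => qnorm (quat_at v s)).
Proof.
under eq_fun do rewrite qnorm_entry.
apply: continuous_fun_entry; apply: continuous_fun_mulmx.
  exact: continuous_qleft.
by apply: continuous_fun_trmx; exact: continuous_qleft.
Qed.

Lemma qnorm_entry_le (k : quat R) : qnorm k = 1 ->
  [/\ `|q0 k| <= 1, `|q1 k| <= 1, `|q2 k| <= 1 & `|q3 k| <= 1].
Proof.
rewrite /qnorm => k1.
have sq x : x ^+ 2 <= 1 -> `|x| <= 1 :> R.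
  by move=> x1; rewrite -(@expr_le1 _ 2) // real_normK ?num_real.
have := sqr_ge0 (q0 k); have := sqr_ge0 (q1 k).
have := sqr_ge0 (q2 k); have := sqr_ge0 (q3 k).
by move=> *; split; apply: sq; lra.
Qed.

Lemma unit_quat2_max (f : quat R -> quat R -> R) :
  continuous (fun v => f (quat_at v 0) (quat_at v 4)) ->
  exists k q, [/\ qnorm k = 1, qnorm q = 1 &
    forall k' q', qnorm k' = 1 -> qnorm q' = 1 -> f k' q' <= f k q].
Proof.
move=> cf.
pose A := [set v : 'rV[R]_8 | qnorm (quat_at v 0) = 1] `&`
  [set v : 'rV[R]_8 | qnorm (quat_at v 4) = 1].
pose pair k q : 'rV[R]_8 :=
  \row_i nth 0 [:: q0 k; q1 k; q2 k; q3 k; q0 q; q1 q; q2 q; q3 q] i.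
have pair1 k q : quat_at (pair k q) 0 = k.
  by case: k => *; rewrite /quat_at !mxE !inordK.
have pair2 k q : quat_at (pair k q) 4 = q.
  by case: q => *; rewrite /quat_at !mxE !inordK.
have A0 : A !=set0.
  by exists (pair (qone R) (qone R)); rewrite /A /= pair1 pair2 qnorm1.
have Acl s : closed [set v : 'rV[R]_8 | qnorm (quat_at v s) = 1].
  have -> : [set v : 'rV[R]_8 | qnorm (quat_at v s) = 1] =
    (fun v => qnorm (quat_at v s)) @^-1` [set x : R | x = 1] by [].
  by apply: closed_comp; [move=> v _; exact: continuous_qnorm | exact: closed_eq].
have Aco : compact A.
  apply: (@mx_bounded_closed_compact _ _ _ A 1); last exact: closedI.
  move=> v [/qnorm_entry_le[h0 h1 h2 h3] /qnorm_entry_le[h4 h5 h6 h7]].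
  apply: mx_norm_le => // i j; rewrite ord1.
  rewrite -[j]inord_val; case: j => -[|[|[|[|[|[|[|[|]]]]]]]] //=.
have [v vA vmax] := compact_EVT_max A0 Aco (continuous_subspaceT cf).
have [v1 v2] : A v by exact: set_mem.
exists (quat_at v 0), (quat_at v 4); split => // k' q' k1 q1.
have := vmax (pair k' q'); rewrite pair1 pair2; apply.
by apply: mem_set; rewrite /A /= pair1 pair2.
Qed.

Lemma mulr_le_normM (a y z : R) : `|y| <= z -> a * y <= `|a| * z.
Proof.
by move=> yz; apply: le_trans (ler_norm _) _; rewrite normrM ler_wpM2l.
Qed.

(** [B] is the derivative along the circle at [(1, 0)]. The rational parametrization turns the
    hypothesis into a polynomial inequality in [t] with linear term [2 B t]. *)
Lemma cubic_circle_critical (A B C D : R) :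
  (forall c s, c ^+ 2 + s ^+ 2 = 1 ->
    A * c ^+ 3 + B * c ^+ 2 * s + C * c * s ^+ 2 + D * s ^+ 3 <= A) -> B = 0.
Proof.
move=> H; suff : 2 * B = 0 by lra.
(* Sum of the bounds by [t ^ 2], for [|t| <= 1], of all terms of higher order left after multiplying
   by [(1 + t ^ 2) ^ 3]. *)
pose K := 8 * `|A| + 4 * `|C| + 8 * `|D| + 4 * `|B|.
apply: (@first_order_vanish _ _ K) => [|t t1].
  by rewrite /K; have := normr_ge0 A; have := normr_ge0 B;
     have := normr_ge0 C; have := normr_ge0 D; lra.
have t2 : 0 <= t ^+ 2 <= 1 by rewrite sqr_ge0 -[t ^+ 2]real_normK ?num_real // expr_le1.
have t3 : `|t ^+ 3| <= t ^+ 2.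
  by rewrite exprS normrM -[leRHS]mul1r (ger0_norm (sqr_ge0 t)) ler_wpM2r ?sqr_ge0.
have d0 : 1 + t ^+ 2 != 0 by lra.
have := H ((1 - t ^+ 2) / (1 + t ^+ 2)) (2 * t / (1 + t ^+ 2)) _.
have -> : ((1 - t ^+ 2) / (1 + t ^+ 2)) ^+ 2 + (2 * t / (1 + t ^+ 2)) ^+ 2 = 1 by field.
move=> /(_ erefl).
set L := (X in X <= A -> _).
have -> : L = (A * (1 - t ^+ 2) ^+ 3 + B * (1 - t ^+ 2) ^+ 2 * (2 * t)
   + C * (1 - t ^+ 2) * (2 * t) ^+ 2 + D * (2 * t) ^+ 3) / (1 + t ^+ 2) ^+ 3.
  by rewrite /L; field.
rewrite ler_pdivrMr; last by rewrite exprn_gt0 //; lra.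
have hA : A * (6 * t ^+ 2 + 2 * t ^+ 6) <= `|A| * (8 * t ^+ 2).
  apply: mulr_le_normM.
  have -> : t ^+ 6 = t ^+ 2 * (t ^+ 2) ^+ 2 by ring.
  move: t2; set u := t ^+ 2 => /andP[u0 u1]; rewrite ler_norml; nra.
have hC : C * (- (4 * t ^+ 2 * (1 - t ^+ 2))) <= `|C| * (4 * t ^+ 2).
  apply: mulr_le_normM.
  by move: t2; set u := t ^+ 2 => /andP[u0 u1]; rewrite ler_norml; nra.
have hD : D * (- 8 * t ^+ 3) <= `|D| * (8 * t ^+ 2).
  by apply: mulr_le_normM; rewrite normrM normrN; apply: ler_pM => //; rewrite ger0_norm.
have hB : B * (4 * t ^+ 3 - 2 * t ^+ 2 * t ^+ 3) <= `|B| * (4 * t ^+ 2).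
  apply: mulr_le_normM; have -> : 4 * t ^+ 3 - 2 * t ^+ 2 * t ^+ 3 = (4 - 2 * t ^+ 2) * t ^+ 3 by ring.
  rewrite normrM; apply: ler_pM => //; rewrite ger0_norm; lra.
by rewrite /K => h; lra.
Qed.

(** The same for expressions quadratic in the entries of [qrot], themselves quadratic in the
    quaternion. *)
Lemma quartic_circle_critical (A B C D E : R) :
  (forall c s, c ^+ 2 + s ^+ 2 = 1 ->
    A * c ^+ 4 + B * c ^+ 3 * s + C * c ^+ 2 * s ^+ 2 + D * c * s ^+ 3
    + E * s ^+ 4 <= A) -> B = 0.
Proof.
move=> H; suff : 2 * B = 0 by lra.
pose K := 16 * `|A| + 4 * `|C| + 8 * `|D| + 16 * `|E| + 8 * `|B|.
apply: (@first_order_vanish _ _ K) => [|t t1].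
  by rewrite /K; have := normr_ge0 A; have := normr_ge0 B; have := normr_ge0 E;
     have := normr_ge0 C; have := normr_ge0 D; lra.
have t2 : 0 <= t ^+ 2 <= 1 by rewrite sqr_ge0 -[t ^+ 2]real_normK ?num_real // expr_le1.
have t3 : `|t ^+ 3| <= t ^+ 2.
  by rewrite exprS normrM -[leRHS]mul1r (ger0_norm (sqr_ge0 t)) ler_wpM2r ?sqr_ge0.
have d0 : 1 + t ^+ 2 != 0 by lra.
have := H ((1 - t ^+ 2) / (1 + t ^+ 2)) (2 * t / (1 + t ^+ 2)) _.
have -> : ((1 - t ^+ 2) / (1 + t ^+ 2)) ^+ 2 + (2 * t / (1 + t ^+ 2)) ^+ 2 = 1 by field.
move=> /(_ erefl).
set L := (X in X <= A -> _).
have -> : L = (A * (1 - t ^+ 2) ^+ 4 + B * (1 - t ^+ 2) ^+ 3 * (2 * t)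
   + C * (1 - t ^+ 2) ^+ 2 * (2 * t) ^+ 2 + D * (1 - t ^+ 2) * (2 * t) ^+ 3
   + E * (2 * t) ^+ 4) / (1 + t ^+ 2) ^+ 4.
  by rewrite /L; field.
rewrite ler_pdivrMr; last by rewrite exprn_gt0 //; lra.
have hA : A * (8 * t ^+ 2 + 8 * t ^+ 6) <= `|A| * (16 * t ^+ 2).
  apply: mulr_le_normM.
  have -> : t ^+ 6 = t ^+ 2 * (t ^+ 2) ^+ 2 by ring.
  move: t2; set u := t ^+ 2 => /andP[u0 u1]; rewrite ler_norml; nra.
have hC : C * (- (4 * t ^+ 2 * (1 - t ^+ 2) ^+ 2)) <= `|C| * (4 * t ^+ 2).
  apply: mulr_le_normM.
  move: t2; set u := t ^+ 2 => /andP[u0 u1].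
  have v0 := sqr_ge0 (1 - u); have v1 : (1 - u) ^+ 2 <= 1 by nra.
  by move: v0 v1; set v := (1 - u) ^+ 2 => v0 v1; rewrite ler_norml; nra.
have hD : D * (- (8 * (1 - t ^+ 2)) * t ^+ 3) <= `|D| * (8 * t ^+ 2).
  apply: mulr_le_normM; rewrite normrM normrN; apply: ler_pM => //.
  by rewrite ger0_norm; lra.
have hE : E * (- 16 * t ^+ 4) <= `|E| * (16 * t ^+ 2).
  apply: mulr_le_normM; have -> : t ^+ 4 = t ^+ 2 * t ^+ 2 by ring.
  by move: t2; set u := t ^+ 2 => /andP[u0 u1]; rewrite ler_norml; nra.
have hB : B * ((6 - 6 * t ^+ 2 + 2 * t ^+ 4) * t ^+ 3) <= `|B| * (8 * t ^+ 2).
  apply: mulr_le_normM; rewrite normrM; apply: ler_pM => //.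
  have -> : t ^+ 4 = t ^+ 2 * t ^+ 2 by ring.
  by move: t2; set u := t ^+ 2 => /andP[u0 u1]; rewrite ler_norml; nra.
by rewrite /K => h; lra.
Qed.

End UnitQuaternions.

Section NormalForm.
Variable R : realType.
Implicit Types (k q a b c : quat R) (p : 'M[R]_(3, 4)).

Definition quat_rows a b c : 'M[R]_(3, 4) := mk_mx 3 4 [::
  [:: q0 a; q1 a; q2 a; q3 a]; [:: q0 b; q1 b; q2 b; q3 b];
  [:: q0 c; q1 c; q2 c; q3 c]].

Lemma quat_rowsP p : exists a b c, p = quat_rows a b c.
Proof.
pose row i := Quat (p i (inord 0)) (p i (inord 1)) (p i (inord 2)) (p i (inord 3)).
exists (row (inord 0)), (row (inord 1)), (row (inord 2)).
apply/matrixP => i j; rewrite mxE /row -[i in LHS]inord_val -[j in LHS]inord_val.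
by ord_cases i; ord_cases j.
Qed.

Let i0 : 'I_3 := @Ordinal 3 0 isT.
Let i1 : 'I_3 := @Ordinal 3 1 isT.
Let i2 : 'I_3 := @Ordinal 3 2 isT.
Let j1 : 'I_4 := @Ordinal 4 1 isT.
Let j2 : 'I_4 := @Ordinal 4 2 isT.
Let j3 : 'I_4 := @Ordinal 4 3 isT.

(* Scalar product with the regular section point sect 2 1 (-3), whose maximum over the orbits singles out a Weyl chamber of the section. *)
Definition height p : R := 2 * p i0 j1 + p i1 j2 - 3 * p i2 j3.

Let height_left k a b c : R :=
    2 * (qrot k i0 i0 * q1 (qmul k a) + qrot k i0 i1 * q1 (qmul k b)
         + qrot k i0 i2 * q1 (qmul k c))
  + (qrot k i1 i0 * q2 (qmul k a) + qrot k i1 i1 * q2 (qmul k b)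
         + qrot k i1 i2 * q2 (qmul k c))
  - 3 * (qrot k i2 i0 * q3 (qmul k a) + qrot k i2 i1 * q3 (qmul k b)
         + qrot k i2 i2 * q3 (qmul k c)).

Let height_right q a b c : R :=
  2 * q1 (qmul a q) + q2 (qmul b q) - 3 * q3 (qmul c q).

Lemma height_qact k a b c :
  height (qact k (quat_rows a b c)) = height_left k a b c.
Proof.
rewrite /height /height_left /qact !mxE !big_ord_recl !big_ord0 !mxE.
by do ?[rewrite !big_ord_recl]; rewrite !big_ord0 !mxE /=; ring.
Qed.

Lemma height_mul_right q a b c :
  height (quat_rows a b c *m qright q) = height_right q a b c.
Proof.
rewrite /height /height_right !mxE !big_ord_recl !big_ord0 !mxE /=; ring.
Qed.

Lemma linear_critical (f : R -> R -> R) :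
  (forall x y : R, f x y = f 1 0 * x + f 0 1 * y) ->
  (forall x y : R, x ^+ 2 + y ^+ 2 = 1 -> f x y <= f 1 0) -> f 0 1 = 0.
Proof.
move=> fE fmax.
apply: (@cubic_circle_critical _ (f 1 0) _ (f 1 0) (f 0 1)) => x y xy.
set l := (X in X <= _).
(* On the circle a linear form becomes cubic after multiplication by [x ^ 2 + y ^ 2 = 1]. *)
have -> : l = (f 1 0 * x + f 0 1 * y) * (x ^+ 2 + y ^+ 2) by rewrite /l; ring.
by rewrite xy mulr1 -fE; apply: fmax.
Qed.

(** The coefficients other than [B] are recovered from the values at [(1, 0)], [(0, 1)], [(1, 1)]
    and [(1, -1)], so that each use only has to exhibit [B]. *)
Lemma cubic_critical (f : R -> R -> R) B :
  (forall x y : R, f x y = f 1 0 * x ^+ 3 + B * x ^+ 2 * y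
    + ((f 1 1 + f 1 (-1)) / 2 - f 1 0) * x * y ^+ 2 + f 0 1 * y ^+ 3) ->
  (forall x y : R, x ^+ 2 + y ^+ 2 = 1 -> f x y <= f 1 0) -> B = 0.
Proof.
move=> fE fmax.
apply: (@cubic_circle_critical _ (f 1 0) B ((f 1 1 + f 1 (-1)) / 2 - f 1 0)
  (f 0 1)) => x y xy.
by rewrite -fE; apply: fmax.
Qed.

(** Criticality along the circles from 1 towards i, j, k gives three linear equations on the left
    and three on the right; [gamma = 0] gives four more. These ten equations kill the nine
    coordinates off the section and leave the sum condition. *)
Lemma height_critical a b c :
  gamma (quat_rows a b c) = 0 ->
  (forall k, qnorm k = 1 -> height (qact k (quat_rows a b c)) <= height (quat_rows a b c)) ->
  (forall q, qnorm q = 1 -> height (quat_rows a b c *m qright q) <= height (quat_rows a b c)) ->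
  quat_rows a b c = sect (q1 a) (q2 b) (q3 c) /\ q1 a + q2 b + q3 c = 0.
Proof.
move=> g0 kmax qmax.
have hl k : qnorm k = 1 -> height_left k a b c <= height_left (qone R) a b c.
  by move=> k1; rewrite -!height_qact qact1; apply: kmax.
have hr q : qnorm q = 1 -> height_right q a b c <= height_right (qone R) a b c.
  by move=> q1; rewrite -!height_mul_right qright1 mulmx1; apply: qmax.
have L1 : 2 * q0 a - 7 * q3 b - 5 * q2 c = 0.
  apply: (@cubic_critical (fun x y => height_left (Quat x y 0 0) a b c)).
    by move=> x y; rewrite /height_left !mxE /=; field.
  by move=> x y xy; apply: hl; rewrite /qnorm /= -xy; ring.
have L2 : 8 * q3 a + q0 b + 7 * q1 c = 0.
  apply: (@cubic_critical (fun x y => height_left (Quat x 0 y 0) a b c)).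
    by move=> x y; rewrite /height_left !mxE /=; field.
  by move=> x y xy; apply: hl; rewrite /qnorm /= -xy; ring.
have L3 : - 3 * q1 b - 3 * q0 c = 0.
  apply: (@cubic_critical (fun x y => height_left (Quat x 0 0 y) a b c)).
    by move=> x y; rewrite /height_left !mxE /=; field.
  by move=> x y xy; apply: hl; rewrite /qnorm /= -xy; ring.
have R1 := (@linear_critical (fun x y => height_right (Quat x y 0 0) a b c)).
have R2 := (@linear_critical (fun x y => height_right (Quat x 0 y 0) a b c)).
have R3 := (@linear_critical (fun x y => height_right (Quat x 0 0 y) a b c)).
have {}R1 : height_right (Quat 0 1 0 0) a b c = 0.
  apply: R1 => x y; first by rewrite /height_right /=; ring.
  by move=> xy; apply: hr; rewrite /qnorm /= -xy; ring.
have {}R2 : height_right (Quat 0 0 1 0) a b c = 0.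
  apply: R2 => x y; first by rewrite /height_right /=; ring.
  by move=> xy; apply: hr; rewrite /qnorm /= -xy; ring.
have {}R3 : height_right (Quat 0 0 0 1) a b c = 0.
  apply: R3 => x y; first by rewrite /height_right /=; ring.
  by move=> xy; apply: hr; rewrite /qnorm /= -xy; ring.
have g (j : 'I_4) := congr1 (fun v : 'rV[R]_4 => v 0 j) g0.
have := g ord0; have := g (lift ord0 ord0); have := g j2; have := g j3.
rewrite /gamma !mxE !big_ord_recl !big_ord0 !mxE.
do ?[rewrite !big_ord_recl]; rewrite !big_ord0 !mxE /= => G3 G2 G1 G0.
move: R1 R2 R3; rewrite /height_right /= => R1 R2 R3.
case: a b c {g0 kmax qmax hl hr g} L1 L2 L3 R1 R2 R3 G0 G1 G2 G3
  => [a0 a1 a2 a3] [b0 b1 b2 b3] [c0 c1 c2 c3] /= L1 L2 L3 R1 R2 R3 G0 G1 G2 G3.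
split; last by lra.
apply/matrixP => i j; rewrite !mxE; ord_cases i; ord_cases j => //=; lra.
Qed.

End NormalForm.

(** * Symmetries of the section and reduction to a chamber *)

Section Chamber.
Variable R : realType.
Implicit Types (k q : quat R) (p : 'M[R]_(3, 4)).

Lemma height_sect (y1 y2 y3 : R) : height (sect y1 y2 y3) = 2 * y1 + y2 - 3 * y3.
Proof. by rewrite /height !mxE. Qed.

Let h : R := Num.sqrt (1 / 2).

Let hh : 2 * h ^+ 2 = 1.
Proof. by rewrite /h sqr_sqrtr ?divr_ge0 //; field. Qed.

Let hhhh : 4 * h ^+ 4 = 1.
Proof.
have -> : 4 * h ^+ 4 = (2 * h ^+ 2) ^+ 2 by ring.
by rewrite hh expr1n.
Qed.

Definition diag3 (y1 y2 y3 : R) : 'M[R]_3 :=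
  mk_mx 3 3 [:: [:: y1; 0; 0]; [:: 0; y2; 0]; [:: 0; 0; y3]].

Let imag : 'M[R]_(3, 4) :=
  mk_mx 3 4 [:: [:: 0; 1; 0; 0]; [:: 0; 0; 1; 0]; [:: 0; 0; 0; 1]].

Let sectE (y1 y2 y3 : R) : sect y1 y2 y3 = diag3 y1 y2 y3 *m imag.
Proof. mx_ring. Qed.

Let imag_conj k : imag *m (qleft k *m qright (qconj k)) = (qrot k)^T *m imag.
Proof.
rewrite qright_conj; apply/matrixP => i j.
rewrite !mxE !big_ord_recl !big_ord0 !mxE !big_ord_recl !big_ord0 !mxE.
ord_cases i; ord_cases j; rewrite /=; ring.
Qed.

(* The section consists of the matrices X *m imag with X diagonal, and the diagonal quaternions (k, k^-1) act on X by conjugation by a rotation. *)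
Lemma sect_conj k (y1 y2 y3 z1 z2 z3 : R) :
  qrot k *m diag3 y1 y2 y3 *m (qrot k)^T = diag3 z1 z2 z3 ->
  qact k (sect y1 y2 y3) *m qright (qconj k) = sect z1 z2 z3.
Proof.
by move=> e; rewrite !sectE /qact -e -!mulmxA imag_conj.
Qed.

(** [Quat 0 h h 0] is the half-turn about [e1 + e2]: it exchanges two axes and reverses the third, a
    sign that conjugation of a diagonal matrix does not see. *)
Lemma sect_swap12 (y1 y2 y3 : R) :
  qact (Quat 0 h h 0) (sect y1 y2 y3) *m qright (qconj (Quat 0 h h 0)) =
  sect y2 y1 y3.
Proof.
apply: sect_conj; have -> : qrot (Quat 0 h h 0) = mk_mx 3 3 [:: [:: 0; 1; 0]; [:: 1; 0; 0]; [:: 0; 0; -1]].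
  by apply/matrixP => i j; rewrite !mxE; ord_cases i; ord_cases j; move: hh; rewrite /=; move: h => u hu; lra.
by mx_ring.
Qed.

Lemma sect_swap23 (y1 y2 y3 : R) :
  qact (Quat 0 0 h h) (sect y1 y2 y3) *m qright (qconj (Quat 0 0 h h)) =
  sect y1 y3 y2.
Proof.
apply: sect_conj; have -> : qrot (Quat 0 0 h h) = mk_mx 3 3 [:: [:: -1; 0; 0]; [:: 0; 0; 1]; [:: 0; 1; 0]].
  by apply/matrixP => i j; rewrite !mxE; ord_cases i; ord_cases j; move: hh; rewrite /=; move: h => u hu; lra.
by mx_ring.
Qed.

Lemma sect_swap13 (y1 y2 y3 : R) :
  qact (Quat 0 h 0 h) (sect y1 y2 y3) *m qright (qconj (Quat 0 h 0 h)) =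
  sect y3 y2 y1.
Proof.
apply: sect_conj; have -> : qrot (Quat 0 h 0 h) = mk_mx 3 3 [:: [:: 0; 0; 1]; [:: 0; -1; 0]; [:: 1; 0; 0]].
  by apply/matrixP => i j; rewrite !mxE; ord_cases i; ord_cases j; move: hh; rewrite /=; move: h => u hu; lra.
by mx_ring.
Qed.

Lemma sect_neg (y1 y2 y3 : R) :
  sect y1 y2 y3 *m qright (Quat (-1) 0 0 0) = sect (- y1) (- y2) (- y3).
Proof. by mx_ring. Qed.

Lemma sect_chamber (y1 y2 y3 : R) : y1 + y2 + y3 = 0 ->
  (forall k q, qnorm k = 1 -> qnorm q = 1 ->
     height (qact k (sect y1 y2 y3) *m qright q) <= height (sect y1 y2 y3)) ->
  0 <= y2 <= y1.
Proof.
move=> y0 ymax.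
have n12 : qnorm (Quat 0 h h 0) = 1 by rewrite /qnorm /= -hh; ring.
have n23 : qnorm (Quat 0 0 h h) = 1 by rewrite /qnorm /= -hh; ring.
have n13 : qnorm (Quat 0 h 0 h) = 1 by rewrite /qnorm /= -hh; ring.
have := ymax _ _ n12 (etrans (qnorm_conj _) n12); rewrite sect_swap12 !height_sect.
have := ymax _ _ n23 (etrans (qnorm_conj _) n23); rewrite sect_swap23 !height_sect.
(* [(y1, y2, y3) |-> (- y3, - y2, - y1)] is the reflection in the wall [y2 = 0]: a half-turn on both
   sides combined with the right factor -1. *)
have nm : qnorm (qmul (qconj (Quat 0 h 0 h)) (Quat (-1) 0 0 0)) = 1.
  by rewrite qnormM qnorm_conj n13 /qnorm /=; ring.
have := ymax _ _ n13 nm; rewrite qrightM mulmxA sect_swap13 sect_neg !height_sect.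
by move=> *; apply/andP; split; lra.
Qed.

Lemma continuous_height p :
  continuous (fun v => height (qact (quat_at v 0) p *m qright (quat_at v 4))).
Proof.
have c : continuous (fun v : 'rV[R]_8 => qact (quat_at v 0) p *m qright (quat_at v 4)).
  apply: continuous_fun_mulmx; last exact: continuous_qright.
  apply: continuous_fun_mulmx; last exact: continuous_qleft.
  by apply: continuous_fun_mulmx; [exact: continuous_qrot | exact: continuous_mx_cst].
rewrite /height; apply: continuous_fun_sub; first apply: continuous_fun_add.
- by apply: continuous_fun_mul; [exact: continuous_fun_cst | exact: continuous_fun_entry].
- exact: continuous_fun_entry.
- by apply: continuous_fun_mul; [exact: continuous_fun_cst | exact: continuous_fun_entry].
Qed.

Theorem section_normal_form p : gamma p = 0 ->
  exists k q (x y : R), [/\ qnorm k = 1, qnorm q = 1, 0 <= y <= x &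
    p = qact k (sect x y (- x - y)) *m qright q].
Proof.
move=> gp.
have [k [q [k1 q1' kqmax]]] := @unit_quat2_max R
  (fun k q => height (qact k p *m qright q)) (@continuous_height p).
pose p' := qact k p *m qright q.
have p'max k' q' : qnorm k' = 1 -> qnorm q' = 1 ->
    height (qact k' p' *m qright q') <= height p'.
  move=> k'1 q'1; rewrite /p' qact_right qactM -mulmxA -qrightM.
  by apply: kqmax; rewrite qnormM ?k1 ?q1' ?k'1 ?q'1 mulr1.
have gp' : gamma p' = 0.
  by rewrite /p' gamma_right gamma_qact gp mul0mx scaler0 mul0mx.
have [a [b [c p'E]]] := quat_rowsP p'.
have [| | | sE s0] := @height_critical R a b c; rewrite -?p'E //.
- by move=> k' k'1; have := p'max k' (qone R) k'1 (qnorm1 R); rewrite qright1 mulmx1.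
- by move=> q' q'1; have := p'max (qone R) q' (qnorm1 R) q'1; rewrite qact1.
rewrite -p'E in sE.
have ch : 0 <= q2 b <= q1 a.
  by apply: (sect_chamber s0) => k' q' k'1 q'1; rewrite -sE; apply: p'max.
exists (qconj k), (qconj q), (q1 a), (q2 b); split; rewrite ?qnorm_conj //.
have -> : - q1 a - q2 b = q3 c by lra.
by rewrite -sE /p' qact_right qactK // qrightK.
Qed.

End Chamber.

(** * Diagonalization of symmetric 3 x 3 matrices *)

Section Diagonalization.
Variable R : realType.
Implicit Types q r : quat R.

Let i0 : 'I_3 := @Ordinal 3 0 isT.
Let i1 : 'I_3 := @Ordinal 3 1 isT.
Let i2 : 'I_3 := @Ordinal 3 2 isT.

Definition sym3 (a b c d e f : R) : 'M[R]_3 :=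
  mk_mx 3 3 [:: [:: a; d; e]; [:: d; b; f]; [:: e; f; c]].

Lemma sym3P (Y : 'M[R]_3) : Y^T = Y ->
  Y = sym3 (Y i0 i0) (Y i1 i1) (Y i2 i2) (Y i0 i1) (Y i0 i2) (Y i1 i2).
Proof.
move=> YT; have sy i j : Y i j = Y j i by rewrite -{1}YT mxE.
apply/matrixP => i j; rewrite mxE.
have -> : i = @Ordinal 3 i (ltn_ord i) by apply: val_inj.
have -> : j = @Ordinal 3 j (ltn_ord j) by apply: val_inj.
case: i j => -[|[|[|//]]] hi [] [|[|[|//]]] hj /=; do ?[by congr (Y _ _); apply: val_inj];
  by rewrite sy; congr (Y _ _); apply: val_inj.
Qed.

(** The trace against [diag (1, 2, 0)]. At a maximum over rotations, its distinct weights force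
    diagonality and order the eigenvalues as third, first, second, as in [gram_chamber]. *)
Let weight (Y : 'M[R]_3) := Y i0 i0 + 2 * Y i1 i1.

Let rotated r (a b c d e f : R) : R :=
  let o i j := qrot r i j in
  let form j := o i0 j ^+ 2 * a + o i1 j ^+ 2 * b + o i2 j ^+ 2 * c +
    2 * (o i0 j * o i1 j * d + o i0 j * o i2 j * e + o i1 j * o i2 j * f) in
  form i0 + 2 * form i1.

Let weight_rotated r (a b c d e f : R) :
  weight ((qrot r)^T *m sym3 a b c d e f *m qrot r) = rotated r a b c d e f.
Proof.
rewrite /weight /rotated !mxE !big_ord_recl !big_ord0 !mxE !big_ord_recl !big_ord0 !mxE /=.
by ring.
Qed.

Let rotated_max (a b c d e f : R) :
  (forall r, qnorm r = 1 ->
     weight ((qrot r)^T *m sym3 a b c d e f *m qrot r) <= a + 2 * b) ->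
  [/\ d = 0, e = 0, f = 0 & c <= a <= b].
Proof.
move=> wmax.
have rmax r : qnorm r = 1 -> rotated r a b c d e f <= a + 2 * b.
  by rewrite -weight_rotated; exact: wmax.
(* Up to a factor, each off-diagonal entry is the derivative of the weight along one of three
   circles; the other arguments are the remaining coefficients of the restricted quartic. *)
have B3 : - (4 * d) = 0.
  apply: (@quartic_circle_critical _ (a + 2 * b) _
    (- 2 * (a + 2 * b) + 4 * (b + 2 * a)) (4 * d) (a + 2 * b)) => x y xy.
  have := rmax (Quat x 0 0 y); rewrite /qnorm /= => h.
  apply: le_trans (h _); last by rewrite -xy; ring.
  by rewrite le_eqVlt; apply/orP; left; apply/eqP; rewrite /rotated !mxE /=; ring.
have B1 : 8 * f = 0.
  apply: (@quartic_circle_critical _ (a + 2 * b) _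
    (2 * a + 2 * (- 2 * b + 4 * c)) (- (8 * f)) (a + 2 * b)) => x y xy.
  have := rmax (Quat x y 0 0); rewrite /qnorm /= => h.
  apply: le_trans (h _); last by rewrite -xy; ring.
  by rewrite le_eqVlt; apply/orP; left; apply/eqP; rewrite /rotated !mxE /=; ring.
have B2 : - (4 * e) = 0.
  apply: (@quartic_circle_critical _ (a + 2 * b) _
    (- 2 * a + 4 * c + 4 * b) (4 * e) (a + 2 * b)) => x y xy.
  have := rmax (Quat x 0 y 0); rewrite /qnorm /= => h.
  apply: le_trans (h _); last by rewrite -xy; ring.
  by rewrite le_eqVlt; apply/orP; left; apply/eqP; rewrite /rotated !mxE /=; ring.
have d0 : d = 0 by lra.
have e0 : e = 0 by lra.
have f0 : f = 0 by lra.
pose h : R := Num.sqrt (1 / 2).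
have hh : 2 * h ^+ 2 = 1 by rewrite /h sqr_sqrtr ?divr_ge0 //; field.
have hhhh : 4 * h ^+ 4 = 1.
  by have -> : 4 * h ^+ 4 = (2 * h ^+ 2) ^+ 2; [ring | rewrite hh expr1n].
(* Quarter-turns about the axes exchange two diagonal entries. *)
have := rmax (Quat h 0 0 h); have := rmax (Quat h h 0 0).
rewrite /rotated !mxE /= d0 e0 f0; move: hh hhhh; move: h => u hh hhhh.
rewrite /qnorm /= => r1 r3.
have {}r1 : a + 2 * c <= a + 2 * b.
  apply: le_trans (r1 _); last by rewrite -hh; ring.
  have -> : a + 2 * c = 4 * u ^+ 4 * (a + 2 * c) by rewrite hhhh mul1r.
  by rewrite le_eqVlt; apply/orP; left; apply/eqP; ring.
have {}r3 : b + 2 * a <= a + 2 * b.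
  apply: le_trans (r3 _); last by rewrite -hh; ring.
  have -> : b + 2 * a = 4 * u ^+ 4 * (b + 2 * a) by rewrite hhhh mul1r.
  by rewrite le_eqVlt; apply/orP; left; apply/eqP; ring.
have := rmax (Quat u 0 u 0); rewrite /rotated !mxE /= d0 e0 f0 /qnorm /= => r2.
have {}r2 : c + 2 * b <= a + 2 * b.
  apply: le_trans (r2 _); last by rewrite -hh; ring.
  have -> : c + 2 * b = 4 * u ^+ 4 * (c + 2 * b) by rewrite hhhh mul1r.
  by rewrite le_eqVlt; apply/orP; left; apply/eqP; ring.
by split => //; apply/andP; split; lra.
Qed.

(** The diagonalizing matrix must have the form [qrot q], since a right factor of the model has to
    realize it. *)
Theorem sym3_diagonalize (Y : 'M[R]_3) : Y^T = Y ->
  exists q (d1 d2 d3 : R), [/\ qnorm q = 1, d3 <= d1 <= d2 &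
    Y = qrot q *m diag3 d1 d2 d3 *m (qrot q)^T].
Proof.
move=> YT.
have [|_ [q [_ q1 qmax]]] :=
    @unit_quat2_max R (fun _ q => weight ((qrot q)^T *m Y *m qrot q)).
  have c : continuous (fun v : 'rV[R]_8 =>
      (qrot (quat_at v 4))^T *m Y *m qrot (quat_at v 4)).
    apply: continuous_fun_mulmx; last exact: continuous_qrot.
    apply: continuous_fun_mulmx; last exact: continuous_mx_cst.
    by apply: continuous_fun_trmx; exact: continuous_qrot.
  apply: continuous_fun_add; first exact: continuous_fun_entry.
  by apply: continuous_fun_mul; [exact: continuous_fun_cst | exact: continuous_fun_entry].
pose Z := (qrot q)^T *m Y *m qrot q.
have ZT : Z^T = Z by rewrite /Z !trmx_mul trmxK YT mulmxA.
have ZE := sym3P ZT.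
have [|d0 e0 f0 ord] := @rotated_max (Z i0 i0) (Z i1 i1) (Z i2 i2)
    (Z i0 i1) (Z i0 i2) (Z i1 i2).
  move=> r r1; rewrite -ZE -/(weight Z).
  have -> : (qrot r)^T *m Z *m qrot r =
      (qrot (qmul q r))^T *m Y *m qrot (qmul q r).
    by rewrite qrotM trmx_mul /Z !mulmxA.
  by apply: (qmax (qone R)); rewrite ?qnorm1 // qnormM q1 r1 mulr1.
exists q, (Z i0 i0), (Z i1 i1), (Z i2 i2); split => //.
have -> : diag3 (Z i0 i0) (Z i1 i1) (Z i2 i2) = Z.
  by rewrite [RHS]ZE d0 e0 f0.
by rewrite /Z !mulmxA qrot_orthV // mul1mx -mulmxA qrot_orthV // mulmx1.
Qed.

End Diagonalization.

(** * Invariants of the model *)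

Section Chamber.
Variable R : realType.

Lemma cube_inj_le (a b : R) : 0 <= b -> a ^+ 3 <= b ^+ 3 -> a <= b.
Proof.
move=> b0 h; rewrite leNgt; apply/negP => ba.
have a0 : 0 <= a by lra.
by move: h; rewrite leNgt ltrXn2r.
Qed.

(** On this range [(a + c) ^ 3 * (a - 3 c)] increases with [a] and decreases with [c]. If [a < a'],
    equality of [a c ^ 3] forces [c' <= c], and both effects enlarge the primed value. *)
Lemma chamber_le (a c a' c' : R) : 0 <= c -> 0 <= c' -> 3 * c <= a -> 3 * c' <= a' ->
  (a + c) ^+ 3 * (a - 3 * c) = (a' + c') ^+ 3 * (a' - 3 * c') ->
  a * c ^+ 3 = a' * c' ^+ 3 -> a' <= a.
Proof.
move=> c0 c0' ca ca' e1 e2; rewrite leNgt; apply/negP => aa'.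
have a0 : 0 <= a by lra.
have cc' : c' <= c.
  apply: cube_inj_le => //.
  rewrite -(@ler_pM2l _ a') ?(le_lt_trans a0) // -e2.
  by rewrite ler_wpM2r ?exprn_ge0 // ltW.
have dec : (a + c) ^+ 3 * (a - 3 * c) <= (a + c') ^+ 3 * (a - 3 * c').
  have E x : (a + x) ^+ 3 * (a - 3 * x) =
      a ^+ 4 - 6 * (a ^+ 2 * x ^+ 2) - 8 * (a * x ^+ 3) - 3 * x ^+ 4 by ring.
  rewrite !E.
  have h2 : a ^+ 2 * c' ^+ 2 <= a ^+ 2 * c ^+ 2 by rewrite ler_wpM2l ?sqr_ge0 // ler_pXn2r.
  have h3 : a * c' ^+ 3 <= a * c ^+ 3 by rewrite ler_wpM2l // ler_pXn2r.
  have h4 : c' ^+ 4 <= c ^+ 4 by rewrite ler_pXn2r.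
  lra.
have : (a + c') ^+ 3 * (a - 3 * c') < (a' + c') ^+ 3 * (a' - 3 * c').
  have h1 : (a + c') ^+ 3 <= (a' + c') ^+ 3 by rewrite ler_pXn2r ?nnegrE //; lra.
  have h2 : 0 < (a' + c') ^+ 3 by rewrite exprn_gt0 //; lra.
  apply: (@le_lt_trans _ _ ((a' + c') ^+ 3 * (a - 3 * c'))).
    by rewrite ler_wpM2r //; lra.
  by rewrite ltr_pM2l //; lra.
by rewrite -e1 ltNge dec.
Qed.

(** The two polynomials are the gaps between consecutive eigenvalues of half the Gram matrix at
    [sect x y (- x - y)]. The substitution [a = x + y / 2], [c = y / 2] turns the second into
    [16 a c ^ 3]. *)
Lemma chamber_inj (x y x' y' : R) : 0 <= y <= x -> 0 <= y' <= x' ->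
  (x + y) ^+ 3 * (x - y) = (x' + y') ^+ 3 * (x' - y') ->
  y ^+ 3 * (2 * x + y) = y' ^+ 3 * (2 * x' + y') ->
  x = x' /\ y = y'.
Proof.
move=> /andP[y0 xy] /andP[y0' xy'] e1 e2.
pose a := x + y / 2; pose c := y / 2; pose a' := x' + y' / 2; pose c' := y' / 2.
have f1 : (a + c) ^+ 3 * (a - 3 * c) = (a' + c') ^+ 3 * (a' - 3 * c').
  rewrite (_ : a + c = x + y); last by rewrite /a /c; field.
  rewrite (_ : a' + c' = x' + y'); last by rewrite /a' /c'; field.
  rewrite (_ : a - 3 * c = x - y); last by rewrite /a /c; field.
  by rewrite (_ : a' - 3 * c' = x' - y') //; rewrite /a' /c'; field.
have f2 : a * c ^+ 3 = a' * c' ^+ 3.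
  have -> : a * c ^+ 3 = (y ^+ 3 * (2 * x + y)) / 16 by rewrite /a /c; field.
  by rewrite e2 /a' /c'; field.
have aa' : a = a'.
  by apply/eqP; rewrite eq_le; apply/andP; split;
    [apply: (@chamber_le a' c' a c) | apply: (@chamber_le a c a' c')];
    rewrite // /a /c /a' /c'; lra.
have [a0|a0] := eqVneq a 0.
  by move: aa' a0; rewrite /a /a' => aa' a0; split; lra.
have cc' : c = c'.
  have c3 : c ^+ 3 = c' ^+ 3 by apply: (mulfI a0); rewrite f2 aa'.
  by apply/eqP; rewrite eq_le; apply/andP; split; apply: cube_inj_le;
    rewrite ?c3 // /c /c'; lra.
by move: aa' cc'; rewrite /a /a' /c /c' => aa' cc'; split; lra.
Qed.

(** With [x = r (1 - t)] and [y = 2 r t] the chamber is [0 <= t <= 1 / 3], and the gaps, of degree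
    4, add up to [r ^ 4 (1 - t) ^ 3 (1 + 3 t)]. Their ratio determines [t], their size [r]. *)
Lemma chamber_surj (al be : R) : 0 <= al -> 0 <= be ->
  exists x y : R, [/\ 0 <= y <= x, (x + y) ^+ 3 * (x - y) = al &
    y ^+ 3 * (2 * x + y) = be].
Proof.
move=> al0 be0; pose ga := al + be.
have [g0|g0] := eqVneq ga 0.
  have [-> ->] : al = 0 /\ be = 0 by move: g0; rewrite /ga; split; lra.
  by exists 0, 0; split; [rewrite lexx | ring | ring].
have ga0 : 0 < ga by rewrite lt_def g0 /ga; lra.
(* At a root, [be / ga] is [16 t ^ 3 / ((1 - t) ^ 3 (1 + 3 t))], as required; the values at 0 and
   1/3 are [- be] and a positive multiple of [al]. *)
pose P : {poly R} := (16 * ga) *: 'X^3 - be *: ((1 - 'X) ^+ 3 * (1 + 3 *: 'X)).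
have PE t : P.[t] = 16 * ga * t ^+ 3 - be * ((1 - t) ^+ 3 * (1 + 3 * t)).
  by rewrite /P !hornerE.
have [||t /andP[t0 t1] /rootP] := @poly_ivt R P 0 (1 / 3).
- by lra.
- rewrite !PE; apply/andP; split; first by rewrite expr0n /=; lra.
  have -> : 16 * ga * (1 / 3) ^+ 3 - be * ((1 - 1 / 3) ^+ 3 * (1 + 3 * (1 / 3))) =
    16 / 27 * al by rewrite /ga; field.
  by rewrite mulr_ge0.
rewrite PE => /eqP; rewrite subr_eq0 => /eqP tE.
pose K := (1 - t) ^+ 3 * (1 + 3 * t).
have K0 : 0 < K by rewrite /K mulr_gt0 ?exprn_gt0 //; lra.
pose r := Num.sqrt (Num.sqrt (ga / K)).
have r0 : 0 <= r by exact: sqrtr_ge0.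
have r4 : r ^+ 4 * K = ga.
  have -> : r ^+ 4 = (r ^+ 2) ^+ 2 by ring.
  rewrite sqr_sqrtr ?sqrtr_ge0 // sqr_sqrtr ?divr_ge0 ?ltW //.
  by rewrite divfK // gt_eqF.
have be_eq : (2 * (r * t)) ^+ 3 * (2 * (r * (1 - t)) + 2 * (r * t)) = be.
  have -> : (2 * (r * t)) ^+ 3 * (2 * (r * (1 - t)) + 2 * (r * t)) =
    r ^+ 4 * (16 * t ^+ 3) by ring.
  apply: (mulIf (lt0r_neq0 K0)); rewrite mulrAC r4 -tE; ring.
exists (r * (1 - t)), (2 * (r * t)); split => //.
  by apply/andP; split; [rewrite !mulr_ge0 | rewrite mulrCA ler_wpM2l //; lra].
have <- : ga - be = al by rewrite /ga addrK.
by rewrite -be_eq -r4 /K; ring.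
Qed.

End Chamber.

(** * The map to R^5 and its surjectivity *)

Section Invariants.
Variable R : realType.
Implicit Types (k q r : quat R) (p : 'M[R]_(3, 4)).

Let i0 : 'I_3 := @Ordinal 3 0 isT.
Let i1 : 'I_3 := @Ordinal 3 1 isT.
Let i2 : 'I_3 := @Ordinal 3 2 isT.

(** Linear coordinates on symmetric matrices modulo scalar matrices, a quotient that stands for the
    traceless part. *)
Definition invariants p : 'cV[R]_5 := \col_j nth 0
  [:: gram p i0 i0 - gram p i2 i2; gram p i1 i1 - gram p i2 i2;
      gram p i0 i1; gram p i0 i2; gram p i1 i2] j.

Lemma invariants_qact k p : qnorm k = 1 -> invariants (qact k p) = invariants p.
Proof. by move=> k1; rewrite /invariants gram_qact. Qed.

Lemma gram_sym p : (gram p)^T = gram p.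
Proof.
by apply/matrixP => b c; rewrite !mxE -mxtrace_tr trmx_mul trmxK.
Qed.

Lemma continuous_gram : continuous (@gram R).
Proof.
apply: continuous_mx_entries => b c; under eq_fun do rewrite mxE.
have h d : continuous (fun p => p *m qright (qaxis R d) *m p^T).
  apply: continuous_fun_mulmx; last by apply: continuous_fun_trmx => p; exact: cvg_id.
  apply: continuous_fun_mulmx; last exact: continuous_mx_cst.
  by move=> p; exact: cvg_id.
apply: continuous_fun_trace; apply: continuous_fun_mulmx => //.
exact: continuous_fun_trmx.
Qed.

Lemma continuous_invariants : continuous invariants.
Proof.
apply: continuous_mx_entries => i j; under eq_fun do rewrite mxE.
have h a b : continuous (fun p => gram p a b).
  by apply: continuous_fun_entry; exact: continuous_gram.
by ord_cases i => /=; try exact: h; apply: continuous_fun_sub; exact: h.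
Qed.

Lemma invariants_gram p (Y : 'M[R]_3) (l : R) :
  gram p = Y + l%:M ->
  invariants p = \col_j nth 0
    [:: Y i0 i0 - Y i2 i2; Y i1 i1 - Y i2 i2; Y i0 i1; Y i0 i2; Y i1 i2] j.
Proof.
move=> e; have E a b : gram p a b = Y a b + l *+ (a == b).
  by rewrite e mxE [l%:M _ _]mxE.
apply/matrixP => i j; rewrite [LHS]mxE [RHS]mxE !E.
by ord_cases i; rewrite /= ?mulr1n ?mulr0n ?addr0 //; ring.
Qed.

Lemma invariants_eq p p' : invariants p = invariants p' ->
  exists l, gram p = gram p' + l%:M.
Proof.
move=> e; exists (gram p i2 i2 - gram p' i2 i2).
have E (j : 'I_5) := congr1 (fun v : 'cV[R]_5 => v j 0) e.
have EE (j : 'I_5) (r : 'M[R]_(3, 4)) : invariants r j 0 = nth 0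
  [:: gram r i0 i0 - gram r i2 i2; gram r i1 i1 - gram r i2 i2;
      gram r i0 i1; gram r i0 i2; gram r i1 i2] j by rewrite mxE.
have := E (@Ordinal 5 0 isT); have := E (@Ordinal 5 1 isT).
have := E (@Ordinal 5 2 isT); have := E (@Ordinal 5 3 isT).
have := E (@Ordinal 5 4 isT); rewrite !EE /= => e4 e3 e2 e1 e0.
move: e0 e1 e2 e3 e4; rewrite (sym3P (gram_sym p)) (sym3P (gram_sym p')).
move: (gram p) (gram p') => A B.
rewrite !mxE /= => e0 e1 e2 e3 e4.
by apply/matrixP => i j; rewrite !mxE; ord_cases i; ord_cases j;
  rewrite /= ?mulr1n ?mulr0n; lra.
Qed.

Lemma gram_chamber (x y : R) :
  exists l, gram (sect x y (- x - y)) =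
    2 *: diag3 (y ^+ 3 * (2 * x + y))
      ((x + y) ^+ 3 * (x - y) + y ^+ 3 * (2 * x + y)) 0 + l%:M.
Proof.
exists (2 * (x * y) ^+ 2); rewrite gram_sect; apply/matrixP => i j; rewrite !mxE.
by ord_cases i; ord_cases j; rewrite /= ?mulr1n ?mulr0n; ring.
Qed.

Theorem invariants_surj (v : 'cV[R]_5) :
  exists2 p, gamma p = 0 & invariants p = v.
Proof.
pose e j := v j 0.
(* The representative modulo scalars whose last diagonal entry is 0. *)
pose Y := sym3 (e (@Ordinal 5 0 isT)) (e (@Ordinal 5 1 isT)) 0
  (e (@Ordinal 5 2 isT)) (e (@Ordinal 5 3 isT)) (e (@Ordinal 5 4 isT)).
have [|q [d1 [d2 [d3 [nq /andP[d31 d12] YE]]]]] := @sym3_diagonalize R Y.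
  by apply/matrixP => i j; rewrite !mxE; ord_cases i; ord_cases j.
have [||x [y [xy al be]]] := @chamber_surj R ((d2 - d1) / 2) ((d1 - d3) / 2);
  try by rewrite divr_ge0 // subr_ge0.
exists (sect x y (- x - y) *m qright (qconj q)).
  by rewrite gamma_right gamma_sect ?mul0mx //; ring.
have [l gE] := gram_chamber x y.
rewrite al be in gE.
have gE' : gram (sect x y (- x - y)) = diag3 d1 d2 d3 + (l - d3)%:M.
  rewrite gE; apply/matrixP => i j; rewrite !mxE.
  by ord_cases i; ord_cases j; rewrite /= ?mulr1n ?mulr0n; field.
have gY : gram (sect x y (- x - y) *m qright (qconj q)) = Y + (l - d3)%:M.
  rewrite gram_right gE' qrot_conj trmxK mulmxDr mulmxDl -YE.
  by rewrite -mulmxA mul_scalar_mx -scalemxAr qrot_orthV // scalemx1.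
rewrite (invariants_gram gY); apply/matrixP => i j; rewrite mxE !mxE ord1.
by ord_cases i; rewrite /= ?subr0 /e; congr (v _ _); apply: val_inj.
Qed.

End Invariants.

(** * Trading right factors for left factors *)

Section Separation.
Variable R : realType.
Implicit Types (k q r : quat R) (p : 'M[R]_(3, 4)).

Let i0 : 'I_3 := @Ordinal 3 0 isT.
Let i1 : 'I_3 := @Ordinal 3 1 isT.
Let i2 : 'I_3 := @Ordinal 3 2 isT.

(** Trisection of the angle: [a + i b] is a cube root of [u + i v]. *)
Lemma unit_cube_root (u v : R) : u ^+ 2 + v ^+ 2 = 1 ->
  exists a b : R, [/\ a ^+ 2 + b ^+ 2 = 1, u = a ^+ 3 - 3 * a * b ^+ 2 &
    v = 3 * a ^+ 2 * b - b ^+ 3].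
Proof.
move=> uv.
have [t [tu tv]] : exists t, cos t = u /\ sin t = v.
  have u1 : -1 <= u <= 1.
    by rewrite -ler_norml -(@expr_le1 _ 2) // real_normK ?num_real //; have := sqr_ge0 v; lra.
  have cu : cos (acos u) = u by rewrite acosK // in_itv /= u1.
  have su : sin (acos u) ^+ 2 = v ^+ 2.
    by have := cos2Dsin2 (acos u); rewrite cu -uv => /addrI.
  have /orP[/eqP e|/eqP e] : (sin (acos u) == v) || (sin (acos u) == - v).
    by rewrite -eqf_sqr su.
    by exists (acos u).
  by exists (- acos u); rewrite cosN sinN e opprK.
exists (cos (t / 3)), (sin (t / 3)); split; first exact: cos2Dsin2.
- rewrite -tu; have -> : cos t = cos (t / 3 + (t / 3 + t / 3)) by congr cos; field.
  by rewrite !cosD !sinD; ring.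
- rewrite -tv; have -> : sin t = sin (t / 3 + (t / 3 + t / 3)) by congr sin; field.
  by rewrite !sinD !cosD; ring.
Qed.

Lemma diag3E (a b c : R) : diag3 a b c = diag_mx (\row_j nth 0 [:: a; b; c] j).
Proof. by apply/matrixP => i j; rewrite !mxE; ord_cases i; ord_cases j. Qed.

Lemma diag3_comm_entry (O : 'M[R]_3) (d1 d2 d3 e1 e2 e3 : R) :
  diag3 d1 d2 d3 *m O = O *m diag3 e1 e2 e3 ->
  forall i j : 'I_3, nth 0 [:: d1; d2; d3] i * O i j =
    O i j * nth 0 [:: e1; e2; e3] j.
Proof.
move=> e i j; have := congr1 (fun M : 'M[R]_3 => M i j) e.
by rewrite !diag3E mul_diag_mx mul_mx_diag !mxE.
Qed.

(** The hypothesis says that [qrot r] commutes with [diag3 x y z]; then [sect_conj] shows that [r]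
    on the left and its conjugate on the right fix the section point. *)
Lemma qrot_commute_sect r (x y z : R) :
  (forall i j : 'I_3, (nth 0 [:: x; y; z] i - nth 0 [:: x; y; z] j) * qrot r i j = 0) ->
  qnorm r = 1 -> sect x y z *m qright r = qact r (sect x y z).
Proof.
move=> h r1.
have c : qrot r *m diag3 x y z = diag3 x y z *m qrot r.
  rewrite diag3E mul_diag_mx mul_mx_diag; apply/matrixP => i j.
  rewrite [LHS]mxE [RHS]mxE ![(\row_j _) _ _]mxE [LHS]mulrC; apply/eqP.
  by rewrite eq_sym -subr_eq0 -mulrBl h.
have := @sect_conj R r x y z x y z.
rewrite c -mulmxA qrot_orthV // mulmx1 => /(_ erefl) e.
by rewrite -{1}e qrightVK.
Qed.

Lemma sect_wall_right (x u v : R) : u ^+ 2 + v ^+ 2 = 1 ->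
  exists2 n, qnorm n = 1 &
    sect x 0 (- x) *m qright (Quat u 0 v 0) = qact n (sect x 0 (- x)).
Proof.
(* The right factor is to be the conjugate of the cube of the left one,
   [u + v j = conj ((a + b j) ^ 3)], whence the sign of [v]. *)
move=> uv; have [|a [b [ab ua vb]]] := @unit_cube_root u (- v).
  by rewrite sqrrN.
exists (Quat a 0 b 0); first by rewrite /qnorm /= -ab; ring.
have {vb}-> : v = b ^+ 3 - 3 * a ^+ 2 * b by lra.
rewrite ua {u v uv ua} /qact.
have -> : qrot (Quat a 0 b 0) *m sect x 0 (- x) = mk_mx 3 4
  [:: [:: 0; (a ^+ 2 - b ^+ 2) * x; 0; - (2 * a * b * x)]; [:: 0; 0; 0; 0];
      [:: 0; - (2 * a * b * x); 0; - ((a ^+ 2 - b ^+ 2) * x)]].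
  by mx_ring.
by mx_ring.
Qed.

Lemma sect_axis_right (x y z : R) :
  sect x y z *m qright (Quat 0 1 0 0) = qact (Quat 0 1 0 0) (sect x y z).
Proof.
apply: qrot_commute_sect; last by rewrite /qnorm /=; ring.
by move=> i j; ord_cases i; ord_cases j; rewrite !mxE /=; ring.
Qed.

(* A right factor preserving the Gram matrix of a section point moves it within its orbit. On the wall y = 0 the two circles stabilizing sect x 0 (- x) are coupled with weights 1 and 3, hence the cube root; elsewhere left and right factors can be taken equal. *)
Lemma sect_right_qact r (x y : R) : qnorm r = 1 -> 0 <= y <= x ->
  (forall i j : 'I_3,
     let d := [:: y ^+ 3 * (2 * x + y);
                  (x + y) ^+ 3 * (x - y) + y ^+ 3 * (2 * x + y); 0] in
     nth 0 d i * qrot r i j = qrot r i j * nth 0 d j) ->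
  exists2 n, qnorm n = 1 &
    sect x y (- x - y) *m qright r = qact n (sect x y (- x - y)).
Proof.
move=> r1 /andP[y0 xy] h.
have [yE|yN0] := eqVneq y 0; last first.
  have y_gt0 : 0 < y by rewrite lt_def yN0.
  have be0 : y ^+ 3 * (2 * x + y) != 0.
    by rewrite gt_eqF // mulr_gt0 ?exprn_gt0 //; lra.
  have al0 : (x + y) ^+ 3 * (x - y) + y ^+ 3 * (2 * x + y) != 0.
    have : 0 <= (x + y) ^+ 3 * (x - y) by rewrite mulr_ge0 ?exprn_ge0 //; lra.
    have : 0 < y ^+ 3 * (2 * x + y) by rewrite mulr_gt0 ?exprn_gt0 //; lra.
    by move=> *; apply/eqP; lra.
  have xy3 : (x + y) ^+ 3 != 0 by rewrite gt_eqF // exprn_gt0 //; lra.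
  have xyE : (x + y) ^+ 3 * (x - y) = 0 -> x = y.
    by move/eqP; rewrite mulf_eq0 (negPf xy3) /= subr_eq0 => /eqP.
  move: h al0 be0 xyE; set be := y ^+ 3 * _; set al := (x + y) ^+ 3 * _.
  move=> h al0 be0 xyE.
  (* Off the wall, equal Gram eigenvalues come from equal section coordinates, so [qrot r] commutes
     with the section point as well. *)
  have key (i j : 'I_3) : nth 0 [:: be; al + be; 0] i = nth 0 [:: be; al + be; 0] j ->
      nth 0 [:: x; y; - x - y] i = nth 0 [:: x; y; - x - y] j.
    ord_cases i; ord_cases j => //= e; try (by rewrite xyE //; lra);
      by move/eqP: al0; move/eqP: be0; rewrite -?e ?e.
  exists r => //; apply: qrot_commute_sect => // i j.
  have [/key ->|dij] :=
    eqVneq (nth 0 [:: be; al + be; 0] i) (nth 0 [:: be; al + be; 0] j).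
    by rewrite subrr mul0r.
  suff -> : qrot r i j = 0 by rewrite mulr0.
  have := h i j; move: (qrot r i j) dij => o dij /= /eqP.
  rewrite [X in _ == X]mulrC -subr_eq0 -mulrBl mulf_eq0 subr_eq0 (negPf dij) /=.
  by move/eqP.
have [xE|xN0] := eqVneq x 0.
  exists (qone R); first exact: qnorm1.
  have -> : sect x y (- x - y) = 0.
    by rewrite xE yE; apply/matrixP => i j; rewrite !mxE; ord_cases i; ord_cases j => //=; ring.
  by rewrite qact1 mul0mx.
have x0 : 0 < x by rewrite lt_def xN0; lra.
have x4 : x ^+ 3 * x != 0 by rewrite mulf_neq0 ?expf_neq0.
(* On the wall the eigenvalues are 0, [x ^ 4], 0, so that [qrot r] is only known to preserve the
   second axis. *)
have o12 : qrot r i0 i1 = 0.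
  have := h i0 i1; move: (qrot r i0 i1) => o /= /eqP; rewrite yE !expr0n /= !mul0r subr0 !addr0.
  by rewrite eq_sym mulf_eq0 (negPf x4) orbF => /eqP.
have o21 : qrot r i1 i0 = 0.
  have := h i1 i0; move: (qrot r i1 i0) => o /= /eqP; rewrite yE !expr0n /= !mul0r mulr0 subr0 !addr0.
  by rewrite mulf_eq0 (negPf x4) => /eqP.
have o23 : qrot r i1 i2 = 0.
  have := h i1 i2; move: (qrot r i1 i2) => o /= /eqP; rewrite yE !expr0n /= !mul0r mulr0 subr0 !addr0.
  by rewrite mulf_eq0 (negPf x4) => /eqP.
have o32 : qrot r i2 i1 = 0.
  have := h i2 i1; move: (qrot r i2 i1) => o /= /eqP; rewrite yE !expr0n /= !mul0r subr0 !addr0.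
  by rewrite eq_sym mulf_eq0 (negPf x4) orbF => /eqP.
have zE : - x - y = - x by rewrite yE subr0.
rewrite yE subr0.
case: r r1 o12 o21 o23 o32 {h} => a b c d r1 o12 o21 o23 o32.
rewrite /qnorm /= in r1; rewrite !mxE /= in o12 o21 o23 o32.
have bc : b * c = 0 by lra.
have ad : a * d = 0 by lra.
have cd : c * d = 0 by lra.
have ab : a * b = 0 by lra.
(* Rotations preserving that axis come from two circles of quaternions: [a + c j], and
   [b i + d k = i (b + d j)]. *)
have [[bE dE]|[aE cE]] : (b = 0 /\ d = 0) \/ (a = 0 /\ c = 0).
  have [bE|bN] := eqVneq b 0; last first.
    right; split; apply/eqP; [move/eqP: ab | move/eqP: bc];
      by rewrite mulf_eq0 (negPf bN) ?orbF.
  have [dE|dN] := eqVneq d 0; first by left.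
  by right; split; apply/eqP; [move/eqP: ad | move/eqP: cd];
    rewrite mulf_eq0 (negPf dN) ?orbF.
- rewrite bE dE; apply: sect_wall_right; rewrite -r1 bE dE; ring.
have [|n n1 nE] := @sect_wall_right x b d; first by rewrite -r1 aE cE; ring.
exists (qmul (Quat 0 1 0 0) n); first by rewrite qnormM n1 /qnorm /=; ring.
have -> : Quat a b c d = qmul (Quat 0 1 0 0) (Quat b 0 d 0).
  by rewrite /qmul /= aE cE; congr Quat; ring.
by rewrite qrightM mulmxA sect_axis_right -qact_right nE qactM.
Qed.

Lemma orthogonal_sq_sums (O : 'M[R]_3) : O^T *m O = 1%:M ->
  (forall j, \sum_i O i j ^+ 2 = 1) /\ (forall i, \sum_j O i j ^+ 2 = 1).
Proof.
move=> o1; split => [j|i].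
  have := congr1 (fun M : 'M[R]_3 => M j j) o1; rewrite !mxE eqxx => e; apply: etrans e.
  by apply: eq_bigr => i _; rewrite mxE expr2.
have := congr1 (fun M : 'M[R]_3 => M i i) (mulmx1C o1); rewrite !mxE eqxx => e; apply: etrans e.
by apply: eq_bigr => j _; rewrite mxE expr2.
Qed.

(** The squares [O_ij ^ 2] are doubly stochastic and link only equal eigenvalues. Averaging over a
    row or a column compares the largest and the smallest eigenvalues both ways; the trace settles
    the middle one. *)
Lemma sorted_spectrum_eq (O : 'M[R]_3) (d1 d2 d3 e1 e2 e3 : R) :
  O^T *m O = 1%:M -> d3 <= d1 <= d2 -> e3 <= e1 <= e2 ->
  diag3 d1 d2 d3 *m O = O *m diag3 e1 e2 e3 -> [/\ d1 = e1, d2 = e2 & d3 = e3].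
Proof.
move=> o1 /andP[d31 d12] /andP[e31 e12] /diag3_comm_entry h.
have [col row] := orthogonal_sq_sums o1.
have [w wE] : exists w : 'I_3 -> 'I_3 -> R, forall i j, w i j = O i j ^+ 2.
  by exists (fun i j => O i j ^+ 2).
have w0 i j : 0 <= w i j by rewrite wE sqr_ge0.
have hw (i j : 'I_3) : nth 0 [:: d1; d2; d3] i * w i j = w i j * nth 0 [:: e1; e2; e3] j.
  by rewrite wE expr2 mulrA h -!mulrA (mulrC _ (O i j)).
have sum3 (f : 'I_3 -> R) : \sum_i f i = f i0 + f i1 + f i2.
  rewrite !big_ord_recl big_ord0 addr0 addrA.
  by congr (f _ + f _ + f _); apply: val_inj.
have c0 := col i0; have c1 := col i1; have c2 := col i2.
have r0 := row i0; have r1 := row i1; have r2 := row i2.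
rewrite !sum3 -!wE in c0 c1 c2 r0 r1 r2.
have hE := (hw i0 i0, hw i0 i1, hw i0 i2, hw i1 i0, hw i1 i1, hw i1 i2,
  hw i2 i0, hw i2 i1, hw i2 i2).
move: hE (w0 i0 i0) (w0 i0 i1) (w0 i0 i2) (w0 i1 i0) (w0 i1 i1) (w0 i1 i2)
  (w0 i2 i0) (w0 i2 i1) (w0 i2 i2) => /=.
move: (w i0 i0) (w i0 i1) (w i0 i2) (w i1 i0) (w i1 i1) (w i1 i2)
  (w i2 i0) (w i2 i1) (w i2 i2) c0 c1 c2 r0 r1 r2 {h hw w0 wE o1 col row sum3}.
move=> a b c d e f g k l c0 c1 c2 r0 r1 r2 [[[[[[[[h0 h1] h2] h3] h4] h5] h6] h7] h8].
move=> a0 b0 cc0 dd0 ee0 f0 g0 k0 l0.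
have D2 : d2 = e2.
  apply/eqP; rewrite eq_le; apply/andP; split.
    have -> : d2 = d2 * d + d2 * e + d2 * f by rewrite -!mulrDr r1 mulr1.
    have -> : e2 = d * e2 + e * e2 + f * e2 by rewrite -!mulrDl r1 mul1r.
    by rewrite h3 h4 h5 !lerD // ler_wpM2l //; lra.
  have -> : d2 = d2 * b + d2 * e + d2 * k by rewrite -!mulrDr c1 mulr1.
  have -> : e2 = b * e2 + e * e2 + k * e2 by rewrite -!mulrDl c1 mul1r.
  by rewrite -h1 -h4 -h7 !lerD // ler_wpM2r //; lra.
have D3 : d3 = e3.
  apply/eqP; rewrite eq_le; apply/andP; split.
    have -> : d3 = d3 * c + d3 * f + d3 * l by rewrite -!mulrDr c2 mulr1.
    have -> : e3 = c * e3 + f * e3 + l * e3 by rewrite -!mulrDl c2 mul1r.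
    by rewrite -h2 -h5 -h8 !lerD // ler_wpM2r //; lra.
  have -> : d3 = d3 * g + d3 * k + d3 * l by rewrite -!mulrDr r2 mulr1.
  have -> : e3 = g * e3 + k * e3 + l * e3 by rewrite -!mulrDl r2 mul1r.
  by rewrite h6 h7 h8 !lerD // ler_wpM2l //; lra.
split => //.
have t1 : d1 + d2 + d3 = d1 * (a + b + c) + d2 * (d + e + f) + d3 * (g + k + l).
  by rewrite r0 r1 r2 !mulr1.
have t2 : e1 + e2 + e3 = (a + d + g) * e1 + (b + e + k) * e2 + (c + f + l) * e3.
  by rewrite c0 c1 c2 !mul1r.
suff : d1 + d2 + d3 = e1 + e2 + e3 by lra.
rewrite t1 t2 !mulrDr !mulrDl h0 h1 h2 h3 h4 h5 h6 h7 h8; ring.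
Qed.

End Separation.

(** * Injectivity and properness of the invariants *)

Section Orbits.
Variable R : realType.
Implicit Types (k q r : quat R) (p : 'M[R]_(3, 4)).

Lemma conj_transfer (A B D E : 'M[R]_3) (l : R) :
  A *m A^T = 1%:M -> B *m B^T = 1%:M ->
  A^T *m D *m A = B^T *m E *m B + l%:M ->
  D *m (A *m B^T) = (A *m B^T) *m (E + l%:M).
Proof.
move=> a1 b1 e.
have -> : D *m (A *m B^T) = A *m (A^T *m D *m A) *m B^T.
  by rewrite !mulmxA a1 mul1mx.
rewrite e !mulmxDr mulmxDl -!mulmxA b1 mulmx1 !mulmxA; congr (_ + _).
by rewrite -!mulmxA scalar_mxC.
Qed.

Theorem invariants_inj p p' : gamma p = 0 -> gamma p' = 0 ->
  invariants p = invariants p' -> exists2 k, qnorm k = 1 & p' = qact k p.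
Proof.
move=> /section_normal_form [k [q [x [y [k1 q1 xy ->]]]]].
move=> /section_normal_form [k' [q' [x' [y' [k'1 q'1 xy' ->]]]]].
rewrite -!qact_right !invariants_qact // => /invariants_eq [l].
rewrite !gram_right.
have [m gE] := gram_chamber x y; have [m' gE'] := gram_chamber x' y'.
(* [r] compares the right factors of the two normal forms; once the chamber points agree, it fixes
   the Gram matrix and can be absorbed on the left. *)
pose r := qmul q (qconj q').
have r1 : qnorm r = 1 by rewrite qnormM qnorm_conj q1 q'1 mulr1.
have rE : qrot r = qrot q *m (qrot q')^T by rewrite qrotM qrot_conj.
have qE : q = qmul r q'.
  by rewrite /r /qmul /=; move: q'1; rewrite /qnorm; case: (q) (q') => [a b c d] [a' b' c' d'] /= n; congr Quat;
   rewrite -[LHS]mulr1 -n; ring.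
move=> /(conj_transfer (qrot_orthV q1) (qrot_orthV q'1)); rewrite -rE gE gE'.
set be := y ^+ 3 * _; set al := (x + y) ^+ 3 * _.
set be' := y' ^+ 3 * _; set al' := (x' + y') ^+ 3 * _ => e.
have shift (a b c : R) : 2 *: diag3 a b 0 + c%:M = diag3 (2 * a + c) (2 * b + c) c.
  by apply/matrixP => i j; rewrite !mxE; ord_cases i; ord_cases j; rewrite /= ?mulr1n ?mulr0n; ring.
rewrite -addrA -raddfD /= !shift in e.
have [y0 yx] := andP xy; have [y0' yx'] := andP xy'.
have al0 : 0 <= al by rewrite mulr_ge0 ?exprn_ge0 //; lra.
have be0 : 0 <= be by rewrite mulr_ge0 ?exprn_ge0 //; lra.
have al0' : 0 <= al' by rewrite mulr_ge0 ?exprn_ge0 //; lra.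
have be0' : 0 <= be' by rewrite mulr_ge0 ?exprn_ge0 //; lra.
have [| | e1 e2 e3] := sorted_spectrum_eq (qrot_orth r1) _ _ e.
- by apply/andP; split; lra.
- by apply/andP; split; lra.
have [ex ey] : x = x' /\ y = y'.
  by apply: chamber_inj => //; [rewrite -/al -/al' | rewrite -/be -/be']; lra.
have [|n n1 nE] := @sect_right_qact R r x y r1 xy.
  move=> i j /=; have := diag3_comm_entry e i j.
  rewrite -e1 -e2 -e3 -/al -/be; move: (qrot r i j) => o.
  have -> : nth 0 [:: 2 * be + m; 2 * (al + be) + m; m] i =
      2 * nth 0 [:: be; al + be; 0] i + m by ord_cases i => /=; ring.
  have -> : nth 0 [:: 2 * be + m; 2 * (al + be) + m; m] j =
      2 * nth 0 [:: be; al + be; 0] j + m by ord_cases j => /=; ring.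
  by move: (nth _ _ i) (nth _ _ j) => u v; lra.
(* With [s] the common section point, [p = k n s q'] and [p' = k' s q']. *)
exists (qmul (qmul k' (qconj n)) (qconj k)).
  by rewrite !qnormM !qnorm_conj k1 k'1 n1 !mulr1.
by rewrite -ex -ey -!qactM qactK // qE qrightM mulmxA nE -[qact n _ *m _]qact_right qactK //.
Qed.

Lemma qrot_norm_le k : qnorm k = 1 -> `|qrot k| <= 1.
Proof.
move=> k1; apply: mx_norm_le => // i j.
have [_ row] := orthogonal_sq_sums (qrot_orth k1).
rewrite -(@expr_le1 _ 2) // real_normK ?num_real // -(row i) (bigD1 j) //= lerDl.
by apply: sumr_ge0 => a _; exact: sqr_ge0.
Qed.

Lemma qleft_norm_le k : qnorm k = 1 -> `|qleft k| <= 1.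
Proof.
move=> /qnorm_entry_le [h0 h1 h2 h3]; apply: mx_norm_le => // i j; rewrite mxE.
by ord_cases i; ord_cases j; rewrite /= ?normrN.
Qed.

Lemma qright_norm_le k : qnorm k = 1 -> `|qright k| <= 1.
Proof.
move=> /qnorm_entry_le [h0 h1 h2 h3]; apply: mx_norm_le => // i j; rewrite mxE.
by ord_cases i; ord_cases j; rewrite /= ?normrN.
Qed.

Lemma norm_qact_le k p : qnorm k = 1 -> `|qact k p| <= 12 * `|p|.
Proof.
move=> k1; apply: le_trans (norm_mulmx_le _ _) _.
have h1 : `|qrot k *m p| <= 3 * `|p|.
  apply: le_trans (norm_mulmx_le _ _) _; rewrite ler_wpM2l //.
  by rewrite -[leRHS]mul1r ler_wpM2r // qrot_norm_le.
have -> : 12 * `|p| = 4 * (3 * `|p| * 1) by ring.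
by rewrite ler_wpM2l // ler_pM // qleft_norm_le.
Qed.

(** Half the spread of the Gram eigenvalues is [al + be = x ^ 4 + 2 x ^ 3 y]; the invariants bound
    it, and [x] bounds the section point. The 9 pays for two products with rotations, and 96 is
    [12 * 4 * 2] for the left factor, the right factor and the section. *)
Theorem invariants_proper (c : R) : exists c' : R, forall p,
  gamma p = 0 -> `|invariants p| <= c -> `|p| <= c'.
Proof.
exists (96 * (1 + 9 * `|c|)) => p /section_normal_form [k [q [x [y [k1 q1 xy ->]]]]].
rewrite -qact_right invariants_qact // => ic.
have [y0 yx] := andP xy.
have [m gE] := gram_chamber x y.
have gr := gram_right q (sect x y (- x - y)); rewrite gE in gr.
set be := y ^+ 3 * _ in gr; set al := (x + y) ^+ 3 * _ in gr.
have x4 : x ^+ 4 <= al + be.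
  have -> : al + be = x ^+ 4 + 2 * (x ^+ 3 * y) by rewrite /al /be; ring.
  by rewrite lerDl mulr_ge0 // mulr_ge0 // exprn_ge0 //; lra.
set g := gram _ in gr.
pose i0 : 'I_3 := @Ordinal 3 0 isT.
pose i1 : 'I_3 := @Ordinal 3 1 isT.
pose i2 : 'I_3 := @Ordinal 3 2 isT.
pose Y := g - (g i2 i2)%:M.
have Yc : `|Y| <= `|c|.
  have ge (v : R) : `|v| <= `|invariants (sect x y (- x - y) *m qright q)| -> `|v| <= `|c|.
    by move=> h; apply: le_trans h (le_trans ic (ler_norm _)).
  have inv (j : 'I_5) := ge _ (mx_entry_le_norm
    (invariants (sect x y (- x - y) *m qright q)) j 0).
  have E (j : 'I_5) : invariants (sect x y (- x - y) *m qright q) j 0 = nth 0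
    [:: g i0 i0 - g i2 i2; g i1 i1 - g i2 i2; g i0 i1; g i0 i2; g i1 i2] j.
    by rewrite mxE.
  have gs : g^T = g by exact: gram_sym.
  have := inv (@Ordinal 5 0 isT); have := inv (@Ordinal 5 1 isT).
  have := inv (@Ordinal 5 2 isT); have := inv (@Ordinal 5 3 isT).
  have := inv (@Ordinal 5 4 isT); rewrite !E /= /Y (sym3P gs) {gr inv E Y gs}.
  move: g => g; rewrite !mxE /= => h4 h3 h2 h1 h0; apply: mx_norm_le => // i j; rewrite !mxE.
  by ord_cases i; ord_cases j; rewrite /= ?mulr1n ?mulr0n ?subr0 ?subrr ?normr0.
have YE : qrot q *m Y *m (qrot q)^T = 2 *: diag3 be (al + be) 0 + (m - g i2 i2)%:M.
  rewrite /Y mulmxBr mulmxBl scalar_mxC -[X in _ - X]mulmxA qrot_orthV // mulmx1.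
  rewrite gr !mulmxA qrot_orthV // mul1mx -mulmxA qrot_orthV // mulmx1.
  by rewrite raddfB addrA.
have Yn : `|qrot q *m Y *m (qrot q)^T| <= 9 * `|c|.
  apply: le_trans (norm_mulmx_le _ _) _.
  have -> : 9 * `|c| = 3 * ((3 * (1 * `|c|)) * 1) by ring.
  rewrite ler_wpM2l // ler_pM // ?norm_trmx ?qrot_norm_le //.
  apply: le_trans (norm_mulmx_le _ _) _.
  by rewrite ler_wpM2l // ler_pM // qrot_norm_le.
have sum_le : al + be <= 9 * `|c|.
  have h1 := le_trans (mx_entry_le_norm _ i1 i1) Yn.
  have h2 := le_trans (mx_entry_le_norm _ i2 i2) Yn.
  move: h1 h2; rewrite YE !mxE /= ?mulr1n !ler_norml => /andP[_ h1] /andP[h2 _]; lra.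
have x_le : x <= 1 + 9 * `|c|.
  have [x1|x1] := leP x 1; first by have := normr_ge0 c; lra.
  have : x <= x ^+ 4 by rewrite -{1}[x]expr1 ler_eXn2l.
  by lra.
have sn : `|sect x y (- x - y)| <= 2 * x.
  apply: mx_norm_le => [|i j]; first by lra.
  by rewrite mxE; ord_cases i; ord_cases j; rewrite /= ler_norml; apply/andP; split; lra.
apply: le_trans (norm_qact_le _ k1) _.
have -> : 96 * (1 + 9 * `|c|) = 12 * (4 * (2 * (1 + 9 * `|c|) * 1)) by ring.
rewrite ler_wpM2l //; apply: le_trans (norm_mulmx_le _ _) _.
rewrite ler_wpM2l // ler_pM // ?qright_norm_le //.
by apply: le_trans sn _; rewrite ler_wpM2l.
Qed.

End Orbits.

(** * Weight strings of su(2) *)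

Section Ladder.
Variables (K : numClosedFieldType) (n : nat) (E F H : 'M[K]_n).
Hypothesis EH : E *m H = H *m E + E.
Hypothesis FH : F *m H = H *m F - F.
Hypothesis FE : F *m E = E *m F + 2 *: H.
Implicit Types (u v : 'rV[K]_n) (mu : K).

Definition lup k v := iter k (mulmxr E) v.
Definition ldown k v := iter k (mulmxr F) v.

Lemma lup_weight k v mu : v *m H = mu *: v ->
  lup k v *m H = (mu + k%:R) *: lup k v.
Proof.
move=> vH; elim: k => [|k IH]; first by rewrite addr0.
rewrite /= -mulmxA EH mulmxDr mulmxA IH -scalemxAl -[X in _ + X]scale1r -scalerDl.
by rewrite -addrA natr1.
Qed.

Lemma ldown_weight k v mu : v *m H = mu *: v ->
  ldown k v *m H = (mu - k%:R) *: ldown k v.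
Proof.
move=> vH; elim: k => [|k IH]; first by rewrite subr0.
rewrite /= -mulmxA FH mulmxBr mulmxA IH -scalemxAl -[X in _ - X]scale1r -scalerBl.
by rewrite -addrA -opprD natr1.
Qed.

(** Moving [E] past each [F] adds twice the current weight, and
    [2 mu + 2 (mu - 1) + ... + 2 (mu - k)] is the coefficient. *)
Lemma ldown_raise u mu k : u *m H = mu *: u -> u *m E = 0 ->
  ldown k.+1 u *m E = (k.+1%:R * (2 * mu - k%:R)) *: ldown k u.
Proof.
move=> uH uE; elim: k => [|k IH].
  by rewrite /= -mulmxA FE mulmxDr mulmxA uE mul0mx add0r -scalemxAr uH scalerA subr0 mul1r.
rewrite [LHS]/= -mulmxA FE mulmxDr mulmxA -[iter k _ u *m F]/(ldown k.+1 u) IH.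
rewrite -scalemxAr (ldown_weight _ uH) -scalemxAl -[ldown k u *m F]/(ldown k.+1 u).
by rewrite scalerA -scalerDl; congr (_ *: _); rewrite -!natr1; ring.
Qed.

(** Eigenspaces of distinct eigenvalues are independent. With [r = 1] this bounds the length of a
    string, with [r = 2] it counts a doubled one. *)
Lemma eigenspaces_rank_le (D r : nat) mu :
  (forall k, (k < D)%N -> (r <= \rank (eigenspace H (mu - k%:R)))%N) ->
  (D * r <= n)%N.
Proof.
move=> h; pose a (k : 'I_D) := mu - (val k)%:R.
have inj_a : {in xpredT &, injective a}.
  by move=> i j _ _ /addrI /oppr_inj /eqP; rewrite eqr_nat => /eqP /val_inj.
have /mxdirectP /= := @mxdirect_sum_eigenspace K 'I_D n H xpredT a inj_a.
move=> e; apply: leq_trans (rank_leq_col (\sum_i eigenspace H (a i))%MS); rewrite e.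
have -> : (D * r = \sum_(i < D) r)%N by rewrite sum_nat_const card_ord.
by apply: leq_sum => i _; exact: (h _ (ltn_ord i)).
Qed.

Lemma eigenspace_rank_ge1 v mu : v != 0 -> v *m H = mu *: v ->
  (1 <= \rank (eigenspace H mu))%N.
Proof.
move=> v0 /eigenspaceP vH; apply: leq_trans (mxrankS vH).
by rewrite rank_rV v0.
Qed.

Lemma exists_highest_weight : (0 < n)%N ->
  exists u mu, [/\ u != 0, u *m H = mu *: u & u *m E = 0].
Proof.
move=> n0.
have /closed_rootP [mu] : size (char_poly H) != 1%N.
  by rewrite size_char_poly eqSS -lt0n.
rewrite -eigenvalue_root_char => /eigenvalueP [v vH v0].
have [k uk0] : exists k, lup k v == 0.
  apply: contrapT => no.
  have nz k : lup k v != 0 by apply/negP => uk; apply: no; exists k.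
  suff : (n.+1 * 1 <= n)%N by rewrite muln1 ltnn.
  apply: (@eigenspaces_rank_le _ _ (mu + n%:R)) => k kn.
  apply: (eigenspace_rank_ge1 (nz (n - k)%N)).
  by rewrite (lup_weight _ vH) natrB // addrA.
have kP : exists k, lup k v == 0 by exists k.
case: (ex_minnP kP) => -[|m] /eqP um min; first by case/negP: v0; apply/eqP.
exists (lup m v), (mu + m%:R); split; last exact: um.
  by apply/negP => /min; rewrite ltnn.
exact: lup_weight.
Qed.

(** At the first [D] with [F ^ D u = 0], raising once gives [D (2 mu - (D - 1)) = 0]. *)
Lemma highest_weight_length u mu : (0 < n)%N -> u != 0 ->
  u *m H = mu *: u -> u *m E = 0 ->
  exists D, [/\ (0 < D)%N, ldown D u = 0, (forall k, (k < D)%N -> ldown k u != 0) &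
    2 * mu = D%:R - 1].
Proof.
move=> n0 u0 uH uE.
have kP : exists k, ldown k u == 0.
  apply: contrapT => no.
  have nz k : ldown k u != 0 by apply/negP => uk; apply: no; exists k.
  suff : (n.+1 * 1 <= n)%N by rewrite muln1 ltnn.
  apply: (@eigenspaces_rank_le _ _ mu) => k kn.
  by apply: (eigenspace_rank_ge1 (nz k)); exact: ldown_weight.
case: (ex_minnP kP) => -[|m] /eqP um min; first by case/negP: u0; apply/eqP.
exists m.+1; split => //.
  by move=> k km; apply/negP => /min; rewrite leqNgt km.
have := ldown_raise m uH uE; rewrite um mul0mx => /esym/eqP.
rewrite scaler_eq0 => /orP[|/min]; last by rewrite ltnn.
rewrite mulf_eq0 pnatr_eq0 /= subr_eq0 => /eqP ->.
by rewrite -natr1 addrK.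
Qed.

(** The factors [k (D - k)] are positive along the string. Their sign, and not only their
    nonvanishing, decides the parity of [D] for a self-conjugate string. *)
Lemma lup_ldown u mu D k : u *m H = mu *: u -> u *m E = 0 -> 2 * mu = D%:R - 1 ->
  (k < D)%N -> exists2 c : K, 0 < c & lup k (ldown k u) = c *: u.
Proof.
move=> uH uE muD; elim: k => [|k IH] kD; first by exists 1; rewrite ?ltr01 ?scale1r.
have [c c0 cE] := IH (ltnW kD).
exists (k.+1%:R * (D%:R - 1 - k%:R) * c).
  by rewrite !mulr_gt0 ?ltr0n // -addrA -opprD nat1r subr_gt0 ltr_nat.
rewrite /lup iterSr /= -[iter k _ u *m F]/(ldown k.+1 u) (ldown_raise k uH uE) muD.
have upZ (a : K) w : iter k (mulmxr E) (a *: w) = a *: lup k w.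
  by elim: (k) => //= m ->; rewrite -scalemxAl.
by rewrite upZ cE scalerA.
Qed.

End Ladder.

(** * Real weight strings through complexification *)

Section RealForm.
Local Open Scope complex_scope.
Variable R : realType.
Local Notation C := (R[i]).

Definition cmx m n (A : 'M[R]_(m, n)) : 'M[C]_(m, n) := map_mx (real_complex R) A.
Definition remx m n (A : 'M[C]_(m, n)) : 'M[R]_(m, n) := map_mx (@complex.Re R) A.
Definition immx m n (A : 'M[C]_(m, n)) : 'M[R]_(m, n) := map_mx (@complex.Im R) A.
Definition conjmx m n (A : 'M[C]_(m, n)) : 'M[C]_(m, n) := map_mx (@conjc R) A.

Lemma ReD (a b : C) : complex.Re (a + b) = complex.Re a + complex.Re b.
Proof. by case: a b => a b [c d]. Qed.
Lemma ImD (a b : C) : complex.Im (a + b) = complex.Im a + complex.Im b.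
Proof. by case: a b => a b [c d]. Qed.
Lemma ReZ (a : R) (b : C) : complex.Re (a%:C * b) = a * complex.Re b.
Proof. by case: b => b d /=; rewrite mul0r subr0. Qed.
Lemma ImZ (a : R) (b : C) : complex.Im (a%:C * b) = a * complex.Im b.
Proof. by case: b => b d /=; rewrite mul0r addr0. Qed.
Lemma Rei (b : C) : complex.Re ('i * b) = - complex.Im b.
Proof. by case: b => b d /=; rewrite mul0r mul1r sub0r. Qed.
Lemma Imi (b : C) : complex.Im ('i * b) = complex.Re b.
Proof. by case: b => b d /=; rewrite mul0r mul1r add0r. Qed.

Lemma remxD m n (A B : 'M[C]_(m, n)) : remx (A + B) = remx A + remx B.
Proof. by apply/matrixP => i j; rewrite !mxE ReD. Qed.
Lemma immxD m n (A B : 'M[C]_(m, n)) : immx (A + B) = immx A + immx B.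
Proof. by apply/matrixP => i j; rewrite !mxE ImD. Qed.
Lemma remxZ m n (a : R) (A : 'M[C]_(m, n)) : remx (a%:C *: A) = a *: remx A.
Proof. by apply/matrixP => i j; rewrite !mxE ReZ. Qed.
Lemma immxZ m n (a : R) (A : 'M[C]_(m, n)) : immx (a%:C *: A) = a *: immx A.
Proof. by apply/matrixP => i j; rewrite !mxE ImZ. Qed.
Lemma remxi m n (A : 'M[C]_(m, n)) : remx ('i *: A) = - immx A.
Proof. by apply/matrixP => i j; rewrite !mxE Rei. Qed.
Lemma immxi m n (A : 'M[C]_(m, n)) : immx ('i *: A) = remx A.
Proof. by apply/matrixP => i j; rewrite !mxE Imi. Qed.
Lemma remx0 m n : remx (0 : 'M[C]_(m, n)) = 0.
Proof. by apply/matrixP => i j; rewrite !mxE. Qed.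
Lemma immx0 m n : immx (0 : 'M[C]_(m, n)) = 0.
Proof. by apply/matrixP => i j; rewrite !mxE. Qed.

Lemma remx_mul m n p (A : 'M[C]_(m, n)) (b : 'M[R]_(n, p)) :
  remx (A *m cmx b) = remx A *m b.
Proof.
apply/matrixP => i j; rewrite !mxE (big_morph _ ReD (erefl _)).
by apply: eq_bigr => k _; rewrite !mxE mulrC ReZ mulrC.
Qed.
Lemma immx_mul m n p (A : 'M[C]_(m, n)) (b : 'M[R]_(n, p)) :
  immx (A *m cmx b) = immx A *m b.
Proof.
apply/matrixP => i j; rewrite !mxE (big_morph _ ImD (erefl _)).
by apply: eq_bigr => k _; rewrite !mxE mulrC ImZ mulrC.
Qed.

Lemma cmx_reim m n (A : 'M[C]_(m, n)) : A = cmx (remx A) + 'i *: cmx (immx A).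
Proof. by apply/matrixP => i j; rewrite !mxE -complexE. Qed.

Lemma cmx_re m n (A : 'M[C]_(m, n)) : cmx (remx A) = 2^-1 *: (A + conjmx A).
Proof. by apply/matrixP => i j; rewrite !mxE mulrC; exact: ReJ_add. Qed.

Lemma conjmxK m n (A : 'M[C]_(m, n)) : conjmx (conjmx A) = A.
Proof. by apply/matrixP => i j; rewrite !mxE conjcK. Qed.

Lemma conjmxZ m n (a : C) (A : 'M[C]_(m, n)) : conjmx (a *: A) = (a^*)%C *: conjmx A.
Proof. by apply/matrixP => i j; rewrite !mxE rmorphM. Qed.

Lemma conjmx_mul m n p (A : 'M[C]_(m, n)) (B : 'M[C]_(n, p)) :
  conjmx (A *m B) = conjmx A *m conjmx B.
Proof. exact: map_mxM. Qed.

Lemma conjmx_real m n (A : 'M[R]_(m, n)) : conjmx (cmx A) = cmx A.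
Proof. by apply/matrixP => i j; rewrite !mxE; exact: conjc_real. Qed.

Lemma conjmx0 m n : conjmx (0 : 'M[C]_(m, n)) = 0.
Proof. exact: map_mx0. Qed.

Section Irreducible.
Local Open Scope complex_scope.
Variables (n : nat) (b1 b2 b3 : 'M[R]_n).
Hypothesis n_gt0 : (0 < n)%N.
Hypothesis n_even : ~~ odd n.
(* Row vectors: the matrices b_i are the transposes of those of the representation, which reverses the products in the bracket relations. *)
Hypothesis r12 : b2 *m b1 = b1 *m b2 + b3.
Hypothesis r23 : b3 *m b2 = b2 *m b3 + b1.
Hypothesis r31 : b1 *m b3 = b3 *m b1 + b2.
Hypothesis irr : forall m (X : 'M[R]_(m, n)), X != 0 ->
  (X *m b1 <= X)%MS -> (X *m b2 <= X)%MS -> (X *m b3 <= X)%MS -> row_full X.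

(** Conjugation sends [E], [F], [H] to [- F], [- E], [- H]: the conjugate of a string is a string
    that runs the other way. *)
Let E : 'M[C]_n := 'i *: cmx b1 - cmx b2.
Let F : 'M[C]_n := 'i *: cmx b1 + cmx b2.
Let H : 'M[C]_n := 'i *: cmx b3.

Let c12 : cmx b2 *m cmx b1 = cmx b1 *m cmx b2 + cmx b3.
Proof. by rewrite /cmx -!map_mxM r12 map_mxD map_mxM. Qed.
Let c23 : cmx b3 *m cmx b2 = cmx b2 *m cmx b3 + cmx b1.
Proof. by rewrite /cmx -!map_mxM r23 map_mxD map_mxM. Qed.
Let c31 : cmx b1 *m cmx b3 = cmx b3 *m cmx b1 + cmx b2.
Proof. by rewrite /cmx -!map_mxM r31 map_mxD map_mxM. Qed.

Let ii : 'i * 'i = -1 :> C. Proof. by rewrite -expr2 sqr_i. Qed.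

Let EH : E *m H = H *m E + E.
Proof.
rewrite /E /H mulmxBl mulmxBr -!scalemxAl -!scalemxAr !scalerA ii c31 c23.
move: (cmx b3 *m cmx b1) (cmx b2 *m cmx b3) (cmx b1) (cmx b2) => P Q S T.
by apply/matrixP => i j; rewrite !mxE; ring.
Qed.

Let FH : F *m H = H *m F - F.
Proof.
rewrite /F /H mulmxDl mulmxDr -!scalemxAl -!scalemxAr !scalerA ii c31 c23.
move: (cmx b3 *m cmx b1) (cmx b2 *m cmx b3) (cmx b1) (cmx b2) => P Q S T.
by apply/matrixP => i j; rewrite !mxE; ring.
Qed.

Let FE : F *m E = E *m F + 2 *: H.
Proof.
rewrite /F /E /H !mulmxDl !mulmxDr !mulNmx !mulmxN -!scalemxAl -!scalemxAr !scalerA ii c12.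
move: (cmx b1 *m cmx b1) (cmx b1 *m cmx b2) (cmx b2 *m cmx b2) => P Q S.
by apply/matrixP => i j; rewrite !mxE; ring.
Qed.

Let conj_i : ('i%C : C)^* = - 'i%C.
Proof. by apply/eqP; rewrite eq_complex /= oppr0 !eqxx. Qed.

Let conjE : conjmx E = - F.
Proof.
rewrite /E [LHS]map_mxB -!/(conjmx _) conjmxZ conj_i !conjmx_real scaleNr.
by rewrite /F opprD.
Qed.

Let conjF : conjmx F = - E.
Proof. by rewrite -[E]conjmxK conjE [conjmx (- F)]map_mxN opprK. Qed.

Let conjH : conjmx H = - H.
Proof. by rewrite conjmxZ conj_i conjmx_real scaleNr. Qed.

Let conj_down k (u : 'rV[C]_n) :
  conjmx (ldown F k u) = (-1) ^+ k *: lup E k (conjmx u).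
Proof.
elim: k => [|k IH]; first by rewrite scale1r.
rewrite [LHS]conjmx_mul conjF IH mulmxN -scalemxAl exprS mulN1r scaleNr.
by [].
Qed.

Let rank2 (v w : 'rV[C]_n) (S : 'M[C]_n) : v != 0 -> (v <= S)%MS ->
  (w <= S)%MS -> ~~ (w <= v)%MS -> (2 <= \rank S)%N.
Proof.
move=> v0 vS wS wv; have : (v < S)%MS.
  by rewrite ltmxE vS; apply: contra wv => Sv; exact: submx_trans wS Sv.
by move/rank_ltmx; rewrite rank_rV v0.
Qed.

(** [F], [E], [- H] satisfy the same relations, so the ladder lemmas also apply to [conj u], a
    lowest weight vector. *)
Let swapped_EH : E *m (- H) = (- H) *m E - E.
Proof. by rewrite mulmxN EH mulNmx opprD. Qed.
Let swapped_EF : E *m F = F *m E + 2 *: (- H).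
Proof. by rewrite FE scalerN addrK. Qed.

(** Real and imaginary parts of the action on [F ^ k u]: [m] is the weight and [e] the coefficient
    of raising. At [k = 0] the term at [k.-1 = 0] is harmless because [e = 0]. *)
Definition real_ladder (x y : nat -> 'rV[R]_n) (D k : nat) : Prop :=
  let m : R := (D%:R - 1) / 2 - k%:R in
  let e : R := k%:R * (D%:R - k%:R) in
  [/\ [/\ x k *m b1 = 2^-1 *: (e *: y k.-1 + y k.+1),
          x k *m b2 = 2^-1 *: (x k.+1 - e *: x k.-1) &
          x k *m b3 = m *: y k],
      y k *m b1 = - (2^-1 *: (e *: x k.-1 + x k.+1)),
      y k *m b2 = 2^-1 *: (y k.+1 - e *: y k.-1) &
      y k *m b3 = - (m *: x k)].

(* The real and imaginary parts of the weight string of a highest weight vector u span, which gives n <= 2 D. If E^(D-1) maps conj u out of the line of u, each weight has multiplicity 2 and n = 2 D; otherwise the string is self-conjugate, hence n = D, and comparing conj (conj u) with u forces D to be odd. *)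
Theorem real_weight_string : exists (x y : nat -> 'rV[R]_n) D,
  [/\ n = D.*2, row_full (col_mx (\matrix_(k < D) x k) (\matrix_(k < D) y k)),
      x D = 0, y D = 0 & forall k, real_ladder x y D k].
Proof.
have [u [mu [u0 uH uE]]] := @exists_highest_weight _ _ E H EH n_gt0.
have [D [D0 uD unz muD]] := highest_weight_length FH FE n_gt0 u0 uH uE.
exists (fun k => remx (ldown F k u)), (fun k => immx (ldown F k u)), D.
have muE : mu = (D%:R - 1) / 2 by rewrite -muD mulrAC divff ?mul1r // pnatr_eq0.
have muC : mu = ((D%:R - 1) / 2 : R)%:C.
  by rewrite muE rmorphM fmorphV rmorphB !rmorph_nat.
have mu_real : (mu^*)%C = mu.
  by rewrite muC; exact: conjc_real.
have uH' : u *m H = ((D%:R - 1) / 2) *: u by rewrite -muE.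
pose S := col_mx (\matrix_(k < D) remx (ldown F k u)) (\matrix_(k < D) immx (ldown F k u)).
have Sre k : (k <= D)%N -> (remx (ldown F k u) <= S)%MS.
  rewrite leq_eqVlt => /orP[/eqP ->|kD]; first by rewrite uD remx0 sub0mx.
  apply: submx_trans (_ : \matrix_(k < D) remx (ldown F k u) <= S)%MS.
    have -> : remx (ldown F k u) = row (Ordinal kD) (\matrix_(k < D) remx (ldown F k u)).
      by rewrite rowK.
    exact: row_sub.
  by rewrite -addsmxE addsmxSl.
have Sim k : (k <= D)%N -> (immx (ldown F k u) <= S)%MS.
  rewrite leq_eqVlt => /orP[/eqP ->|kD]; first by rewrite uD immx0 sub0mx.
  apply: submx_trans (_ : \matrix_(k < D) immx (ldown F k u) <= S)%MS.
    have -> : immx (ldown F k u) = row (Ordinal kD) (\matrix_(k < D) immx (ldown F k u)).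
      by rewrite rowK.
    exact: row_sub.
  by rewrite -addsmxE addsmxSr.
pose e k : R := k%:R * (D%:R - k%:R).
have raise k : ldown F k u *m E = (e k)%:C *: ldown F k.-1 u.
  case: k => [|k]; first by rewrite uE /e mul0r scale0r.
  rewrite (ldown_raise FH FE k uH uE) muD; congr (_ *: _).
  by rewrite /e rmorphM rmorphB !rmorph_nat -[k.+1%:R]natr1; ring.
have half : (2^-1 : R)%:C = 2^-1 :> C by rewrite fmorphV rmorph_nat.
have b3E k : ldown F k u *m cmx b3 = - ('i *: (((D%:R - 1) / 2 - k%:R)%:C *: ldown F k u)).
  have := ldown_weight FH k uH; rewrite /H -scalemxAr muC -(rmorph_nat (real_complex R)) -rmorphB => <-.
  by rewrite scalerA ii scaleN1r opprK.
have EF : E + F = ('i + 'i) *: cmx b1.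
  rewrite scalerDl /E /F; move: (_ *: cmx b1) (cmx b2) => P Q.
  by rewrite addrCA subrK.
have FE2 : F - E = cmx b2 + cmx b2 by rewrite /E /F opprB addrC addrA subrK.
have b1E k : ldown F k u *m cmx b1 =
    - ('i *: ((2^-1)%:C *: ((e k)%:C *: ldown F k.-1 u + ldown F k.+1 u))).
  rewrite -raise [ldown F k.+1 u]/= -mulmxDr EF.
  rewrite -scalemxAr !scalerA half.
  have -> : 'i * 2^-1 * ('i + 'i) = -1 :> C.
    by rewrite -ii; field.
  by rewrite scaleN1r opprK.
have b2E k : ldown F k u *m cmx b2 =
    (2^-1)%:C *: (ldown F k.+1 u + (- e k)%:C *: ldown F k.-1 u).
  rewrite [(- e k)%:C]rmorphN scaleNr -raise [ldown F k.+1 u]/= -mulmxBr FE2 mulmxDr.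
  set Z := _ *m cmx b2; have -> : Z + Z = (2 : C) *: Z by rewrite scaler_nat mulr2n.
  by rewrite half scalerA mulVf ?scale1r ?pnatr_eq0.
have Sfull : row_full S.
  pose P (v : 'rV[C]_n) := (remx v <= S)%MS && (immx v <= S)%MS.
  have PD v w : P v -> P w -> P (v + w).
    by move=> /andP[a b] /andP[c d]; rewrite /P remxD immxD !addmx_sub.
  have Pi v : P v -> P ('i *: v).
    by move=> /andP[a b]; rewrite /P remxi immxi a eqmx_opp b.
  have PZ (a : R) v : P v -> P (a%:C *: v).
    by move=> /andP[c d]; rewrite /P remxZ immxZ !scalemx_sub.
  have PN v : P v -> P (- v).
    by move=> /(PZ (-1)); rewrite rmorphN rmorph1 scaleN1r.
  have Pu k : (k <= D)%N -> P (ldown F k u) by move=> kD; rewrite /P Sre ?Sim.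
  have stab (b : 'M[R]_n) : (forall k, (k < D)%N -> P (ldown F k u *m cmx b)) ->
      (S *m b <= S)%MS.
    move=> Pb; rewrite mul_col_mx col_mx_sub; apply/andP; split;
      apply/row_subP => k; rewrite row_mul rowK -?remx_mul -?immx_mul;
      by case/andP: (Pb k (ltn_ord k)).
  apply: irr.
  - apply/negP => /eqP S0; case/negP: u0; apply/eqP.
    have := Sre 0%N (leq0n _); have := Sim 0%N (leq0n _).
    rewrite S0 => /submxP[M1]; rewrite mulmx0 => im0 /submxP[M2]; rewrite mulmx0 => re0.
    rewrite /= in im0 re0.
    by rewrite [u]cmx_reim im0 re0 /cmx map_mx0 scaler0 addr0.
  - apply: stab => k kD; rewrite b1E; apply/PN/Pi/PZ/PD; last exact: Pu.
    by apply/PZ/Pu/(leq_trans (leq_pred k))/ltnW.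
  - apply: stab => k kD; rewrite b2E; apply/PZ/PD; first exact: Pu.
    by apply/PZ/Pu/(leq_trans (leq_pred k))/ltnW.
  - by apply: stab => k kD; rewrite b3E; apply/PN/Pi/PZ/Pu/ltnW.
(* [sg] lifts [conj u], of weight [- mu], back to weight [mu]; like [u] it is killed by [E]. *)
pose uc := conjmx u; pose sg := lup E D.-1 uc.
have ucF : uc *m F = 0.
  have : conjmx (u *m E) = 0 by rewrite uE conjmx0.
  by rewrite conjmx_mul conjE mulmxN => /eqP; rewrite oppr_eq0 => /eqP.
have ucH : uc *m (- H) = mu *: uc.
  by rewrite -conjH -conjmx_mul uH conjmxZ mu_real.
have sgH : sg *m H = mu *: sg.
  have ucH' : uc *m H = (- mu) *: uc by rewrite scaleNr -ucH mulmxN opprK.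
  rewrite /sg (lup_weight EH _ ucH'); congr (_ *: _).
  have -> : D.-1%:R = D%:R - 1 :> C by rewrite -[in RHS](prednK D0) -natr1 addrK.
  by rewrite -muD; ring.
have sgE : sg *m E = 0.
  have := conj_down D u; rewrite uD conjmx0 => /esym/eqP.
  rewrite scaler_eq0 signr_eq0 /= => /eqP.
  by rewrite -[in lup E D](prednK D0).
have ldownZ (a : C) (v : 'rV[C]_n) k : ldown F k (a *: v) = a *: ldown F k v.
  by elim: k => //= k ->; rewrite -scalemxAl.
have ldownB (v w : 'rV[C]_n) k : ldown F k (v - w) = ldown F k v - ldown F k w.
  by elim: k => //= k ->; rewrite -mulmxBl.
have Dn : (D <= n)%N.
  have := @eigenspaces_rank_le _ _ H D 1 mu; rewrite muln1; apply => k kD.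
  by apply: (eigenspace_rank_ge1 (unz k kD)); exact: ldown_weight.
have [/sub_rVP [a sga]|sgu] := boolP (sg <= u)%MS.
  exfalso.
  have [|c c0 cE] := @lup_ldown _ _ F E (- H) swapped_EH swapped_EF uc mu D D.-1 ucH ucF muD.
    by rewrite prednK.
  have {}cE : a *: ldown F D.-1 u = c *: uc by rewrite -ldownZ -sga.
  have [r r0 rE] : exists2 r : R, 0 < r & c = r%:C.
    case: c c0 {cE} => r s; rewrite ltcE /= => /andP[/eqP s0 r0].
    by exists r; rewrite // s0.
  (* Conjugating [a F^(D-1) u = c (conj u)] gives [|a| ^ 2 (-1) ^ (D - 1) = c > 0]. *)
  have := congr1 (@conjmx _ _) cE.
  rewrite !conjmxZ conj_down -/uc -/sg sga conjmxK rE conjc_real !scalerA => rel.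
  have {rel} : a^*%C * (-1) ^+ D.-1 * a = r%:C.
    apply/eqP; rewrite -subr_eq0; have /eqP := rel.
    by rewrite -subr_eq0 -scalerBl scaler_eq0 (negPf u0) orbF.
  have [t t0 tE] : exists2 t : R, 0 <= t & a^*%C * a = t%:C.
    case: (a) => x y; exists (x ^+ 2 + y ^+ 2); first by rewrite addr_ge0 ?sqr_ge0.
    by apply/eqP; rewrite eq_complex /=; apply/andP; split; apply/eqP; ring.
  rewrite mulrAC tE -signr_odd => /eqP.
  case Dodd: (odd D.-1).
    rewrite expr1 mulrN1 -rmorphN eq_complex /= eqxx andbT => /eqP rt.
    by move: r0; rewrite -rt oppr_gt0 ltNge t0.
  move=> _; have oddD : odd D by rewrite -(prednK D0) /= Dodd.
  (* The complex span of the string contains [conj u], hence the real and imaginary parts of the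
     string, hence everything; so [n = D] would be odd. *)
  pose W := \matrix_(k < D) ldown F k u.
  have WP k : (k <= D)%N -> (ldown F k u <= W)%MS.
    rewrite leq_eqVlt => /orP[/eqP ->|kD]; first by rewrite uD sub0mx.
    have -> : ldown F k u = row (Ordinal kD) W by rewrite rowK.
    exact: row_sub.
  have WE : (W *m E <= W)%MS.
    apply/row_subP => k; rewrite row_mul rowK raise scalemx_sub // WP //.
    by apply: leq_trans (leq_pred k) _; exact: ltnW.
  have Wup j w : (w <= W)%MS -> (lup E j w <= W)%MS.
    move=> wW; elim: j => //= j IH.
    by apply: submx_trans WE; exact: submxMr.
  have Wuc : (uc <= W)%MS.
    have -> : uc = c^-1 *: (a *: ldown F D.-1 u).
      by rewrite cE scalerA mulVf ?scale1r // gt_eqF.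
    by rewrite !scalemx_sub // WP // leq_pred.
  have Wre k : (k < D)%N -> (cmx (remx (ldown F k u)) <= W)%MS.
    move=> kD; rewrite cmx_re scalemx_sub // addmx_sub ?WP ?(ltnW kD) //.
    by rewrite conj_down scalemx_sub // Wup.
  have Wim k : (k < D)%N -> (cmx (immx (ldown F k u)) <= W)%MS.
    move=> kD; have -> : cmx (immx (ldown F k u)) =
        (- 'i) *: (ldown F k u - cmx (remx (ldown F k u))).
      by rewrite {2}[ldown F k u]cmx_reim addrC addKr scalerA mulNr ii opprK scale1r.
    by rewrite scalemx_sub // addmx_sub ?eqmx_opp ?Wre // WP // ltnW.
  have SW : (cmx S <= W)%MS.
    rewrite /cmx /S map_col_mx col_mx_sub; apply/andP; split; apply/row_subP => k;
      rewrite -map_row rowK; [exact: Wre | exact: Wim].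
  have nD : (n <= D)%N.
    move: Sfull; rewrite /row_full => /eqP <-.
    rewrite -(mxrank_map (real_complex R)); apply: leq_trans (mxrankS SW) _.
    exact: rank_leq_row.
  have En : n = D by apply/eqP; rewrite eqn_leq nD Dn.
  by move: n_even; rewrite En oddD.
have remxN (v : 'rV[C]_n) : remx (- v) = - remx v.
  by apply/matrixP => i j; rewrite !mxE; case: (v i j).
have immxN (v : 'rV[C]_n) : immx (- v) = - immx v.
  by apply/matrixP => i j; rewrite !mxE; case: (v i j).
split; [|exact: Sfull|by rewrite uD remx0|by rewrite uD immx0|]; last first.
  have re_ni (v : 'rV[C]_n) : remx (- ('i *: v)) = immx v by rewrite remxN remxi opprK.
  have im_ni (v : 'rV[C]_n) : immx (- ('i *: v)) = - remx v by rewrite immxN immxi.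
  move=> k; rewrite /real_ladder -/(e k); split; first split.
  - by rewrite -remx_mul b1E re_ni immxZ immxD immxZ.
  - by rewrite -remx_mul b2E remxZ remxD remxZ scaleNr.
  - by rewrite -remx_mul b3E re_ni immxZ.
  - by rewrite -immx_mul b1E im_ni remxZ remxD remxZ.
  - by rewrite -immx_mul b2E immxZ immxD immxZ scaleNr.
  - by rewrite -immx_mul b3E im_ni remxZ.
apply/eqP; rewrite eqn_leq; apply/andP; split.
  by move: Sfull; rewrite /row_full => /eqP <-; rewrite -addnn; exact: rank_leq_row.
rewrite -muln2; apply: (@eigenspaces_rank_le _ _ H _ _ mu) => k kD.
apply: (@rank2 (ldown F k u) (ldown F k sg)); first exact: unz.
- by apply/eigenspaceP; exact: ldown_weight.
- by apply/eigenspaceP; exact: ldown_weight.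
(* A dependence at weight [mu - k] would lift to one between [sg] and [u], since [E^k] undoes [F^k]
   up to a positive factor. *)
apply/negP => /sub_rVP [a ae]; case/negP: sgu; apply/sub_rVP; exists a.
apply/eqP; rewrite -subr_eq0; apply/eqP.
have [||c c0 cE] := @lup_ldown _ _ E F H FH FE (sg - a *: u) mu D k _ _ muD kD.
- by rewrite mulmxBl -scalemxAl sgH uH scalerBr scalerA mulrC -scalerA.
- by rewrite mulmxBl -scalemxAl sgE uE scaler0 subr0.
move: cE; rewrite ldownB ldownZ ae subrr.
have -> : lup E k 0 = 0 by elim: (k) => //= m ->; rewrite mul0mx.
by move/esym/eqP; rewrite scaler_eq0 gt_eqF //= => /eqP.
Qed.

End Irreducible.
End RealForm.

Lemma sum_ord8 (V : nmodType) (f : 'I_8 -> V) : \sum_i f i =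
  f (@Ordinal 8 0 isT) + f (@Ordinal 8 1 isT) + f (@Ordinal 8 2 isT)
  + f (@Ordinal 8 3 isT) + f (@Ordinal 8 4 isT) + f (@Ordinal 8 5 isT)
  + f (@Ordinal 8 6 isT) + f (@Ordinal 8 7 isT).
Proof.
rewrite !big_ord_recl big_ord0 addr0 !addrA.
by do ?congr (_ + _); congr (f _); apply: val_inj.
Qed.

(** * The weight string of the model *)

Section ModelRepresentation.
Variable R : realType.
Implicit Types (p : 'M[R]_(3, 4)) (r : 'rV[R]_8) (s : R).

Definition cross_mx s1 s2 s3 : 'M[R]_3 :=
  mk_mx 3 3 [:: [:: 0; - s3; s2]; [:: s3; 0; - s1]; [:: - s2; s1; 0]].

(* The derivative at t = 0 of qact k_t p along a curve of unit quaternions with k_0 = 1 and derivative (s1 i + s2 j + s3 k) / 2. *)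
Definition dact s1 s2 s3 p : 'M[R]_(3, 4) :=
  cross_mx s1 s2 s3 *m p + 2^-1 *: (p *m qleft (Quat 0 s1 s2 s3)).

Lemma dact_linear s1 s2 s3 p : dact s1 s2 s3 p =
  s1 *: dact 1 0 0 p + s2 *: dact 0 1 0 p + s3 *: dact 0 0 1 p.
Proof.
rewrite [LHS]/dact.
have -> : cross_mx s1 s2 s3 = s1 *: cross_mx 1 0 0 + s2 *: cross_mx 0 1 0
    + s3 *: cross_mx 0 0 1 by mx_ring.
have -> : qleft (Quat 0 s1 s2 s3) = s1 *: qleft (Quat 0 1 0 0)
    + s2 *: qleft (Quat 0 0 1 0) + s3 *: qleft (Quat 0 0 0 1) by mx_ring.
rewrite /dact !mulmxDl !mulmxDr -!scalemxAl -!scalemxAr.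
by apply/matrixP => i j; rewrite [LHS]mxE [RHS]mxE !mxE; ring.
Qed.

(* Coordinates in the weight string of the model generated by the highest weight vector (0 -1 - i 0 0; 0 - i 1 0; 0 0 0 0). *)
Definition ladder_vec r : 'M[R]_(3, 4) :=
  let c0 := r 0 (@Ordinal 8 0 isT) in let c1 := r 0 (@Ordinal 8 1 isT) in
  let c2 := r 0 (@Ordinal 8 2 isT) in let c3 := r 0 (@Ordinal 8 3 isT) in
  let d0 := r 0 (@Ordinal 8 4 isT) in let d1 := r 0 (@Ordinal 8 5 isT) in
  let d2 := r 0 (@Ordinal 8 6 isT) in let d3 := r 0 (@Ordinal 8 7 isT) in
  mk_mx 3 4 [:: [:: d1 - 6 * d3; - c0 + 2 * c2; - d0 + 2 * d2; c1 - 6 * c3];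
    [:: - c1 - 6 * c3; - d0 - 2 * d2; c0 + 2 * c2; d1 + 6 * d3];
    [:: - 4 * d2; 2 * c1; 2 * d1; - 4 * c2]].

(** [real_ladder] for [D = 4] in the basis [x 0, ..., x 3, y 0, ..., y 3], acting on rows: [m] takes
    the values 3/2, 1/2, -1/2, -3/2 and [e] the values 0, 3, 4, 3. *)
Definition ladder_mx1 : 'M[R]_8 := mk_mx 8 8 [::
  [:: 0; 0; 0; 0; 0; (1 / 2); 0; 0];
  [:: 0; 0; 0; 0; (3 / 2); 0; (1 / 2); 0];
  [:: 0; 0; 0; 0; 0; 2; 0; (1 / 2)];
  [:: 0; 0; 0; 0; 0; 0; (3 / 2); 0];
  [:: 0; - (1 / 2); 0; 0; 0; 0; 0; 0];
  [:: - (3 / 2); 0; - (1 / 2); 0; 0; 0; 0; 0];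
  [:: 0; - 2; 0; - (1 / 2); 0; 0; 0; 0];
  [:: 0; 0; - (3 / 2); 0; 0; 0; 0; 0]].

Definition ladder_mx2 : 'M[R]_8 := mk_mx 8 8 [::
  [:: 0; (1 / 2); 0; 0; 0; 0; 0; 0];
  [:: - (3 / 2); 0; (1 / 2); 0; 0; 0; 0; 0];
  [:: 0; - 2; 0; (1 / 2); 0; 0; 0; 0];
  [:: 0; 0; - (3 / 2); 0; 0; 0; 0; 0];
  [:: 0; 0; 0; 0; 0; (1 / 2); 0; 0];
  [:: 0; 0; 0; 0; - (3 / 2); 0; (1 / 2); 0];
  [:: 0; 0; 0; 0; 0; - 2; 0; (1 / 2)];
  [:: 0; 0; 0; 0; 0; 0; - (3 / 2); 0]].

Definition ladder_mx3 : 'M[R]_8 := mk_mx 8 8 [::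
  [:: 0; 0; 0; 0; (3 / 2); 0; 0; 0];
  [:: 0; 0; 0; 0; 0; (1 / 2); 0; 0];
  [:: 0; 0; 0; 0; 0; 0; - (1 / 2); 0];
  [:: 0; 0; 0; 0; 0; 0; 0; - (3 / 2)];
  [:: - (3 / 2); 0; 0; 0; 0; 0; 0; 0];
  [:: 0; - (1 / 2); 0; 0; 0; 0; 0; 0];
  [:: 0; 0; (1 / 2); 0; 0; 0; 0; 0];
  [:: 0; 0; 0; (3 / 2); 0; 0; 0; 0]].

Let row_ladder_mx1 r : r *m ladder_mx1 = \row_j nth 0 [::
  - 3 / 2 * r 0 (@Ordinal 8 5 isT);
  - 1 / 2 * r 0 (@Ordinal 8 4 isT) - 2 / 1 * r 0 (@Ordinal 8 6 isT);
  - 1 / 2 * r 0 (@Ordinal 8 5 isT) - 3 / 2 * r 0 (@Ordinal 8 7 isT);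
  - 1 / 2 * r 0 (@Ordinal 8 6 isT);
  3 / 2 * r 0 (@Ordinal 8 1 isT);
  1 / 2 * r 0 (@Ordinal 8 0 isT) + 2 / 1 * r 0 (@Ordinal 8 2 isT);
  1 / 2 * r 0 (@Ordinal 8 1 isT) + 3 / 2 * r 0 (@Ordinal 8 3 isT);
  1 / 2 * r 0 (@Ordinal 8 2 isT)] j.
Proof.
by apply/rowP => j; rewrite [LHS]mxE sum_ord8 !mxE; ord_cases j; rewrite /=; field.
Qed.

Lemma ladder_vec_dact1 r : dact 1 0 0 (ladder_vec r) = ladder_vec (r *m ladder_mx1).
Proof.
rewrite row_ladder_mx1 /dact /ladder_vec !mxE /=.
by apply/matrixP => i j; rewrite !mxE !big_ord_recl !big_ord0 !mxE;
  ord_cases i; ord_cases j; rewrite /=; field.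
Qed.

Let row_ladder_mx2 r : r *m ladder_mx2 = \row_j nth 0 [::
  - 3 / 2 * r 0 (@Ordinal 8 1 isT);
  1 / 2 * r 0 (@Ordinal 8 0 isT) - 2 / 1 * r 0 (@Ordinal 8 2 isT);
  1 / 2 * r 0 (@Ordinal 8 1 isT) - 3 / 2 * r 0 (@Ordinal 8 3 isT);
  1 / 2 * r 0 (@Ordinal 8 2 isT);
  - 3 / 2 * r 0 (@Ordinal 8 5 isT);
  1 / 2 * r 0 (@Ordinal 8 4 isT) - 2 / 1 * r 0 (@Ordinal 8 6 isT);
  1 / 2 * r 0 (@Ordinal 8 5 isT) - 3 / 2 * r 0 (@Ordinal 8 7 isT);
  1 / 2 * r 0 (@Ordinal 8 6 isT)] j.
Proof.
by apply/rowP => j; rewrite [LHS]mxE sum_ord8 !mxE; ord_cases j; rewrite /=; field.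
Qed.

Lemma ladder_vec_dact2 r : dact 0 1 0 (ladder_vec r) = ladder_vec (r *m ladder_mx2).
Proof.
rewrite row_ladder_mx2 /dact /ladder_vec !mxE /=.
by apply/matrixP => i j; rewrite !mxE !big_ord_recl !big_ord0 !mxE;
  ord_cases i; ord_cases j; rewrite /=; field.
Qed.

Let row_ladder_mx3 r : r *m ladder_mx3 = \row_j nth 0 [::
  - 3 / 2 * r 0 (@Ordinal 8 4 isT);
  - 1 / 2 * r 0 (@Ordinal 8 5 isT);
  1 / 2 * r 0 (@Ordinal 8 6 isT);
  3 / 2 * r 0 (@Ordinal 8 7 isT);
  3 / 2 * r 0 (@Ordinal 8 0 isT);
  1 / 2 * r 0 (@Ordinal 8 1 isT);
  - 1 / 2 * r 0 (@Ordinal 8 2 isT);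
  - 3 / 2 * r 0 (@Ordinal 8 3 isT)] j.
Proof.
by apply/rowP => j; rewrite [LHS]mxE sum_ord8 !mxE; ord_cases j; rewrite /=; field.
Qed.

Lemma ladder_vec_dact3 r : dact 0 0 1 (ladder_vec r) = ladder_vec (r *m ladder_mx3).
Proof.
rewrite row_ladder_mx3 /dact /ladder_vec !mxE /=.
by apply/matrixP => i j; rewrite !mxE !big_ord_recl !big_ord0 !mxE;
  ord_cases i; ord_cases j; rewrite /=; field.
Qed.

Lemma gamma_ladder_vec r : gamma (ladder_vec r) = 0.
Proof.
rewrite /gamma; apply/rowP => j; rewrite !big_ord_recl big_ord0 !mxE.
ord_cases j; do ?[rewrite !big_ord_recl]; rewrite ?big_ord0 ?mxE /=; ring.
Qed.

Lemma ladder_vec_inj r : ladder_vec r = 0 -> r = 0.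
Proof.
move=> e; have E i j := congr1 (fun M : 'M[R]_(3, 4) => M i j) e.
have E00 := E (@Ordinal 3 0 isT) (@Ordinal 4 0 isT); have E01 := E (@Ordinal 3 0 isT) (@Ordinal 4 1 isT).
have E02 := E (@Ordinal 3 0 isT) (@Ordinal 4 2 isT); have E03 := E (@Ordinal 3 0 isT) (@Ordinal 4 3 isT).
have E10 := E (@Ordinal 3 1 isT) (@Ordinal 4 0 isT); have E11 := E (@Ordinal 3 1 isT) (@Ordinal 4 1 isT).
have E12 := E (@Ordinal 3 1 isT) (@Ordinal 4 2 isT); have E13 := E (@Ordinal 3 1 isT) (@Ordinal 4 3 isT).
move: E00 E01 E02 E03 E10 E11 E12 E13; rewrite /ladder_vec !mxE /=.
move=> E00 E01 E02 E03 E10 E11 E12 E13.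
apply/rowP => -[[|[|[|[|[|[|[|[|//]]]]]]]] hj]; rewrite mxE (bool_irrelevance hj isT); lra.
Qed.

Lemma ladder_vec_surj p : gamma p = 0 -> exists r, p = ladder_vec r.
Proof.
move=> g0; have [a [b [c pE]]] := quat_rowsP p; rewrite {}pE in g0 *.
have g (j : 'I_4) := congr1 (fun v : 'rV[R]_4 => v 0 j) g0.
have := g ord0; have := g (lift ord0 ord0); have := g (@Ordinal 4 2 isT);
  have := g (@Ordinal 4 3 isT).
rewrite /gamma !mxE !big_ord_recl !big_ord0 !mxE.
do ?[rewrite !big_ord_recl]; rewrite !big_ord0 !mxE /= => G3 G2 G1 G0.
case: a b c {g0 g} G0 G1 G2 G3 => [a0 a1 a2 a3] [b0 b1 b2 b3] [c0 c1 c2 c3] /= G0 G1 G2 G3.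
(* Inverse of the entries of [ladder_vec], valid modulo the four equations [gamma p = 0]. *)
exists (\row_j nth 0 [:: (b2 - a1) / 2; c1 / 2; - c3 / 4; - (a3 + b0) / 12;
  - (a2 + b1) / 2; c2 / 2; - c0 / 4; (b3 - a0) / 12] j).
apply/matrixP => i j; rewrite !mxE; ord_cases i; ord_cases j => //=; lra.
Qed.

Lemma ladder_vec_linear (x : R) r r' :
  ladder_vec (x *: r + r') = x *: ladder_vec r + ladder_vec r'.
Proof. by apply/matrixP => i j; rewrite !mxE; ord_cases i; ord_cases j => /=; ring. Qed.

End ModelRepresentation.

Section Su2.
Local Open Scope complex_scope.
Variable R : realType.

(** Here and below, [- i / 2] times the Pauli matrices; the half removes all factors from the cyclic
    brackets. *)
Definition su2_1 : 'M[R[i]]_2 := mk_mx 2 2 [:: [:: 0; 0 -i* (1 / 2)]; [:: 0 -i* (1 / 2); 0]].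
Definition su2_2 : 'M[R[i]]_2 := mk_mx 2 2 [:: [:: 0; (- (1 / 2)) +i* 0]; [:: (1 / 2) +i* 0; 0]].
Definition su2_3 : 'M[R[i]]_2 := mk_mx 2 2 [:: [:: 0 -i* (1 / 2); 0]; [:: 0; 0 +i* (1 / 2)]].

Ltac cx_eq := apply/eqP; rewrite eq_complex /=; apply/andP; split; apply/eqP; field.

Lemma su2_1P : su R 2 su2_1.
Proof.
split; last by rewrite /mxtrace !big_ord_recl big_ord0 !mxE /= !addr0.
by apply/matrixP => i j; rewrite !mxE; ord_cases i; ord_cases j => /=; cx_eq.
Qed.

Lemma su2_2P : su R 2 su2_2.
Proof.
split; last by rewrite /mxtrace !big_ord_recl big_ord0 !mxE /= !addr0.
by apply/matrixP => i j; rewrite !mxE; ord_cases i; ord_cases j => /=; cx_eq.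
Qed.

Lemma su2_3P : su R 2 su2_3.
Proof.
split; last by rewrite /mxtrace !big_ord_recl big_ord0 !mxE /= addr0; cx_eq.
by apply/matrixP => i j; rewrite !mxE; ord_cases i; ord_cases j => /=; cx_eq.
Qed.

Lemma su2_bracket12 : lie_bracket su2_1 su2_2 = su2_3.
Proof.
apply/matrixP => i j; rewrite /lie_bracket !mxE !big_ord_recl !big_ord0 !mxE.
by ord_cases i; ord_cases j => /=; cx_eq.
Qed.

Lemma su2_bracket23 : lie_bracket su2_2 su2_3 = su2_1.
Proof.
apply/matrixP => i j; rewrite /lie_bracket !mxE !big_ord_recl !big_ord0 !mxE.
by ord_cases i; ord_cases j => /=; cx_eq.
Qed.

Lemma su2_bracket31 : lie_bracket su2_3 su2_1 = su2_2.
Proof.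
apply/matrixP => i j; rewrite /lie_bracket !mxE !big_ord_recl !big_ord0 !mxE.
by ord_cases i; ord_cases j => /=; cx_eq.
Qed.

Lemma su2_linear (a : R) X Y : su R 2 X -> su R 2 Y -> su R 2 (a%:C *: X + Y).
Proof.
move=> [X1 X2] [Y1 Y2]; split; last by rewrite mxtraceD mxtraceZ X2 Y2 mulr0 addr0.
have -> : (map_mx conjc (a%:C *: X + Y))^T = a%:C *: (map_mx conjc X)^T + (map_mx conjc Y)^T.
  apply/matrixP => i j; rewrite !mxE rmorphD rmorphM /=; congr (_ * _ + _).
  exact: conjc_real.
by rewrite X1 Y1 scalerN opprD.
Qed.

Lemma su2_span X : su R 2 X -> exists s1 s2 s3 : R,
  X = s1%:C *: su2_1 + (s2%:C *: su2_2 + s3%:C *: su2_3).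
Proof.
move=> [X1 X2].
have h i j : conjc (X j i) = - X i j.
  by have := congr1 (fun M : 'M[R[i]]_2 => M i j) X1; rewrite !mxE.
move: X2; rewrite /mxtrace !big_ord_recl big_ord0 addr0.
pose o := lift ord0 ord0 : 'I_2.
have h00 := h ord0 ord0; have h11 := h o o; have h01 := h ord0 o.
rewrite -/o => tr0.
exists (- 2 * complex.Im (X ord0 o)), (- 2 * complex.Re (X ord0 o)), (- 2 * complex.Im (X ord0 ord0)).
have E (i j : 'I_2) : X i j = nth 0 (nth [::] [:: [:: X ord0 ord0; X ord0 o]; [:: X o ord0; X o o]] i) j.
  by ord_cases i; ord_cases j => /=; congr (X _ _); apply: val_inj.
apply/matrixP => i j; rewrite E !mxE.
move: h00 h11 h01 tr0 {E h X1}.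
case: (X ord0 ord0) (X ord0 o) (X o ord0) (X o o) => [a b] [c d] [e f] [g k].
move=> /eqP; rewrite eq_complex /= => /andP[/eqP h1 /eqP h2].
move=> /eqP; rewrite eq_complex /= => /andP[/eqP h3 /eqP h4].
move=> /eqP; rewrite eq_complex /= => /andP[/eqP h5 /eqP h6].
move=> /eqP; rewrite eq_complex /= => /andP[/eqP h7 /eqP h8].
by ord_cases i; ord_cases j; apply/eqP; rewrite /= eq_complex /=; apply/andP; split; apply/eqP; lra.
Qed.

Lemma isomorphic_su2_basis n (g : set 'M[R]_n) : isomorphic_to_su 2 g ->
  exists X1 X2 X3 : 'M[R]_n,
    [/\ forall A, g A <-> exists s1 s2 s3, A = s1 *: X1 + (s2 *: X2 + s3 *: X3),
        lie_bracket X1 X2 = X3, lie_bracket X2 X3 = X1 & lie_bracket X3 X1 = X2].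
Proof.
move=> [phi [[phi_in _ phi_surj] phi_lin phi_br]].
have su0 : su R 2 0.
  have := su2_linear (-1) su2_1P su2_1P.
  by rewrite rmorphN rmorph1 scaleN1r addNr.
have phi0 : phi 0 = 0.
  have := phi_lin 1 _ _ su0 su0; rewrite scaler0 addr0 scale1r => /eqP.
  by rewrite -subr_eq subrr eq_sym => /eqP.
have phiZ a X : su R 2 X -> phi (a%:C *: X) = a *: phi X.
  by move=> sX; have := phi_lin a X 0 sX su0; rewrite !addr0 phi0 addr0.
have suZ (a : R) X : su R 2 X -> su R 2 (a%:C *: X).
  by move=> sX; have := su2_linear a sX su0; rewrite addr0.
have phi3 (s1 s2 s3 : R) :
    phi (s1%:C *: su2_1 + (s2%:C *: su2_2 + s3%:C *: su2_3)) =
    s1 *: phi su2_1 + (s2 *: phi su2_2 + s3 *: phi su2_3).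
  have s3m := suZ s3 _ su2_3P; have s2m := su2_linear s2 su2_2P s3m.
  by rewrite (phi_lin s1 _ _ su2_1P s2m) (phi_lin s2 _ _ su2_2P s3m) (phiZ _ _ su2_3P).
exists (phi su2_1), (phi su2_2), (phi su2_3); split.
- move=> A; split.
    move=> /phi_surj [X sX <-]; have [s1 [s2 [s3 ->]]] := su2_span sX.
    by exists s1, s2, s3; rewrite phi3.
  move=> [s1 [s2 [s3 ->]]]; rewrite -phi3; apply: phi_in.
  apply: su2_linear; first exact: su2_1P.
  by apply: su2_linear; [exact: su2_2P | apply: suZ; exact: su2_3P].
- by rewrite -phi_br ?su2_bracket12; [| exact: su2_1P | exact: su2_2P].
- by rewrite -phi_br ?su2_bracket23; [| exact: su2_2P | exact: su2_3P].
- by rewrite -phi_br ?su2_bracket31; [| exact: su2_3P | exact: su2_1P].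
Qed.

End Su2.

(** * Linear coordinates for the group representation *)

Section Decomposition.
Variable R : realType.

Lemma mulmx_ext m n (A B : 'M[R]_(m, n)) :
  (forall c : 'cV[R]_n, A *m c = B *m c) -> A = B.
Proof.
move=> h; apply/matrixP => i j.
by have := congr1 (fun v : 'cV[R]_m => v i 0) (h (delta_mx j 0)); rewrite -!colE !mxE.
Qed.

Lemma vspace_matrix n (U : {vspace 'cV[R]_n}) : exists Z : 'M[R]_(n, \dim U),
  [/\ forall c, Z *m c \in U, forall v, v \in U -> exists c, v = Z *m c
    & forall c : 'cV[R]_(\dim U), Z *m c = 0 -> c = 0].
Proof.
pose b := vbasis U.
pose Z : 'M[R]_(n, \dim U) := \matrix_(i, j) b`_j i 0.
have ZE (c : 'cV[R]_(\dim U)) : Z *m c = \sum_j c j 0 *: b`_j.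
  apply/colP => i; rewrite mxE summxE; apply: eq_bigr => j _.
  by rewrite !mxE mulrC.
exists Z; split.
- move=> c; rewrite ZE; apply: memv_suml => j _; apply: memvZ.
  by apply: vbasis_mem; rewrite mem_nth // size_tuple.
- move=> v vU; exists (\col_j coord b j v); rewrite ZE {1}(coord_vbasis vU).
  by apply: eq_bigr => j _; rewrite mxE.
- move=> c; rewrite ZE => c0; apply/colP => j; rewrite mxE.
  by have /freeP h := basis_free (vbasisP U); exact: (h (fun j => c j 0) c0 j).
Qed.

(** Operators on a line commute, so a bracket acts on it by zero. Each basis element of su(2) is a
    bracket, so its one-dimensional representations are trivial. *)
Lemma invariant_line_killed n (g : set 'M[R]_n) (X1 X2 X3 : 'M[R]_n)
    (U : {vspace 'cV[R]_n}) :
  invariant_subspace g U -> (\dim U <= 1)%N -> g X1 -> g X2 ->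
  lie_bracket X1 X2 = X3 -> forall v, v \in U -> X3 *m v = 0.
Proof.
move=> inv dU g1 g2 br v vU.
have [->|v0] := eqVneq v 0; first by rewrite mulmx0.
have UE : U = <[v]>%VS.
  apply/esym/eqP; rewrite eqEdim -memvE vU /= dim_vline v0.
  by [].
have act X : g X -> exists a, X *m v = a *: v.
  by move=> gX; have := inv X v gX vU; rewrite UE => /vlineP.
have [a ha] := act _ g1; have [b hb] := act _ g2.
rewrite -br /lie_bracket mulmxBl -!mulmxA ha hb -!scalemxAr ha hb !scalerA.
by rewrite mulrC subrr.
Qed.

Lemma decomposition n (g : set 'M[R]_n) (d : seq nat) (V0 : {vspace 'cV[R]_n})
    (X1 X2 X3 : 'M[R]_n) :
  irreducible_dimensions g d ->
  (forall v : 'cV[R]_n, v \in V0 <-> (forall A, g A -> A *m v = 0)) ->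
  (forall A, g A <-> exists s1 s2 s3, A = s1 *: X1 + (s2 *: X2 + s3 *: X3)) ->
  lie_bracket X1 X2 = X3 -> lie_bracket X2 X3 = X1 -> lie_bracket X3 X1 = X2 ->
  count (fun m => (1 < m)%N) d = 1%N -> nth 0%N d 0 = 8%N ->
  exists U : {vspace 'cV[R]_n},
    [/\ irreducible_subspace g U, \dim U = 8%N, (U + V0 = fullv)%VS &
        (U :&: V0 = 0)%VS].
Proof.
move=> [_ [U [Uirr _ Usum Udim]]] V0P gP br12 br23 br31 cd d0.
have gX1 : g X1 by apply/gP; exists 1, 0, 0; rewrite scale1r !scale0r !addr0.
have gX2 : g X2 by apply/gP; exists 0, 1, 0; rewrite scale1r !scale0r addr0 add0r.
have gX3 : g X3 by apply/gP; exists 0, 0, 1; rewrite scale1r !scale0r !add0r.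
case: d U Uirr Usum Udim cd d0 => [//|m d'] U Uirr Usum Udim /= cd m8.
subst m; have {}cd : count (fun m => (1 < m)%N) d' = 0%N by case: cd.
have small (i : 'I_(size (8%N :: d'))) : i != ord0 -> (U i <= V0)%VS.
  move=> i0; apply/subvP => v vU; apply/V0P => A /gP [s1 [s2 [s3 ->]]].
  have dU : (\dim (U i) <= 1)%N.
    rewrite Udim; case: i i0 vU => -[//|k] /= hk _ _.
    have := mem_nth 0%N (hk : (k < size d')%N).
    have /eqP := cd; rewrite eqn0Ngt -has_count => /hasPn h /h.
    by rewrite -leqNgt.
  have [inv _ _] := Uirr i.
  rewrite !mulmxDl -!scalemxAl.
  rewrite (invariant_line_killed inv dU gX2 gX3 br23 vU).
  rewrite (invariant_line_killed inv dU gX3 gX1 br31 vU).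
  rewrite (invariant_line_killed inv dU gX1 gX2 br12 vU).
  by rewrite !scaler0 !addr0.
exists (U ord0); have [inv U0 irr] := Uirr ord0; split.
- exact: Uirr.
- by rewrite Udim.
- apply/eqP; rewrite eqEsubv subvf /= -Usum; apply/subv_sumP => i _.
  have [->|i0] := eqVneq i ord0; first exact: addvSl.
  exact: subv_trans (small i i0) (addvSr _ _).
- have [||//|UV] := irr (U ord0 :&: V0)%VS; [|exact: capvSl|].
    move=> A v gA; rewrite memv_cap => /andP[vU /V0P vV].
    by rewrite vV // mem0v.
  have UV0 : (U ord0 <= V0)%VS by rewrite -UV capvSr.
  exfalso; have v0 := vpick0 (U ord0); have vU := memv_pick (U ord0).
  set v := vpick _ in v0 vU.
  (* If [U] lay in [V0], the line of any of its vectors would be invariant, against irreducibility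
     in dimension 8. *)
  have [A w gA||lE|lE] := irr <[v]>%VS.
  - move=> /vlineP [a ->]; rewrite -scalemxAr.
    have /V0P -> // := subvP UV0 _ vU.
    by rewrite scaler0 mem0v.
  - by rewrite -memvE.
  - by have := dim_vline v; rewrite lE dimv0 v0 U0.
  - have := dim_vline v; rewrite lE Udim /= ; by case: (v != 0).
Qed.

Section IrreducibleCoordinates.
Variables (n : nat) (g : set 'M[R]_n) (X1 X2 X3 : 'M[R]_n) (U : {vspace 'cV[R]_n}).
Hypothesis gP : forall A, g A <-> exists s1 s2 s3, A = s1 *: X1 + (s2 *: X2 + s3 *: X3).
Hypothesis br12 : lie_bracket X1 X2 = X3.
Hypothesis br23 : lie_bracket X2 X3 = X1.
Hypothesis br31 : lie_bracket X3 X1 = X2.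
Hypothesis Uirr : irreducible_subspace g U.

(** [Y *m X *m Z] is the matrix of [X] on [U] in the basis [Z]. Transposition passes to the row
    vectors of [real_weight_string], whose string gives the rows of the transpose of [Q]. *)
Lemma irreducible_string (Z : 'M[R]_(n, 8)) (Y : 'M[R]_(8, n)) :
  (forall c, Z *m c \in U) -> (forall v, v \in U -> exists c, v = Z *m c) ->
  Y *m Z = 1%:M ->
  exists Q : 'M[R]_8, [/\ Q \in unitmx,
    Y *m X1 *m Z = Q *m (ladder_mx1 R)^T *m invmx Q,
    Y *m X2 *m Z = Q *m (ladder_mx2 R)^T *m invmx Q &
    Y *m X3 *m Z = Q *m (ladder_mx3 R)^T *m invmx Q].
Proof.
move=> ZU UZ YZ; have [inv U0 irr] := Uirr.
have ZYZ c : Z *m (Y *m (Z *m c)) = Z *m c.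
  by rewrite (mulmxA Y) YZ mul1mx.
have gX1 : g X1 by apply/gP; exists 1, 0, 0; rewrite scale1r !scale0r !addr0.
have gX2 : g X2 by apply/gP; exists 0, 1, 0; rewrite scale1r !scale0r addr0 add0r.
have gX3 : g X3 by apply/gP; exists 0, 0, 1; rewrite scale1r !scale0r !add0r.
have ZYX X : g X -> Z *m (Y *m X *m Z) = X *m Z.
  move=> gX; apply: mulmx_ext => c; rewrite -!mulmxA.
  have [c' ->] := UZ _ (inv X (Z *m c) gX (ZU c)).
  exact: ZYZ.
pose a1 := Y *m X1 *m Z; pose a2 := Y *m X2 *m Z; pose a3 := Y *m X3 *m Z.
have aM X X' : g X' -> (Y *m X *m Z) *m (Y *m X' *m Z) = Y *m (X *m X') *m Z.
  by move=> gX'; rewrite -[LHS]mulmxA ZYX // !mulmxA.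
have abr X X' X'' : g X -> g X' -> lie_bracket X X' = X'' ->
    (Y *m X *m Z) *m (Y *m X' *m Z) =
    (Y *m X' *m Z) *m (Y *m X *m Z) + Y *m X'' *m Z.
  move=> gX gX' <-; rewrite !aM // /lie_bracket mulmxBr mulmxBl addrC subrK.
  by [].
have tr (A B C D E : 'M[R]_8) : A *m B = C *m D + E -> B^T *m A^T = D^T *m C^T + E^T.
  by move=> h; rewrite -!trmx_mul h linearD.
have r12 := tr _ _ _ _ _ (abr _ _ _ gX1 gX2 br12).
have r23 := tr _ _ _ _ _ (abr _ _ _ gX2 gX3 br23).
have r31 := tr _ _ _ _ _ (abr _ _ _ gX3 gX1 br31).
have Zinj c : Z *m c = 0 -> c = 0.
  by move=> h; rewrite -[c]mul1mx -YZ -mulmxA h mulmx0.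
(* Row spaces stable under the transposes correspond, through [Z], to invariant subspaces of [U]. *)
have irr8 m (X : 'M[R]_(m, 8)) : X != 0 ->
    (X *m a1^T <= X)%MS -> (X *m a2^T <= X)%MS -> (X *m a3^T <= X)%MS -> row_full X.
  move=> X0 s1 s2 s3.
  pose f : 'Hom('rV[R]_m, 'cV[R]_n) := linfun (mulmx Z \o trmx \o mulmxr X).
  have fE r : f r = Z *m (r *m X)^T by rewrite lfunE.
  have act V : g V -> (X *m (Y *m V *m Z)^T <= X)%MS -> forall r, V *m f r \in limg f.
    move=> gV /submxP [D DE] r.
    have -> : V *m f r = Z *m ((r *m D) *m X)^T.
      rewrite fE mulmxA -ZYX // -[LHS]mulmxA; congr (_ *m _).
      by rewrite -[r *m D *m X]mulmxA -DE mulmxA [RHS]trmx_mul trmxK.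
    rewrite -fE.
    by apply: memv_img; exact: memvf.
  have [||W0|WU] := irr (limg f).
  - move=> A v /gP [t1 [t2 [t3 ->]]] /memv_imgP [r _ ->].
    rewrite !mulmxDl -!scalemxAl; apply: memvD; first by apply: memvZ; exact: act.
    by apply: memvD; apply: memvZ; exact: act.
  - by apply/subvP => v /memv_imgP [r _ ->]; rewrite fE.
  - case/negP: X0; apply/eqP; apply/row_matrixP => i; rewrite row0.
    have : f (delta_mx 0 i) = 0.
      by apply/eqP; rewrite -memv0 -W0; apply: memv_img; exact: memvf.
    by rewrite fE -rowE => /Zinj /(congr1 trmx); rewrite trmxK trmx0.
  - rewrite -sub1mx; apply/row_subP => i.
    have : Z *m (row i 1%:M)^T \in limg f by rewrite WU.
    move=> /memv_imgP [r _]; rewrite fE => e.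
    have : (row i 1%:M)^T - (r *m X)^T = 0 by apply: Zinj; rewrite mulmxBr e subrr.
    by move/eqP; rewrite subr_eq0 => /eqP /trmx_inj ->; exact: submxMl.
have [x [y [D [D8 full xD yD lad]]]] :=
  @real_weight_string R 8 a1^T a2^T a3^T isT isT r12 r23 r31 irr8.
have D4 : D = 4%N by move: D8; case: (D) => [|[|[|[|[|[|k]]]]]].
subst D.
pose X8 : 'M[R]_8 := \matrix_(k < 8) nth 0 [:: x 0%N; x 1%N; x 2%N; x 3%N;
  y 0%N; y 1%N; y 2%N; y 3%N] k.
have rowX (j : 'I_8) : row j X8 = nth 0 [:: x 0%N; x 1%N; x 2%N; x 3%N;
  y 0%N; y 1%N; y 2%N; y 3%N] j by rewrite rowK.
have X8U : X8 \in unitmx.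
  rewrite -row_full_unit -sub1mx; apply: submx_trans (_ : col_mx _ _ <= X8)%MS; first by rewrite sub1mx; exact: full.
  rewrite col_mx_sub; apply/andP; split; apply/row_subP => k; rewrite rowK.
    have k8 : (k < 8)%N by apply: leq_trans (ltn_ord k) _.
    have -> : x k = row (Ordinal k8) X8.
      by rewrite rowX; case: k k8 => -[|[|[|[|//]]]].
    exact: row_sub.
  have k8 : (4 + k < 8)%N by rewrite -[8%N]/(4 + 4)%N ltn_add2l.
  have -> : y k = row (Ordinal k8) X8 by rewrite rowX; case: k k8 => -[|[|[|[|//]]]].
  exact: row_sub.
exists X8^T.
have conj (L A : 'M[R]_8) : X8 *m A^T = L *m X8 -> A = X8^T *m L^T *m invmx X8^T.
  move=> h; rewrite -trmx_inv -!trmx_mul -[LHS]trmxK; congr (_^T).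
  by rewrite -h mulKmx.
have [[x01 x02 x03] y01 y02 y03] := lad 0%N.
have [[x11 x12 x13] y11 y12 y13] := lad 1%N.
have [[x21 x22 x23] y21 y22 y23] := lad 2%N.
have [[x31 x32 x33] y31 y32 y33] := lad 3%N.
rewrite -/a1 -/a2 -/a3; split; first by rewrite unitmx_tr.
- apply: conj; apply/row_matrixP => k; rewrite [LHS]row_mul [RHS]row_mul [RHS]mulmx_sum_row [RHS]sum_ord8 !rowX.
  ord_cases k; rewrite /= ?x01 ?x11 ?x21 ?x31 ?y01 ?y11 ?y21 ?y31 ?xD ?yD;
    by apply/rowP => j; rewrite !mxE /=; field.
- apply: conj; apply/row_matrixP => k; rewrite [LHS]row_mul [RHS]row_mul [RHS]mulmx_sum_row [RHS]sum_ord8 !rowX.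
  ord_cases k; rewrite /= ?x02 ?x12 ?x22 ?x32 ?y02 ?y12 ?y22 ?y32 ?xD ?yD;
    by apply/rowP => j; rewrite !mxE /=; field.
- apply: conj; apply/row_matrixP => k; rewrite [LHS]row_mul [RHS]row_mul [RHS]mulmx_sum_row [RHS]sum_ord8 !rowX.
  ord_cases k; rewrite /= ?x03 ?x13 ?x23 ?x33 ?y03 ?y13 ?y23 ?y33 ?xD ?yD;
    by apply/rowP => j; rewrite !mxE /=; field.
Qed.

End IrreducibleCoordinates.

End Decomposition.

(** * Coordinates adapted to the splitting of V *)

Section ModelCoordinates.
Variable R : realType.

Lemma direct_sum_coordinates n (U V : {vspace 'cV[R]_n}) :
  (U + V = fullv)%VS -> (U :&: V = 0)%VS ->
  exists (Z : 'M[R]_(n, \dim U)) (Z0 : 'M[R]_(n, \dim V))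
         (Y : 'M[R]_(\dim U, n)) (Y0 : 'M[R]_(\dim V, n)),
    [/\ forall c, Z *m c \in U, forall v, v \in U -> exists c, v = Z *m c,
        forall w, Z0 *m w \in V,
        [/\ Y *m Z = 1%:M, Y *m Z0 = 0, Y0 *m Z = 0 & Y0 *m Z0 = 1%:M]
      & Z *m Y + Z0 *m Y0 = 1%:M].
Proof.
move=> UVf UV0.
have [Z [ZU UZ Zinj]] := vspace_matrix U; have [Z0 [Z0V VZ0 Z0inj]] := vspace_matrix V.
pose S := row_mx Z Z0.
have Sinj (x : 'cV[R]_(\dim U + \dim V)) : S *m x = 0 -> x = 0.
  rewrite -[x]vsubmxK mul_row_col => e.
  have e' : Z *m usubmx x = - (Z0 *m dsubmx x).
    by apply/eqP; rewrite -addr_eq0 e.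
  have : Z *m usubmx x \in (U :&: V)%VS by rewrite memv_cap ZU e' memvN Z0V.
  rewrite UV0 memv0 => /eqP z; rewrite (Zinj _ z).
  move: e'; rewrite z => /esym/eqP; rewrite oppr_eq0 => /eqP /Z0inj ->.
  exact: col_mx0.
have Ssurj (v : 'cV[R]_n) : exists x, v = S *m x.
  have : v \in (U + V)%VS by rewrite UVf memvf.
  move=> /memv_addP [u /UZ [c ->]] [w /VZ0 [c0 ->] ->].
  by exists (col_mx c c0); rewrite mul_row_col.
have free : row_free S^T.
  apply: inj_row_free => v /(congr1 trmx); rewrite trmx_mul trmxK trmx0.
  by move=> /Sinj /(congr1 trmx); rewrite trmxK trmx0.
have full : row_full S^T.
  rewrite -sub1mx; apply/row_subP => i.
  have [x xE] := Ssurj (row i 1%:M)^T.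
  by rewrite -[row i _]trmxK xE trmx_mul; exact: submxMl.
pose PP := (pinvmx S^T)^T.
have PS : PP *m S = 1%:M by rewrite -[S]trmxK -trmx_mul mulmxVp // trmx1.
have SP : S *m PP = 1%:M by rewrite -[S]trmxK -trmx_mul mulVpmx // trmx1.
exists Z, Z0, (usubmx PP), (dsubmx PP); split => //.
  by move: PS; rewrite -[PP]vsubmxK /S mul_col_row scalar_mx_block !vsubmxK => /eq_block_mx[].
by rewrite -mul_row_col vsubmxK.
Qed.

(** [P] reads the component in [U] in the ladder basis and [K] the component in [V0]; jointly they
    are a linear isomorphism that intertwines the action with the model. *)
Lemma model_coordinates n (g : set 'M[R]_n) (d : seq nat) (V0 : {vspace 'cV[R]_n}) :
  irreducible_dimensions g d ->
  (forall v : 'cV[R]_n, v \in V0 <-> (forall A, g A -> A *m v = 0)) ->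
  isomorphic_to_su 2 g ->
  count (fun m => (1 < m)%N) d = 1%N -> nth 0%N d 0 = 8%N ->
  exists (X1 X2 X3 : 'M[R]_n) (P : 'M[R]_(8, n)) (K : 'M[R]_(\dim V0, n)),
    [/\ forall A, g A <-> exists s1 s2 s3, A = s1 *: X1 + (s2 *: X2 + s3 *: X3),
        [/\ P *m X1 = (ladder_mx1 R)^T *m P, P *m X2 = (ladder_mx2 R)^T *m P
          & P *m X3 = (ladder_mx3 R)^T *m P],
        [/\ K *m X1 = 0, K *m X2 = 0 & K *m X3 = 0],
        forall r w, exists2 v : 'cV[R]_n, P *m v = r & K *m v = w
      & forall v : 'cV[R]_n, P *m v = 0 -> K *m v = 0 -> v = 0].
Proof.
move=> irrd V0P /isomorphic_su2_basis [X1 [X2 [X3 [gP br12 br23 br31]]]] cd d0.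
have [U [Uirr dU UV UV0]] := decomposition irrd V0P gP br12 br23 br31 cd d0.
have [Z [Z0 [Y [Y0 [ZU UZ Z0V [YZ YZ0 Y0Z Y0Z0] SP]]]]] := direct_sum_coordinates UV UV0.
move: Z Y ZU UZ YZ YZ0 Y0Z SP; rewrite dU => Z Y ZU UZ YZ YZ0 Y0Z SP.
have [Q [QU Q1 Q2 Q3]] := irreducible_string gP br12 br23 br31 Uirr ZU UZ YZ.
have gX1 : g X1 by apply/gP; exists 1, 0, 0; rewrite scale1r !scale0r !addr0.
have gX2 : g X2 by apply/gP; exists 0, 1, 0; rewrite scale1r !scale0r addr0 add0r.
have gX3 : g X3 by apply/gP; exists 0, 0, 1; rewrite scale1r !scale0r !add0r.
have XZ0 X : g X -> X *m Z0 = 0.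
  move=> gX; apply: mulmx_ext => w; rewrite -mulmxA mul0mx.
  by move: (Z0V w) => /V0P; apply.
have Y0XZ X : g X -> Y0 *m X *m Z = 0.
  move=> gX; apply: mulmx_ext => c; rewrite -!mulmxA mul0mx.
  have [inv _ _] := Uirr; have [c' ->] := UZ _ (inv X _ gX (ZU c)).
  by rewrite mulmxA Y0Z mul0mx.
have PX X (L : 'M[R]_8) : g X -> Y *m X *m Z = Q *m L *m invmx Q ->
    invmx Q *m Y *m X = L *m (invmx Q *m Y).
  move=> gX e; rewrite -[LHS]mulmx1 -[RHS]mulmx1 -SP !mulmxDr; congr (_ + _).
    rewrite !mulmxA; congr (_ *m Y).
    by rewrite -!mulmxA (mulmxA Y) e YZ mulmx1 !mulmxA mulVmx // mul1mx.
  rewrite !mulmxA; congr (_ *m Y0).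
  by rewrite -!mulmxA XZ0 // YZ0 !mulmx0.
have Y0X X : g X -> Y0 *m X = 0.
  by move=> gX; rewrite -[LHS]mulmx1 -SP mulmxDr !mulmxA Y0XZ // -(mulmxA Y0) XZ0 // mulmx0 !mul0mx addr0.
exists X1, X2, X3, (invmx Q *m Y), Y0; split => //.
- by split; apply: PX.
- by split; apply: Y0X.
- move=> r w; exists (Z *m (Q *m r) + Z0 *m w).
    by rewrite mulmxDr !mulmxA -!(mulmxA _ Y) YZ YZ0 mulmx1 mulVmx // mul1mx mulmx0 mul0mx addr0.
  by rewrite mulmxDr !mulmxA Y0Z Y0Z0 !mul0mx mul1mx add0r.
- move=> v Pv Kv; rewrite -[v]mul1mx -SP mulmxDl -!mulmxA Kv mulmx0 addr0.
  have -> : Y *m v = Q *m (invmx Q *m Y *m v) by rewrite !mulmxA mulmxV // mul1mx.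
  by rewrite Pv !mulmx0.
Qed.

End ModelCoordinates.

(** * Exponentials acting as unit quaternions *)

Section TwoSided.
Variable R : realType.
Implicit Types (B : 'M[R]_3) (C : 'M[R]_4) (p : 'M[R]_(3, 4)).

Definition cvec p : 'cV[R]_(3 * 4) := (mxvec p)^T.

(** [p |-> B p C] as a square matrix on flattened 3 x 4 matrices, the form to which [expmx]
    applies. *)
Definition twosided B C : 'M[R]_(3 * 4) := (lin_mx (mulmxr C \o mulmx B))^T.

Lemma twosidedE B C p : twosided B C *m cvec p = cvec (B *m p *m C).
Proof. by rewrite -trmx_mul mul_vec_lin. Qed.

Lemma cvec_inj : injective cvec.
Proof. by move=> p q /trmx_inj; exact: (can_inj mxvecK). Qed.

Lemma twosided_ext (S T : 'M[R]_(3 * 4)) :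
  (forall p, S *m cvec p = T *m cvec p) -> S = T.
Proof.
move=> h; apply: mulmx_ext => c; have := h (vec_mx c^T).
by rewrite /cvec vec_mxK trmxK.
Qed.

Lemma cvecD p q : cvec (p + q) = cvec p + cvec q.
Proof. by rewrite /cvec !linearD. Qed.

Lemma cvecZ (x : R) p : cvec (x *: p) = x *: cvec p.
Proof. by rewrite /cvec !linearZ. Qed.

Lemma cvecN p : cvec (- p) = - cvec p.
Proof. by rewrite /cvec !linearN. Qed.

Lemma twosided_mulmx B B' C C' :
  twosided B C *m twosided B' C' = twosided (B *m B') (C' *m C).
Proof. by apply: twosided_ext => p; rewrite -mulmxA !twosidedE !mulmxA. Qed.

Lemma twosided11 : twosided 1%:M 1%:M = 1%:M.
Proof. by apply: twosided_ext => p; rewrite twosidedE mul1mx mulmx1 mul1mx. Qed.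

Lemma cvg_twosided {T : Type} (F : set_system T) {FF : Filter F}
    (f : T -> 'M[R]_3) (g : T -> 'M[R]_4) B C :
  f @ F --> B -> g @ F --> C -> (fun x => twosided (f x) (g x)) @ F --> twosided B C.
Proof.
move=> fB gC; apply: cvg_trmx; apply: cvg_mx_entries => i j.
case/mxvec_indexP: j => a b.
have E (B' : 'M[R]_3) (C' : 'M[R]_4) : lin_mx (mulmxr C' \o mulmx B') i (mxvec_index a b)
    = (B' *m vec_mx (delta_mx 0 i) *m C') a b.
  by rewrite mxE mxvecE.
under eq_fun do rewrite E.
rewrite E; apply: cvg_mx_entry; apply: cvg_mulmx => //.
by apply: cvg_mulmx => //; exact: cvg_cst.
Qed.

End TwoSided.

Section CircleLimits.
Variable R : realType.
Implicit Types (x : R).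

Lemma cvg_inv_succ x : (fun m => x / m.+1%:R) @ \oo --> (0 : R).
Proof.
rewrite -[X in _ --> X](mulr0 x); apply: cvgM; first exact: cvg_cst.
exact: cvg_harmonic.
Qed.

Lemma cvg_first_difference (f : R -> R) (l x : R) : is_derive (0 : R) (1 : R) f l ->
  (fun m => m.+1%:R * (f (x / m.+1%:R) - f 0)) @ \oo --> x * l.
Proof.
move=> df; have [->|x0] := eqVneq x 0.
  under eq_fun do rewrite mul0r subrr mulr0.
  by rewrite mul0r; apply: cvg_cst.
have fl : h^-1 *: (f (h *: 1 + 0) - f 0) @[h --> 0^'] --> l.
  by have [d <-] := df; exact: d.
(* A derivative is a limit over nonzero increments, and these are nonzero because [x] is. *)
have h0 : (fun m => x / m.+1%:R) @ \oo --> (0 : R)^'.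
  move=> A /= A0; have [e e0 eA] := A0.
  have := cvg_inv_succ x; move=> /cvgrPdist_lt /(_ e e0); apply: filterS => m hm.
  by apply: eA => //=; rewrite mulf_neq0 // invr_eq0 pnatr_eq0.
have := cvg_comp _ _ h0 fl.
move=> fl'; have fl'' := cvgM (cvg_cst _ : (fun _ : nat => x) @ \oo --> x) fl'.
have E m : x * ((x / m.+1%:R)^-1 *: (f ((x / m.+1%:R) *: 1 + 0) - f 0)) =
    m.+1%:R * (f (x / m.+1%:R) - f 0).
  have m0 : (m.+1%:R : R) != 0 by rewrite pnatr_eq0.
  rewrite /GRing.scale /= mulr1 addr0 invf_div mulrA; congr (_ * _).
  by rewrite mulrC divfK.
refine (cvg_trans _ (fl'' _ _)); apply: near_eq_cvg; apply: nearW => m; exact: E.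
Qed.

Lemma cvg_sin_quotient x : (fun m => m.+1%:R * sin (x / m.+1%:R)) @ \oo --> x.
Proof.
have := @cvg_first_difference sin 1 x; rewrite mulr1.
under eq_fun do rewrite sin0 subr0.
by apply; have := is_derive_sin (0 : R); rewrite cos0.
Qed.

Lemma cvg_cos_quotient x : (fun m => m.+1%:R * (cos (x / m.+1%:R) - 1)) @ \oo --> (0 : R).
Proof.
have := @cvg_first_difference cos 0 x; rewrite mulr0.
under eq_fun do rewrite cos0.
by apply; have := is_derive_cos (0 : R); rewrite sin0 oppr0.
Qed.

End CircleLimits.

Section ExpCircle.
Variable R : realType.
Variables u1 u2 u3 : R.
Hypothesis u_unit : u1 ^+ 2 + u2 ^+ 2 + u3 ^+ 2 = 1.

(** With the half angle, [qrot] turns by the full angle [t] about [(u1, u2, u3)]. *)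
Definition circle_quat (t : R) : quat R :=
  Quat (cos (t / 2)) (sin (t / 2) * u1) (sin (t / 2) * u2) (sin (t / 2) * u3).

Lemma circle_quatD s t : qmul (circle_quat s) (circle_quat t) = circle_quat (s + t).
Proof.
rewrite /qmul /circle_quat /= mulrDl cosD sinD.
set c := cos _; set c' := cos _; set z := sin _; set z' := sin _.
congr Quat; try ring.
transitivity (c * c' - (u1 ^+ 2 + u2 ^+ 2 + u3 ^+ 2) * (z * z')); first ring.
by rewrite u_unit mul1r.
Qed.

Lemma circle_quat0 : circle_quat 0 = qone R.
Proof. by rewrite /circle_quat mul0r cos0 sin0 !mul0r. Qed.

Lemma circle_quat_norm t : qnorm (circle_quat t) = 1.
Proof.
transitivity (cos (t / 2) ^+ 2 + sin (t / 2) ^+ 2 * (u1 ^+ 2 + u2 ^+ 2 + u3 ^+ 2)).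
  by rewrite /qnorm /circle_quat /=; ring.
by rewrite u_unit mulr1 cos2Dsin2.
Qed.

Definition qact_mx (k : quat R) := twosided (qrot k) (qleft k).

Lemma qact_mx_circle_exp t m : qact_mx (circle_quat t) ^+ m = qact_mx (circle_quat (m%:R * t)).
Proof.
elim: m => [|m IH].
  by rewrite expr0 mul0r circle_quat0 /qact_mx qrot1 qleft1 twosided11.
rewrite exprS IH -[LHS]/(_ *m _) /qact_mx twosided_mulmx -qrotM -qleftM circle_quatD.
by congr (twosided (qrot (circle_quat _)) (qleft (circle_quat _))); rewrite -natr1; ring.
Qed.

Definition dact_mx s1 s2 s3 : 'M[R]_(3 * 4) :=
  twosided (cross_mx s1 s2 s3) 1%:M + 2^-1 *: twosided 1%:M (qleft (Quat 0 s1 s2 s3)).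

Lemma dact_mxE s1 s2 s3 p : dact_mx s1 s2 s3 *m cvec p = cvec (dact s1 s2 s3 p).
Proof.
rewrite /dact_mx mulmxDl -scalemxAl !twosidedE mul1mx mulmx1 /dact.
by rewrite cvecD cvecZ.
Qed.

(** Rodrigues' formula, with [sin t] and [1 - cos t] written in the half angle. *)
Lemma qrot_circle t : qrot (circle_quat t) - 1%:M =
  (2 * cos (t / 2) * sin (t / 2)) *: cross_mx u1 u2 u3 +
  (2 * sin (t / 2) ^+ 2) *: (cross_mx u1 u2 u3 *m cross_mx u1 u2 u3).
Proof.
have h := cos2Dsin2 (t / 2); rewrite /circle_quat; move: h.
move: (cos _) (sin _) => c s h.
have c2 : c ^+ 2 = 1 - s ^+ 2 * (u1 ^+ 2 + u2 ^+ 2 + u3 ^+ 2).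
  by rewrite u_unit mulr1 -h addrK.
by mx_entries; rewrite ?c2; ring.
Qed.

Lemma qleft_circle t : qleft (circle_quat t) - 1%:M =
  (cos (t / 2) - 1) *: 1%:M + sin (t / 2) *: qleft (Quat 0 u1 u2 u3).
Proof. rewrite /circle_quat; mx_ring. Qed.

Lemma cvg_qact_mx_circle t :
  (fun m => m.+1%:R *: (qact_mx (circle_quat (t / m.+1%:R)) - 1%:M)) @ \oo
    --> t *: dact_mx u1 u2 u3.
Proof.
pose c m := cos (t / 2 / m.+1%:R); pose s m := sin (t / 2 / m.+1%:R).
have th m : t / m.+1%:R / 2 = t / 2 / m.+1%:R :> R by rewrite mulrAC.
have ms : (fun m => m.+1%:R * s m) @ \oo --> t / 2.
  exact: cvg_sin_quotient.
have mc : (fun m => m.+1%:R * (c m - 1)) @ \oo --> (0 : R).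
  exact: cvg_cos_quotient.
have c1 : c @ \oo --> (1 : R).
  rewrite -(@cos0 R); apply: (cvg_comp _ _ (cvg_inv_succ (t / 2))).
  exact: continuous_cos.
have s0 : s @ \oo --> (0 : R).
  rewrite -(@sin0 R); apply: (cvg_comp _ _ (cvg_inv_succ (t / 2))).
  exact: continuous_sin.
pose N := cross_mx u1 u2 u3; pose Q := qleft (Quat 0 u1 u2 u3).
have cvgZ m n (f : nat -> R) (a : R) (A : 'M[R]_(m, n)) :
    f @ \oo --> a -> (fun k => f k *: A) @ \oo --> a *: A.
  move=> fa; apply: cvg_mx_entries => i j; under eq_fun do rewrite mxE.
  by rewrite mxE; apply: cvgM => //; exact: cvg_cst.
have lB : (fun m => m.+1%:R *: (qrot (circle_quat (t / m.+1%:R)) - 1%:M)) @ \oo --> t *: N.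
  have E m : m.+1%:R *: (qrot (circle_quat (t / m.+1%:R)) - 1%:M) =
      (2 * (c m * (m.+1%:R * s m))) *: N + (2 * (s m * (m.+1%:R * s m))) *: (N *m N).
    by rewrite qrot_circle scalerDr !scalerA th -/(c m) -/(s m); congr (_ *: _ + _ *: _); ring.
  under eq_fun do rewrite E.
  have -> : t *: N = (2 * (1 * (t / 2))) *: N + (2 * (0 * (t / 2))) *: (N *m N).
    by rewrite mul0r mulr0 scale0r addr0; congr (_ *: _); field.
  by apply: cvgD; apply: cvgZ; apply: cvgM; do ?[exact: cvg_cst]; apply: cvgM.
have lC : (fun m => m.+1%:R *: (qleft (circle_quat (t / m.+1%:R)) - 1%:M)) @ \oo --> (t / 2) *: Q.
  have E m : m.+1%:R *: (qleft (circle_quat (t / m.+1%:R)) - 1%:M) =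
      (m.+1%:R * (c m - 1)) *: 1%:M + (m.+1%:R * s m) *: Q.
    by rewrite qleft_circle scalerDr !scalerA th.
  under eq_fun do rewrite E.
  have -> : (t / 2) *: Q = 0 *: 1%:M + (t / 2) *: Q by rewrite scale0r add0r.
  by apply: cvgD; apply: cvgZ.
have lC1 : (fun m => qleft (circle_quat (t / m.+1%:R))) @ \oo --> (1%:M : 'M[R]_4).
  have E m : qleft (circle_quat (t / m.+1%:R)) = c m *: 1%:M + s m *: Q.
    by rewrite -[LHS](subrK 1%:M) qleft_circle th scalerBl scale1r addrAC subrK.
  under eq_fun do rewrite E.
  have e1 : (1%:M : 'M[R]_4) = 1 *: 1%:M + 0 *: Q by rewrite scale1r scale0r addr0.
  suff : (fun m => c m *: 1%:M + s m *: Q) @ \oo --> 1 *: 1%:M + 0 *: Q by rewrite -e1.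
  by apply: cvgD; apply: cvgZ.
(* The product rule before the limit: [B p C - p = (B p - p) C + (p C - p)]. *)
have E m : m.+1%:R *: (qact_mx (circle_quat (t / m.+1%:R)) - 1%:M) =
    twosided (m.+1%:R *: (qrot (circle_quat (t / m.+1%:R)) - 1%:M))
       (qleft (circle_quat (t / m.+1%:R)))
    + twosided 1%:M (m.+1%:R *: (qleft (circle_quat (t / m.+1%:R)) - 1%:M)).
  apply: twosided_ext => p; rewrite mulmxDl -scalemxAl mulmxBl !twosidedE !mul1mx.
  rewrite -!scalemxAl -scalemxAr mulmxBl mulmxBr mulmxBl mul1mx mulmx1.
  move: (qrot _) (qleft _) => B C.
  rewrite !(cvecZ, cvecD, cvecN) -!scalerDr; congr (_ *: _).
  by rewrite addrA subrK.
under eq_fun do rewrite E.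
have -> : t *: dact_mx u1 u2 u3 = twosided (t *: N) 1%:M + twosided 1%:M ((t / 2) *: Q).
  apply: twosided_ext => p; rewrite -scalemxAl dact_mxE mulmxDl !twosidedE /dact.
  by rewrite !mul1mx mulmx1 -scalemxAl -scalemxAr -cvecD -cvecZ scalerDr scalerA.
by apply: cvgD; apply: cvg_twosided => //; exact: cvg_cst.
Qed.

(** Powers of the circle element at [t / m] return the one at [t], so Euler's approximation runs
    along a constant sequence. *)
Lemma expmx_dact t : expmx (t *: dact_mx u1 u2 u3) = qact_mx (circle_quat t).
Proof.
have moo K : \forall m \near \oo, (K <= m.+1)%N.
  by near=> m; apply: leqW; near: m; exact: nbhs_infty_ge.
have lim := @cvg_qact_mx_circle t; have := cvg_pow_expmx moo lim.
under eq_fun do rewrite qact_mx_circle_exp mulrC divfK ?pnatr_eq0 //.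
move=> h; apply: esym; exact: (cvg_mx_unique (cvg_cst _) (h _)).
Unshelve. all: end_near.
Qed.

End ExpCircle.

HB.instance Definition _ (R : realType) :=
  GRing.isLinear.Build R 'rV[R]_8 'M[R]_(3, 4) _ (@ladder_vec R)
    (@ladder_vec_linear R).

Definition ladder_emb (R : realType) : 'M[R]_(3 * 4, 8) :=
  (lin1_mx (mxvec \o @ladder_vec R))^T.

Lemma ladder_embE (R : realType) (c : 'cV[R]_8) :
  ladder_emb R *m c = cvec (ladder_vec c^T).
Proof. by rewrite -[c in LHS]trmxK -trmx_mul mul_rV_lin1. Qed.

Section ModelAction.
Variables (R : realType) (n : nat) (X1 X2 X3 : 'M[R]_n) (P : 'M[R]_(8, n)).
Hypothesis PX1 : P *m X1 = (ladder_mx1 R)^T *m P.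
Hypothesis PX2 : P *m X2 = (ladder_mx2 R)^T *m P.
Hypothesis PX3 : P *m X3 = (ladder_mx3 R)^T *m P.

Definition model_vec (v : 'cV[R]_n) : 'M[R]_(3, 4) := ladder_vec (P *m v)^T.

Lemma model_vec_exp u1 u2 u3 t v : u1 ^+ 2 + u2 ^+ 2 + u3 ^+ 2 = 1 ->
  model_vec (expmx (t *: (u1 *: X1 + (u2 *: X2 + u3 *: X3))) *m v) =
  qact (circle_quat u1 u2 u3 t) (model_vec v).
Proof.
move=> u_unit; set A := u1 *: X1 + _.
pose E := ladder_emb R; have EE := @ladder_embE R : forall c, E *m c = _.
have EA : E *m P *m (t *: A) = (t *: dact_mx u1 u2 u3) *m (E *m P).
  apply: mulmx_ext => w; rewrite -scalemxAr -!scalemxAl; congr (_ *: _).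
  rewrite -!mulmxA !EE dact_mxE dact_linear mulmxA /A.
  rewrite !mulmxDr -!scalemxAr PX1 PX2 PX3 !mulmxDl -!scalemxAl -!mulmxA.
  congr cvec.
  have tE (L : 'M[R]_8) : (L^T *m (P *m w))^T = (P *m w)^T *m L.
    by rewrite [LHS]trmx_mul trmxK.
  rewrite ladder_vec_dact1 ladder_vec_dact2 ladder_vec_dact3.
  by rewrite !linearD !linearZ /= !tE addrA.
apply: cvec_inj; rewrite /model_vec -EE !mulmxA (expmx_intertwine EA) expmx_dact //.
by rewrite -!mulmxA EE twosidedE.
Qed.

End ModelAction.

(** * The orbit space *)

Section OrbitTopology.
Variables (R : realType) (n : nat) (G : compact_orthogonal_group R n).

(** The elements of [G] preserving [f] form a closed subgroup that contains every [exp A]. *)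
Lemma invariant_of_lie (Y : topologicalType) (f : 'cV[R]_n -> Y) :
  hausdorff_space Y -> continuous f -> connected (G : set 'M[R]_n) ->
  (forall A v, lie_algebra G A -> f (expmx A *m v) = f v) ->
  forall g v, (G : set _) g -> f (g *m v) = f v.
Proof.
move=> hY cf Gconn flie.
pose H : set 'M[R]_n := (G : set 'M[R]_n) `&` \bigcap_v [set g | f (g *m v) = f v].
suff HG : H = G by move=> g v; rewrite -HG => -[_ /(_ v I)].
apply: closed_subgroup_full => //.
- by move=> g [].
- apply: closedI; first exact: group_carrier_closed.
  apply: closed_bigI => v _.
  suff : closed ((fun g : 'M[R]_n => f (g *m v)) @^-1` [set f v]) by [].
  apply: preimage_closed; last exact: (compact_closed hY (@compact_set1 Y (f v))).
  move=> g _; apply: (@continuous_comp _ _ _ (fun g : 'M[R]_n => g *m v) f); last exact: cf.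
  have ev : continuous (fun g : 'M[R]_n => g *m v).
    apply: continuous_fun_mulmx; last exact: continuous_mx_cst.
    by move=> h; exact: cvg_id.
  exact: ev.
- by split; [exact: group_one | move=> v _ /=; rewrite mul1mx].
- move=> g h [Gg fg] [Gh fh]; split; first exact: group_mul.
  by move=> v _ /=; rewrite -mulmxA fg // fh.
- move=> g [Gg fg]; split; first exact: group_tr.
  move=> v _ /=; rewrite -(fg (g^T *m v)) // mulmxA.
  by have /mulmx1C -> := group_orthogonal Gg; rewrite mul1mx.
- move=> A lA; split; first by have := lA 1; rewrite scale1r.
  by move=> v _ /=; exact: flie.
Qed.

(** For the inverse: near [y] all fibres lie in one ball, so only a compact set of points outside a
    given open set of orbits matters; its image is closed and misses [y]. *)
Lemma orbit_space_homeomorphic (Y : topologicalType) (f : 'cV[R]_n -> Y) :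
  hausdorff_space Y -> continuous f ->
  (forall v w, f v = f w <-> exists2 g, (G : set _) g & w = g *m v) ->
  (forall y, exists v, f v = y) ->
  (forall y : Y, exists c : R, \forall z \near y, forall v, f v = z -> `|v| <= c) ->
  homeomorphic (orbit_space G) Y.
Proof.
move=> hY cf fP fsurj fproper.
pose pi : 'cV[R]_n -> orbit_space G := \pi_({eq_quot orbit_equiv G})%qT.
have piE v w : (pi v = pi w) <-> f v = f w.
  split.
    by move=> /eqquotP /asboolP /fP.
  by move=> /fP h; apply/eqquotP; apply/asboolP.
pose s y := projT1 (cid (fsurj y)).
have fs y : f (s y) = y by rewrite /s; case: cid.
pose F (q : orbit_space G) := f (repr q).
have Fpi v : F (pi v) = f v.
  by apply/piE; exact: reprK.
exists F, (fun y => pi (s y)); split.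
- apply/quotient_continuous.
  have -> : F \o \pi_(orbit_space G)%qT = f by apply: funext => v; exact: Fpi.
  exact: cf.
- move=> y A; rewrite nbhsE => -[B [oB By] BA].
  have [c cP] := fproper y.
  pose C := [set v : 'cV[R]_n | `|v| <= c] `&` ~` (pi @^-1` B).
  have fCcl : closed (f @` C).
    apply: (compact_closed hY); apply: mx_continuous_compact => //.
    apply: (@mx_bounded_closed_compact R n 1 C c) => [v []|]; first by [].
    apply: closedI.
      suff : closed ((fun v : 'cV[R]_n => `|v|) @^-1` [set x | x <= c]) by [].
      by apply: preimage_closed; [move=> v _; exact: norm_continuous | exact: closed_le].
    by apply: open_closedC; exact: oB.
  have yC : ~ (f @` C) y.
    move=> [v [_ nO] fv]; apply: nO => /=.
    have -> : pi v = pi (s y) by apply/piE; rewrite fs.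
    exact: By.
  have : nbhs y (~` (f @` C)) by apply: open_nbhs_nbhs; split => //; exact: closed_openC.
  rewrite nbhs_simpl /= => nC; near=> z; apply: BA; apply: contrapT => nO.
  have : ~ (f @` C) z by near: z.
  apply; exists (s z); last exact: fs.
  split => //=; have h : forall v, f v = z -> `|v| <= c by near: z.
  exact: h.
- move=> q; rewrite -[q in RHS]reprK; apply/piE; exact: fs.
- by move=> y; rewrite Fpi.
Unshelve. all: end_near.
Qed.

End OrbitTopology.

Section UnitQuaternionCircles.
Variable R : realType.

Lemma polar_coordinates (s1 s2 s3 : R) : exists u1 u2 u3,
  u1 ^+ 2 + u2 ^+ 2 + u3 ^+ 2 = 1 /\
  let t := Num.sqrt (s1 ^+ 2 + s2 ^+ 2 + s3 ^+ 2) in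
  [/\ s1 = t * u1, s2 = t * u2 & s3 = t * u3].
Proof.
have sq0 : 0 <= s1 ^+ 2 + s2 ^+ 2 + s3 ^+ 2.
  by rewrite !addr_ge0 // sqr_ge0.
set t := Num.sqrt _; have tt : t ^+ 2 = s1 ^+ 2 + s2 ^+ 2 + s3 ^+ 2 by rewrite sqr_sqrtr.
have [t0|t0] := eqVneq t 0.
  exists 1, 0, 0; split; first by rewrite expr1n expr0n !addr0.
  have := sqr_ge0 s1; have := sqr_ge0 s2; have := sqr_ge0 s3.
  move: tt; rewrite t0 expr0n /= => tt *.
  by rewrite !mul0r; split; apply/eqP; rewrite -sqrf_eq0; apply/eqP; lra.
exists (s1 / t), (s2 / t), (s3 / t); split; last by split; rewrite -/t mulrC divfK.
by rewrite !expr_div_n -!mulrDl -tt divff // expf_neq0.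
Qed.

(** Every unit quaternion lies on a circle through 1, so a single exponential realizes it. *)
Lemma unit_quat_circle (k : quat R) : qnorm k = 1 ->
  exists u1 u2 u3 t, u1 ^+ 2 + u2 ^+ 2 + u3 ^+ 2 = 1 /\ k = circle_quat u1 u2 u3 t.
Proof.
move=> k1; have [u1 [u2 [u3 [uu]]]] := polar_coordinates (q1 k) (q2 k) (q3 k).
have [k0 _ _ _] := qnorm_entry_le k1; move: k0; rewrite ler_norml => k0.
have -> : q1 k ^+ 2 + q2 k ^+ 2 + q3 k ^+ 2 = 1 - q0 k ^+ 2 by rewrite -k1 /qnorm; ring.
move=> [e1 e2 e3]; exists u1, u2, u3, (2 * acos (q0 k)); split => //.
rewrite /circle_quat mulrAC divff ?pnatr_eq0 // mul1r sin_acos // acosK ?in_itv //.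
by rewrite -e1 -e2 -e3; case: (k).
Qed.

End UnitQuaternionCircles.

Section InjectiveBound.
Variable R : realType.

Lemma injective_mx_bound m n (S : 'M[R]_(m, n)) :
  (forall v : 'cV[R]_n, S *m v = 0 -> v = 0) ->
  exists2 c : R, 0 <= c & forall v : 'cV[R]_n, `|v| <= c * `|S *m v|.
Proof.
move=> Sinj; have free : row_free S^T.
  apply: inj_row_free => v /(congr1 trmx); rewrite trmx_mul trmxK trmx0.
  by move=> /Sinj /(congr1 trmx); rewrite trmxK trmx0.
pose T := (pinvmx S^T)^T.
have TS : T *m S = 1%:M by rewrite -[S]trmxK -trmx_mul mulmxVp // trmx1.
exists (m%:R * `|T|); first by rewrite mulr_ge0.
by move=> v; rewrite -mulrA -{1}[v]mul1mx -TS -mulmxA; exact: norm_mulmx_le.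
Qed.

Lemma norm_cvec_le (p : 'M[R]_(3, 4)) : `|cvec p| <= `|p|.
Proof.
apply: mx_norm_le => // i j; rewrite mxE ord1; case/mxvec_indexP: i => a b.
by rewrite mxvecE; exact: mx_entry_le_norm.
Qed.

Lemma norm_col_mx_le m1 m2 n (A : 'M[R]_(m1, n)) (B : 'M[R]_(m2, n)) :
  `|col_mx A B| <= `|A| + `|B|.
Proof.
apply: mx_norm_le => [|i j]; first by rewrite addr_ge0.
by rewrite mxE; case: fintype.split => k;
  rewrite (le_trans (mx_entry_le_norm _ _ _)) // ?lerDl ?lerDr.
Qed.

End InjectiveBound.

(** * The invariants of the group and its orbit space *)

Section OrbitInvariants.
Variables (R : realType) (n m : nat) (G : compact_orthogonal_group R n).
Variables (X1 X2 X3 : 'M[R]_n) (P : 'M[R]_(8, n)) (K : 'M[R]_(m, n)).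
Hypothesis lieP : forall A, lie_algebra G A <->
  exists s1 s2 s3, A = s1 *: X1 + (s2 *: X2 + s3 *: X3).
Hypothesis PX1 : P *m X1 = (ladder_mx1 R)^T *m P.
Hypothesis PX2 : P *m X2 = (ladder_mx2 R)^T *m P.
Hypothesis PX3 : P *m X3 = (ladder_mx3 R)^T *m P.
Hypothesis KX1 : K *m X1 = 0.
Hypothesis KX2 : K *m X2 = 0.
Hypothesis KX3 : K *m X3 = 0.
Hypothesis PKsurj : forall r w, exists2 v : 'cV[R]_n, P *m v = r & K *m v = w.
Hypothesis PKinj : forall v : 'cV[R]_n, P *m v = 0 -> K *m v = 0 -> v = 0.
Hypothesis Gconn : connected (G : set 'M[R]_n).

Definition orbit_invariants (v : 'cV[R]_n) : 'cV[R]_5 * 'cV[R]_m :=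
  (invariants (model_vec P v), K *m v).

Let KA A : lie_algebra G A -> K *m A = 0.
Proof.
move=> /lieP [s1 [s2 [s3 ->]]].
by rewrite !mulmxDr -!scalemxAr KX1 KX2 KX3 !scaler0 !addr0.
Qed.

Lemma fixed_coordinates_exp A (v : 'cV[R]_n) : lie_algebra G A -> K *m (expmx A *m v) = K *m v.
Proof.
move=> /KA KA0; have /expmx_intertwine : K *m A = 0 *m K by rewrite KA0 mul0mx.
by rewrite mulmxA expmx0 mul1mx => ->.
Qed.

Lemma orbit_invariants_exp A v : lie_algebra G A ->
  orbit_invariants (expmx A *m v) = orbit_invariants v.
Proof.
move=> lA; congr pair; last exact: fixed_coordinates_exp.
have /lieP [s1 [s2 [s3 AE]]] := lA.
have [u1 [u2 [u3 [uu [e1 e2 e3]]]]] := polar_coordinates s1 s2 s3.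
have -> : A = Num.sqrt (s1 ^+ 2 + s2 ^+ 2 + s3 ^+ 2) *: (u1 *: X1 + (u2 *: X2 + u3 *: X3)).
  by rewrite AE !scalerDr !scalerA -e1 -e2 -e3.
by rewrite model_vec_exp // invariants_qact // circle_quat_norm.
Qed.

Lemma continuous_model_vec : continuous (model_vec P).
Proof.
apply: continuous_mx_entries => i j.
have E v : model_vec P v i j = (ladder_emb R *m (P *m v)) (mxvec_index i j) 0.
  by rewrite ladder_embE [RHS]mxE mxvecE.
under eq_fun do rewrite E.
apply: continuous_fun_entry; do 2?[apply: continuous_fun_mulmx; first exact: continuous_mx_cst].
by move=> v; exact: cvg_id.
Qed.

Lemma continuous_invariants_model_vec :
  continuous (fun v => invariants (model_vec P v)).
Proof.
move=> v; apply: (@continuous_comp _ _ _ (model_vec P) (@invariants R)).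
  exact: continuous_model_vec.
exact: continuous_invariants.
Qed.

Lemma continuous_orbit_invariants : continuous orbit_invariants.
Proof.
have cK : continuous (mulmx K : 'cV[R]_n -> 'cV[R]_m).
  apply: continuous_fun_mulmx; first exact: continuous_mx_cst.
  by move=> w; exact: cvg_id.
move=> v A vA; exact: (cvg_pair (@continuous_invariants_model_vec v) (cK v) vA).
Qed.

Lemma model_vec_inj v : model_vec P v = 0 -> K *m v = 0 -> v = 0.
Proof.
by move=> /ladder_vec_inj /(congr1 trmx); rewrite trmxK trmx0; exact: PKinj.
Qed.

Lemma model_vecB v w : model_vec P (v - w) = model_vec P v - model_vec P w.
Proof. by rewrite /model_vec mulmxBr !linearB. Qed.

(** Equal invariants give a unit quaternion between the model points; it is one exponential from the
    Lie algebra, which leaves [K] unchanged and therefore carries all of [v] to [w]. *)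
Lemma orbit_invariantsP v w : orbit_invariants v = orbit_invariants w <->
  exists2 g, (G : set _) g & w = g *m v.
Proof.
split=> [[iE KE]|[g Gg ->]]; last first.
  have h := @norm_hausdorff R ('cV[R]_5 * 'cV[R]_m)%type.
  by rewrite (invariant_of_lie h continuous_orbit_invariants Gconn orbit_invariants_exp).
have [k k1 kE] := invariants_inj (gamma_ladder_vec _) (gamma_ladder_vec _) iE.
have [u1 [u2 [u3 [t [uu kc]]]]] := unit_quat_circle k1.
pose A := t *: (u1 *: X1 + (u2 *: X2 + u3 *: X3)).
have lA : lie_algebra G A.
  by apply/lieP; exists (t * u1), (t * u2), (t * u3); rewrite /A !scalerDr !scalerA.
exists (expmx A); first by have := lA 1; rewrite scale1r.
apply/eqP; rewrite -subr_eq0; apply/eqP; apply: model_vec_inj.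
  by rewrite model_vecB model_vec_exp // -kc -kE subrr.
by rewrite mulmxBr fixed_coordinates_exp // KE subrr.
Qed.

Lemma orbit_invariants_surj y : exists v, orbit_invariants v = y.
Proof.
case: y => x w; have [p p0 <-] := invariants_surj x.
have [r ->] := ladder_vec_surj p0; have [v Pv Kv] := PKsurj r^T w.
by exists v; rewrite /orbit_invariants /model_vec Pv Kv trmxK.
Qed.

Lemma orbit_invariants_proper (c1 c2 : R) : exists c, forall v,
  `|invariants (model_vec P v)| <= c1 -> `|K *m v| <= c2 -> `|v| <= c.
Proof.
have [c' c'P] := invariants_proper c1.
have [v|c c0 cP] := @injective_mx_bound R _ _ (col_mx (ladder_emb R *m P) K).
  rewrite mul_col_mx -mulmxA ladder_embE => /eqP.
  rewrite -[0]vsubmxK => /eqP /eq_col_mx; rewrite linear0 linear0 => -[pv kv].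
  apply: model_vec_inj kv; apply: cvec_inj; rewrite [LHS]pv.
  by rewrite /cvec !linear0.
exists (c * (c' + c2)) => v iv kv; apply: le_trans (cP v) _.
apply: ler_wpM2l => //; rewrite mul_col_mx -mulmxA ladder_embE.
apply: le_trans (norm_col_mx_le _ _) _; apply: lerD => //.
apply: le_trans (norm_cvec_le _) _.
by apply: c'P => //; exact: gamma_ladder_vec.
Qed.

Lemma orbit_space_prod : homeomorphic (orbit_space G) ('cV[R]_5 * 'cV[R]_m)%type.
Proof.
apply: (@orbit_space_homeomorphic R n G _ orbit_invariants).
- exact (@norm_hausdorff R ('cV[R]_5 * 'cV[R]_m)%type).
- exact: continuous_orbit_invariants.
- exact: orbit_invariantsP.
- exact: orbit_invariants_surj.
- move=> y; have [c cP] := orbit_invariants_proper (`|y.1| + 1) (`|y.2| + 1).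
  exists c; near=> z => v vz; apply: cP.
    rewrite -[invariants _]/(orbit_invariants v).1 vz; near: z.
    by apply: cvgr_norm_le; [exact: cvg_fst | rewrite ltrDl].
  rewrite -[K *m v]/(orbit_invariants v).2 vz; near: z.
  by apply: cvgr_norm_le; [exact: cvg_snd | rewrite ltrDl].
Unshelve. all: end_near.
Qed.

Lemma orbit_space_cV5 : m = 0%N -> homeomorphic (orbit_space G) 'cV[R]_5.
Proof.
move=> m0; have K0 (v : 'cV[R]_n) : K *m v = 0.
  by apply/colP => i; have := ltn_ord i; rewrite {2}m0.
apply: (@orbit_space_homeomorphic R n G _ (fun v => invariants (model_vec P v))).
- exact: norm_hausdorff.
- exact: continuous_invariants_model_vec.
- move=> v w; rewrite -orbit_invariantsP /orbit_invariants !K0.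
  by split=> [->|[]].
- by move=> y; have [v [vy _]] := orbit_invariants_surj (y, 0); exists v.
- move=> y; have [c cP] := orbit_invariants_proper (`|y| + 1) 0.
  exists c; near=> z => v vz; apply: cP; last by rewrite K0 normr0.
  rewrite vz; near: z.
  by apply: cvgr_norm_le; [exact: cvg_id | rewrite ltrDl].
Unshelve. all: end_near.
Qed.

End OrbitInvariants.

(** [V0] is the space killed by the Lie algebra, and [count] and [nth] encode [l = 1] and [n_1 = 8].
    One-dimensional components lie in [V0] and survive in the orbit space: the printed [R^5] is the
    case [V0 = 0], and the second conjunct is the general one. *)
Theorem mainTheorem8 (R : realType) (n : nat) (G : compact_orthogonal_group R n)
    (d : seq nat) (V0 : {vspace 'cV[R]_n}) :
  irreducible_dimensions (lie_algebra G) d ->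
  (forall v : 'cV[R]_n,
     v \in V0 <-> (forall A, lie_algebra G A -> A *m v = 0)) ->
  isomorphic_to_su 2 (lie_algebra G) ->
  identity_component G = G ->
  count (fun m => (1 < m)%N) d = 1%N ->
  nth 0%N d 0 = 8%N ->
  (V0 = 0%VS -> homeomorphic (orbit_space G) 'cV[R]_5) /\
  homeomorphic (orbit_space G) ('cV[R]_5 * 'cV[R]_(\dim V0))%type.
Proof.
move=> irrd V0P su2 /connected_of_identity_component Gconn cd d0.
have [X1 [X2 [X3 [P [K [lieP [PX1 PX2 PX3] [KX1 KX2 KX3] PKsurj PKinj]]]]]] :=
  model_coordinates irrd V0P su2 cd d0.
split=> [V00|]; last exact: orbit_space_prod lieP PX1 PX2 PX3 KX1 KX2 KX3 PKsurj PKinj Gconn.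
apply: orbit_space_cV5 lieP PX1 PX2 PX3 KX1 KX2 KX3 PKsurj PKinj Gconn _.
by rewrite V00 dimv0.
Qed.
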